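(* Let $q\geq2$ be an integer, let $H\in(0,\frac{2q-1}{2q})$, let $B$ be a fractional Brownian motion on $[0,1]$ with Hurst index $H$, and define $$ Z_n=\frac{1}{\sigma\sqrt{n}}\sum_{k=0}^{n-1}H_q\big(n^H(B_{(k+1)/n}-B_{k/n})\big),\quad n\geq1,\qquad \sigma=\sqrt{\frac1{q!}\sum_{t\in\mathbb Z}\rho_H(t)^q}. $$ Then, as $n\rightarrow\infty$, $Z_n$ converges in law towards $Z\sim\mathscr{N}(0,1)$. Moreover, there exists a constant $c_H$, depending uniquely on $H$ (for the fixed $q$), such that, for any $n\geq 1$, $$ \sup_{z\in\mathbb R}|P(Z_n\leq z)-P(Z\leq z)| \leq c_H \times \begin{cases} n^{-\frac12} & \text{if } H\in (0,\frac12],\\ n^{H-1} & \text{if } H\in [\frac12,\frac{2q-3}{2q-2}],\\ n^{qH-q+\frac12} & \text{if } H\in [\frac{2q-3}{2q-2},\frac{2q-1}{2q}). \end{cases} $$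
   Context: A fractional Brownian motion $B=\{B_t:t\in[0,1]\}$ of Hurst index $H\in(0,1)$ is a centered Gaussian process started from zero with covariance $E(B_sB_t)=\frac12(t^{2H}+s^{2H}-|t-s|^{2H})$. For $k\in\mathbb Z$, $\rho_H(k)=\frac12(|k+1|^{2H}+|k-1|^{2H}-2|k|^{2H})$. $H_q$ denotes the $q$th Hermite polynomial with the normalization $H_q(x)=\frac{(-1)^q}{q!}e^{x^2/2}\frac{d^q}{dx^q}e^{-x^2/2}$ (e.g. $H_2(x)=(x^2-1)/2$). *)

(* Defs.v *)
From HB Require Import structures.
From mathcomp Require Import all_boot all_order all_algebra.
From mathcomp Require Import all_classical all_reals all_analysis measurable_realfun.
From mathcomp Require Import ring lra.
Set Implicit Arguments.
Unset Strict Implicit.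
Unset Printing Implicit Defensive.
Import Order.TTheory GRing.Theory Num.Theory.
Import numFieldNormedType.Exports.
Local Open Scope classical_set_scope.
Local Open Scope ring_scope.

Section laws.
Context {R : realType} {d : measure_display} {T : measurableType d}.
Variable P : probability T R.

(* Laws are compared on measurable sets only: a measure of the library is a
   function on all sets whose values on nonmeasurable sets carry no meaning. *)
Definition has_normal_law (X : {RV P >-> R}) (m s : R) : Prop :=
  forall A : set R, measurable A -> distribution P X A = normal_prob m s A.

(* The degenerate case is separate because [normal_prob m 0] is the uniform
   law on [0, 1], not the point mass at m. *)
Definition is_gaussian (X : {RV P >-> R}) : Prop :=
  (exists m s : R, 0 < s /\ has_normal_law X m s) \/
  (exists m : R, {ae P, forall w, X w = m}).

Definition lin_comb (N : nat) (a : 'I_N -> R) (X : 'I_N -> {RV P >-> R}) :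
    {RV P >-> R} :=
  \sum_(i < N) ((cst (a i) : {mfun T >-> R}) * (X i : {mfun T >-> R})).

Lemma lin_combE (N : nat) (a : 'I_N -> R) (X : 'I_N -> {RV P >-> R}) (w : T) :
  lin_comb a X w = \sum_(i < N) a i * X i w.
Proof. exact: mfun_sum. Qed.

(* A process on [0, 1] is given as a family indexed by R of which only the
   members with index in [0, 1] matter. *)
Definition gaussian_process01 (B : R -> {RV P >-> R}) : Prop :=
  forall (N : nat) (t a : 'I_N -> R), (forall i, 0 <= t i <= 1) ->
    is_gaussian (lin_comb a (fun i => B (t i))).

Record fBm (H : R) (B : R -> {RV P >-> R}) : Prop := {
  fBm_gaussian : gaussian_process01 B;
  fBm_centered : forall t, 0 <= t <= 1 -> ('E_P[B t] = 0)%E;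
  fBm_start : {ae P, forall w, B 0 w = 0};
  fBm_cov : forall s t, 0 <= s <= 1 -> 0 <= t <= 1 ->
    ('E_P[(fun w => B s w * B t w)%R] =
     (2^-1 * (t `^ (2 * H) + s `^ (2 * H) - `|t - s| `^ (2 * H)))%:E)%E }.

End laws.

Definition cvg_in_law {R : realType}
    {d : measure_display} {T : measurableType d} {P : probability T R}
    {d' : measure_display} {T' : measurableType d'} {Q : probability T' R}
    (X : nat -> {RV P >-> R}) (Z : {RV Q >-> R}) : Prop :=
  forall f : R -> R, continuous f -> bounded_fun f ->
    ('E_P[f \o X n] @[n --> \oo] --> 'E_Q[f \o Z])%E.

Section hermite.
Context {R : realType}.

Definition hermite (q : nat) (x : R) : R :=
  (-1) ^+ q / q`!%:R * expR (x ^+ 2 / 2) *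
  derive1n q (fun y : R => expR (- (y ^+ 2 / 2))) x.

Fixpoint gauss_factor (q : nat) : {poly R} :=
  if q is p.+1 then (gauss_factor p)^`() - 'X * gauss_factor p else 1.

Lemma derive1n_gauss (q : nat) :
  derive1n q (fun y : R => expR (- (y ^+ 2 / 2))) =
  (fun y => (gauss_factor q).[y] * expR (- (y ^+ 2 / 2))).
Proof.
elim: q => [|q IH].
  by rewrite derive1n0; apply/funext => y /=; rewrite hornerC mul1r.
rewrite derive1nS IH; apply/funext => y; rewrite derive1E.
have dg : is_derive y (1 : R) (fun z : R => expR (- (z ^+ 2 / 2)))
    (- y * expR (- (y ^+ 2 / 2))).
  have d1 : is_derive y (1 : R) (fun z : R => - (z ^+ 2 / 2)) (- y).
    rewrite (_ : (fun z : R => _) = horner (- (2^-1 *: 'X^2))); last first.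
      by apply/funext => z; rewrite !hornerE /=; field.
    rewrite (_ : - y = (- (2^-1 *: 'X^2))^`().[y]); first exact: is_derive_poly.
    by rewrite derivN derivZ derivXn !hornerE; field.
  have := @is_derive1_comp _ expR (fun z : R => - (z ^+ 2 / 2)) y _ _ _ d1.
  by move=> /(_ _ (is_derive_expR _)); rewrite mulrC.
have dp := is_derive_poly (gauss_factor q) y.
have /@derive_val -> := is_deriveM dp dg.
by rewrite /GRing.scale /= !hornerE /=; ring.
Qed.

Lemma hermiteE (q : nat) (x : R) :
  hermite q x = (-1) ^+ q / q`!%:R * (gauss_factor q).[x].
Proof.
rewrite /hermite derive1n_gauss -mulrA; congr (_ * _).
by rewrite mulrCA -expRD subrr expR0 mulr1.
Qed.

Lemma hermite2 (x : R) : hermite 2 x = (x ^+ 2 - 1) / 2.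
Proof.
rewrite hermiteE /= /factorial /= derivC sub0r mulr1 derivN derivX.
by rewrite !hornerE; field.
Qed.

Lemma measurable_hermite (q : nat) : measurable_fun [set: R] (hermite q).
Proof.
rewrite (_ : hermite q =
    (fun x => (-1) ^+ q / q`!%:R * (gauss_factor q).[x])); last first.
  by apply/funext => x; exact: hermiteE.
apply: measurable_funM => //.
apply: continuous_measurable_fun => x; exact: continuous_horner.
Qed.

End hermite.

Section variations.
Context {R : realType}.

Definition rho (H : R) (k : int) : R :=
  2^-1 * (`|k%:~R + 1| `^ (2 * H) + `|k%:~R - 1| `^ (2 * H)
          - 2 * `|k%:~R| `^ (2 * H)).

(* Sum of an absolutely summable real family indexed by Z. *)
Definition sumZ (f : int -> R) : R :=
  fine (\esum_(k in [set: int]) (EFin \o f)^\+ k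
        - \esum_(k in [set: int]) (EFin \o f)^\- k)%E.

Definition sigma (q : nat) (H : R) : R :=
  Num.sqrt (q`!%:R^-1 * sumZ (fun t => rho H t ^+ q)).

Context {d : measure_display} {T : measurableType d} {P : probability T R}.

Definition Z_fun (q : nat) (H : R) (B : R -> {RV P >-> R}) (n : nat) (w : T) :
    R :=
  (sigma q H * Num.sqrt n%:R)^-1 *
  \sum_(0 <= k < n)
     hermite q (n%:R `^ H * (B (k.+1%:R / n%:R) w - B (k%:R / n%:R) w)).

Lemma measurable_Z_fun (q : nat) (H : R) (B : R -> {RV P >-> R}) (n : nat) :
  measurable_fun [set: T] (Z_fun q H B n).
Proof.
apply: measurable_funM => //; apply: measurable_sum => k.
apply: (measurableT_comp (measurable_hermite q)).
by apply: measurable_funM => //; apply: measurable_funB.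
Qed.

HB.instance Definition _ (q : nat) (H : R) (B : R -> {RV P >-> R}) (n : nat) :=
  isMeasurableFun.Build _ _ _ _ (Z_fun q H B n) (measurable_Z_fun q H B n).

Definition Z_ (q : nat) (H : R) (B : R -> {RV P >-> R}) (n : nat) :
    {RV P >-> R} := Z_fun q H B n.

End variations.

Definition kolmogorov_dist {R : realType}
    {d : measure_display} {T : measurableType d} {P : probability T R}
    {d' : measure_display} {T' : measurableType d'} {Q : probability T' R}
    (X : {RV P >-> R}) (Z : {RV Q >-> R}) : \bar R :=
  ereal_sup (range (fun z : R =>
    `|P [set w | (X w <= z)%R] - Q [set w | (Z w <= z)%R]|%E)).

(* Main.v *)
Require Import Defs.
From HB Require Import structures.
From mathcomp Require Import all_boot all_order all_algebra.
From mathcomp Require Import all_classical all_reals all_analysis.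
From mathcomp Require Import measurable_realfun ring lra zify.
Import Order.TTheory GRing.Theory Num.Theory.
Import numFieldNormedType.Exports.
Local Open Scope classical_set_scope.
Local Open Scope ring_scope.
Set Implicit Arguments.
Unset Strict Implicit.
Unset Printing Implicit Defensive.

(** The normalized increments [X k] of the fractional Brownian motion over
   [[k/n, (k+1)/n]] form a Gaussian vector of unit variances and covariances
   [rho H (k - l)], and [Z_n] is [kappa] times the sum of the [H_q (X k)], where
   [kappa = 1 / (sigma * sqrt n)]. The argument is that of Nourdin and Peccati: Stein's
   method, fed by Gaussian integration by parts, here in finitely many variables.

   Integration by parts reads [E (X k * g) = E (D_k g)], where the derivation [D_k] sends
   [X j] to its covariance with [X k]. It follows, for trigonometric functions of linear
   forms, from differentiating the characteristic function, and extends by approximation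
   to functions of polynomial growth ([ibp_comp], [ibp_fun_sum]). With the Hermite
   recursion it gives [E (F f(F)) = E (G f'(F))] for [F = Z_n], where [G] is [kappa^2 / q]
   times the sum over [k, l] of [rho (k - l) H_(q-1)(X k) H_(q-1)(X l)]
   ([stein_identity]).

   If [h] is continuous with [|h| <= M], Stein's equation [f' - x f = h - E h(Z)] has a C1
   solution with [|f'| <= 4 M] ([stein_solution]). Hence [|E h(F) - E h(Z)|] is at most
   [4 M E |1 - G|] ([stein_bound]). As only the supremum of [h] enters, this yields the
   convergence in law and, with continuous ramps in the place of the indicators of
   half-lines, a bound of the same order on the Kolmogorov distance
   ([kolmogorov_dist_smooth]).

   It remains to bound [E |1 - G|] by a multiple of [n^-delta], where [-delta] is the
   exponent of the theorem ([stein_factor_rate]). The mean of [G] is a Cesaro average of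
   the partial sums of the series of the [rho(t)^q], divided by its sum: it tends to 1, and
   the rate comes from [|rho t| <= 4 t^(2H-2)] for [t > 0]. For the variance of [G], integration by
   parts turns moments of products of Hermite polynomials into sums over diagrams
   ([hermite_wick_rec], [wick_cov_bound]); for four factors of equal degree these leave the
   sums over [k, j, i, l] of the products of [|rho(k-j) rho(i-l)|^r] and
   [|rho(k-i) rho(j-l)|^s] with [r, s > 0] and [r + s = q]. For [r <= s] the inequality
   [2 a b <= a^2 + b^2] bounds such a sum by a multiple of [n S_s^2 S_2r], where [S_m] is
   the sum of the [|rho(t)|^m] over [t < n] ([quad_sum_le]), and the decay of [rho] bounds
   this by a multiple of [n^(2 - 2 delta)] ([quad_sum_rate]). At [H = 1/2] the increments
   are independent, and any decay exponent may be used for [rho]; [2] avoids the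
   logarithm of the critical exponent [1]. *)

(** * Calculus on the real line *)

Section derive_pointwise.
Context {R : realType}.
Implicit Types (f g : R -> R) (x a b : R).

(** The rules of differentiation for functions written as lambda terms, the form in which
   they occur below, rather than as sums and products of functions. *)
Lemma der_cst (c : R) x : is_derive x (1 : R) (fun _ : R => c) 0.
Proof. exact: is_derive_cst. Qed.

Lemma der_id x : is_derive x (1 : R) (fun y : R => y) 1.
Proof. exact: is_derive_id. Qed.

Lemma derD f g x a b : is_derive x (1 : R) f a -> is_derive x (1 : R) g b ->
  is_derive x (1 : R) (fun y => f y + g y) (a + b).
Proof. exact: is_deriveD. Qed.

Lemma derN f x a : is_derive x (1 : R) f a ->
  is_derive x (1 : R) (fun y => - f y) (- a).
Proof. exact: is_deriveN. Qed.

Lemma derB f g x a b : is_derive x (1 : R) f a -> is_derive x (1 : R) g b ->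
  is_derive x (1 : R) (fun y => f y - g y) (a - b).
Proof. exact: is_deriveB. Qed.

Lemma derM f g x a b : is_derive x (1 : R) f a -> is_derive x (1 : R) g b ->
  is_derive x (1 : R) (fun y => f y * g y) (a * g x + f x * b).
Proof.
move=> df dg; apply: is_derive_eq (is_deriveM df dg) _.
by rewrite /GRing.scale/= addrC (mulrC a).
Qed.

Lemma derZ c f x a : is_derive x (1 : R) f a ->
  is_derive x (1 : R) (fun y => c * f y) (c * a).
Proof. exact: is_deriveZ. Qed.

Lemma der_comp f g x a b : is_derive x (1 : R) g b ->
  is_derive (g x) (1 : R) f a -> is_derive x (1 : R) (fun y => f (g y)) (a * b).
Proof. by move=> dg df; exact: is_derive1_comp. Qed.

Lemma der_sqr x : is_derive x (1 : R) (fun y => y ^+ 2) (2 * x).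
Proof.
rewrite (_ : (fun y : R => y ^+ 2) = (fun y => y * y)); last first.
  by apply/funext => y; rewrite expr2.
by apply: is_derive_eq (derM (der_id x) (der_id x)) _; ring.
Qed.

Lemma der_continuous f f' : (forall x, is_derive x (1 : R) f (f' x)) ->
  continuous f.
Proof.
by move=> df x; apply/differentiable_continuous/derivable1_diffP; apply: ex_derive.
Qed.

Lemma contD f g : continuous f -> continuous g ->
  continuous (fun x => f x + g x).
Proof. by move=> cf cg x; apply: (@cvgD _ R^o); [exact: cf|exact: cg]. Qed.

Lemma contB f g : continuous f -> continuous g ->
  continuous (fun x => f x - g x).
Proof. by move=> cf cg x; apply: (@cvgB _ R^o); [exact: cf|exact: cg]. Qed.

Lemma contM f g : continuous f -> continuous g ->
  continuous (fun x => f x * g x).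
Proof. by move=> cf cg x; apply: cvgM; [exact: cf|exact: cg]. Qed.

Lemma contZ c f : continuous f -> continuous (fun x => c * f x).
Proof. by move=> cf; apply: contM => // x; exact: cvg_cst. Qed.

Lemma cont_comp f g : continuous f -> continuous g ->
  continuous (fun x => f (g x)).
Proof. by move=> cf cg x; apply: (cvg_comp _ _ (cg x)); exact: cf. Qed.

Lemma mean_value f f' : (forall x, is_derive x (1 : R) f (f' x)) ->
  forall a b, a <= b -> exists2 c, a <= c <= b & f b - f a = f' c * (b - a).
Proof.
move=> df a b ab.
have [c + e] := @MVT_segment _ f f' a b ab (fun x _ => df x)
  (continuous_subspaceT (der_continuous df)).
by rewrite in_itv /= => ?; exists c.
Qed.

Lemma mean_value_norm f f' C : (forall x, is_derive x (1 : R) f (f' x)) ->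
  (forall x, `|f' x| <= C) -> forall a b, `|f b - f a| <= C * `|b - a|.
Proof.
move=> df f'C a b; wlog ab : a b / a <= b.
  move=> H; have [/H//|/ltW/H] := leP a b.
  by rewrite distrC (distrC b).
have [c _ ->] := mean_value df ab.
by rewrite normrM ler_wpM2r.
Qed.

End derive_pointwise.

Section integral_derivative.
Context {R : realType}.
Notation mu := (@lebesgue_measure R).

Lemma integral_segment_derive (G g : R -> R) (a b : R) : a < b ->
  (forall x, is_derive x (1 : R) G (g x)) -> continuous g ->
  (\int[mu]_(x in `[a, b]) (g x)%:E = (G b - G a)%:E)%E.
Proof.
move=> ab dG cg; rewrite (@continuous_FTC2 _ g G)//.
- exact: continuous_subspaceT.
- split.
  + by move=> x _; apply: ex_derive.
  + by apply: cvg_at_right_filter; exact: (der_continuous dG).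
  + by apply: cvg_at_left_filter; exact: (der_continuous dG).
- by move=> x _; rewrite derive1E; apply: derive_val.
Qed.

Lemma cvg_restrict_segment (g : R -> \bar R) (x : R) :
  (g \_ [set` `[- n.+1%:R, n.+1%:R]%R]) x @[n --> \oo] --> g x.
Proof.
apply: cvg_near_cst; near=> n.
apply/eqP; rewrite patchE mem_set//= in_itv/= -ler_norml.
apply: (@le_trans _ _ n%:R); last by rewrite ler_nat.
by near: n; exact: nbhs_infty_ger.
Unshelve. all: by end_near. Qed.

Lemma norm_restrict_le (g : R -> \bar R) (A : set R) (x : R) :
  (`|(g \_ A) x| <= `|g x|)%E.
Proof. by rewrite patchE; case: ifP => // _; rewrite abse0. Qed.

(** The integral over the line is the limit of the integrals over [[-n, n]], by dominated
   convergence. *)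
Lemma integral_derive0 (G g : R -> R) :
  (forall x, is_derive x (1 : R) G (g x)) -> continuous g ->
  mu.-integrable setT (EFin \o g) ->
  G n%:R @[n --> \oo] --> (0 : R) -> G (- n%:R) @[n --> \oo] --> (0 : R) ->
  (\int[mu]_x (g x)%:E = 0)%E.
Proof.
move=> dG cg ig Gy GNy.
have mg : measurable_fun setT (EFin \o g) by exact: measurable_int ig.
pose I n : set R := [set` `[- n.+1%:R, n.+1%:R]%R].
have mI n : measurable (I n) by exact: measurable_itv.
have lim1 : (\int[mu]_x ((EFin \o g) \_ (I n)) x)%E @[n --> \oo] -->
    (\int[mu]_x (g x)%:E)%E.
  have [] // := @dominated_convergence _ _ _ mu setT measurableT
    (fun n => (EFin \o g) \_ (I n)) (EFin \o g) (fun x => `|(g x)%:E|)%E.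
  - move=> n; apply/(measurable_restrictT _ (mI n)); exact: measurable_funTS.
  - by apply: aeW => x _; exact: cvg_restrict_segment.
  - exact: integrable_abse ig.
  - by apply: aeW => x n _; exact: norm_restrict_le.
have lim2 : (\int[mu]_x ((EFin \o g) \_ (I n)) x)%E @[n --> \oo] --> (0 : \bar R)%E.
  have iI n : (\int[mu]_x ((EFin \o g) \_ (I n)) x =
      (G n.+1%:R - G (- n.+1%:R))%:E)%E.
    by rewrite -integral_mkcond (integral_segment_derive _ dG)// gtrN.
  under eq_cvg do rewrite iI.
  apply: cvg_EFin; first exact: nearW.
  rewrite -[X in _ --> X](subrr (0 : R)); apply: (@cvgB _ R^o).
    by rewrite (cvg_shiftS (fun n => G n%:R)).
  by rewrite (cvg_shiftS (fun n => G (- n%:R))).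
by have := cvg_unique _ lim1 lim2; exact.
Qed.
End integral_derivative.

(** * Integration against a normal law *)

Section normal_change.
Context {R : realType}.
Notation mu := (@lebesgue_measure R).

(** The normal density is, almost everywhere, the Radon-Nikodym derivative of the normal
   law. *)
Lemma ge0_integral_normal (m s : R) (u : R -> \bar R) :
  measurable_fun setT u -> (forall x, 0 <= u x)%E ->
  (\int[normal_prob m s]_x u x = \int[mu]_x (u x * (normal_pdf m s x)%:E))%E.
Proof.
move=> mu_ u0.
pose nu : {finite_measure set _ -> \bar R} := normal_prob m s.
have dom : nu `<< mu by exact: normal_prob_dominates.
rewrite -(@Radon_Nikodym_SigmaFinite.change_of_variables _ _ R nu mu dom)//.
apply: ae_eq_integral => //.
- apply: emeasurable_funM => //.
  exact: measurable_int (Radon_Nikodym_SigmaFinite.f_integrable dom).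
- apply: emeasurable_funM => //; apply/measurable_EFinP.
  exact: measurable_normal_pdf.
- apply: ae_eqe_mul2l; apply: integral_ae_eq => //.
  + exact: Radon_Nikodym_SigmaFinite.f_integrable.
  + by apply/measurable_EFinP; exact: measurable_normal_pdf.
  + by move=> E _ mE; rewrite -Radon_Nikodym_SigmaFinite.f_integral.
Qed.

Context {d : measure_display} {T : measurableType d} (P : probability T R).

Lemma integral_law (X : {RV P >-> R}) (m s : R) (u : R -> R) :
  has_normal_law X m s -> measurable_fun setT u ->
  mu.-integrable setT (fun x => (u x * normal_pdf m s x)%:E) ->
  P.-integrable setT (fun w => (u (X w))%:E) /\
  (\int[P]_w (u (X w))%:E = \int[mu]_x (u x * normal_pdf m s x)%:E)%E.
Proof.
move=> lX mu_ iu.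
have mX' : @measurable_fun _ _ T (measurableTypeR R) setT X.
  exact: (@measurable_funPT _ _ _ _ X).
(* [X] with values in the copy of the line that carries the Lebesgue measure. *)
pose X' : {RV P >-> measurableTypeR R} := @mfun_Sub _ _ T (measurableTypeR R) _ (mem_set mX').
have key (v : R -> \bar R) : measurable_fun setT v -> (forall x, 0 <= v x)%E ->
   (\int[P]_w v (X w) = \int[mu]_x (v x * (normal_pdf m s x)%:E))%E.
  move=> mv v0; rewrite -ge0_integral_normal//.
  rewrite -(ge0_integral_distribution X')//.
  pose N : {measure set (measurableTypeR R) -> \bar R} := normal_prob m s.
  have := @eq_measure_integral _ (measurableTypeR R) R setT N (distribution P X') v.
  by apply => A mA _; exact: lX.
have mX : measurable_fun setT (fun w => (u (X w))%:E).
  by apply/measurable_EFinP; exact: measurableT_comp.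
have iX : P.-integrable setT (fun w => (u (X w))%:E).
  apply/integrableP; split => //.
  rewrite (key (fun x => `|(u x)%:E|)%E)//; last first.
    by apply: measurableT_comp => //; apply/measurable_EFinP.
  case/integrableP : iu => _; apply: le_lt_trans.
  by rewrite le_eqVlt; apply/orP; left; apply/eqP; apply: eq_integral => x _;
     rewrite /= normrM (ger0_norm (normal_pdf_ge0 _ _ _)).
split => //.
rewrite integralE [RHS]integralE.
have mEu : measurable_fun setT (EFin \o u) by apply/measurable_EFinP.
have pdf0 x : (0 <= (normal_pdf m s x)%:E)%E by rewrite lee_fin normal_pdf_ge0.
have -> : (\int[P]_w (fun w => (u (X w))%:E)^\+ w)%E =
    (\int[P]_w ((EFin \o u)^\+ (X w)))%E.
  by apply: eq_integral => w _; rewrite !funeposE.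
have -> : (\int[P]_w (fun w => (u (X w))%:E)^\- w)%E =
    (\int[P]_w ((EFin \o u)^\- (X w)))%E.
  by apply: eq_integral => w _; rewrite !funenegE.
rewrite (key _ (measurable_funepos mEu))// (key _ (measurable_funeneg mEu))//.
congr (_ - _)%E; apply: eq_integral => x _.
  by rewrite !funeposE /= EFinM maxe_pMl// mul0e.
by rewrite !funenegE /= maxe_pMl// mul0e ?muleN ?mulNe ?EFinN ?EFinM ?mulNe.
Qed.

End normal_change.

(** * Moments and characteristic function of the normal law *)

Lemma cvg0_decay {R : realType} (C : R) (v : nat -> R) : (forall n, n%:R * `|v n| <= C) ->
  v n @[n --> \oo] --> (0 : R).
Proof.
move=> vC; have C0 : 0 <= C by apply: le_trans (vC 0%N); rewrite mul0r.
apply/cvgrPdist_le => e e0; near=> n.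
have n0 : 0 < n%:R :> R by near: n; exact: nbhs_infty_gtr.
rewrite sub0r normrN -(ler_pM2l n0); apply: le_trans (vC n) _.
rewrite -ler_pdivrMr//; near: n; exact: nbhs_infty_ger.
Unshelve. all: by end_near. Qed.

Section normal_density.
Context {R : realType}.
Notation mu := (@lebesgue_measure R).
Variables m s : R.
Hypothesis s0 : 0 < s.

Lemma normal_pdf_expE x :
  normal_pdf m s x = normal_peak s * expR (- ((x - m) ^+ 2 / (2 * s ^+ 2))).
Proof. by rewrite normal_pdfE ?gt_eqF// /normal_fun mulNr -mulr_natl. Qed.

Lemma der_normal_pdf x :
  is_derive x (1 : R) (normal_pdf m s) (- ((x - m) / s ^+ 2) * normal_pdf m s x).
Proof.
have s1 : s != 0 by rewrite gt_eqF.
rewrite (_ : normal_pdf m s = fun y => normal_peak s *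
    expR (- ((2 * s ^+ 2)^-1 * (y - m) ^+ 2))); last first.
  by apply/funext => y; rewrite normal_pdf_expE mulrC (mulrC (_ ^+ 2)) mulrC.
have dm := der_comp (derB (der_id x) (der_cst m x)) (der_sqr (x - m)).
have d1 := derN (derZ (2 * s ^+ 2)^-1 dm).
have d2 := derZ (normal_peak s) (der_comp d1 (is_derive_expR _)).
by apply: is_derive_eq d2 _; field.
Qed.

Lemma powr_le_expR (p : nat) (t : R) : 0 <= t -> t ^+ p <= p`!%:R * expR t.
Proof.
move=> t0; case: p => [|p]; first by rewrite expr0 mul1r -[leLHS]expR0 ler_expR.
have := expR_ge1Dxn p t0; rewrite -ler_pdivrMl ?ltr0n ?fact_gt0// mulrC.
by apply: le_trans; rewrite lerDr.
Qed.

(** With t = x^2/(8 s^2), the polynomial is at most a multiple of exp(t) and the density at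
   most a multiple of exp(- 2t). *)
Lemma normal_growth_bound (p : nat) : exists2 C : R, 0 <= C &
  forall x, (1 + `|x|) ^+ p * normal_pdf m s x <= C * normal_pdf 0 (2 * s) x.
Proof.
have s20 : 0 < 2 * s by rewrite mulr_gt0.
have s2p : 0 < s ^+ 2 by rewrite exprn_gt0.
pose N : R := normal_peak (2 * s); have N0 : 0 < N by rewrite normal_peak_gt0// gt_eqF.
pose c := m ^+ 2 / (2 * s ^+ 2); pose a := (2 + 16 * s ^+ 2) ^+ p * p`!%:R.
have a0 : 0 <= a by rewrite mulr_ge0// exprn_ge0// addr_ge0// mulr_ge0// ltW.
have pc0 : 0 <= normal_peak s * expR (1 + c) by rewrite mulr_ge0 ?normal_peak_ge0 ?expR_ge0.
exists (a * (normal_peak s * expR (1 + c)) / N); first by rewrite divr_ge0 ?(ltW N0)// mulr_ge0.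
move=> x; pose t := x ^+ 2 / (8 * s ^+ 2).
have t0 : 0 <= t by rewrite divr_ge0 ?sqr_ge0// mulr_ge0// ltW.
have growth : (1 + `|x|) ^+ p <= a * expR (1 + t).
  apply: (@le_trans _ _ (((2 + 16 * s ^+ 2) * (1 + t)) ^+ p)); last first.
    by rewrite exprMn /a -mulrA ler_wpM2l ?powr_le_expR ?exprn_ge0 ?addr_ge0// mulr_ge0// ltW.
  have xE : x ^+ 2 = 8 * s ^+ 2 * t by rewrite /t; field; rewrite gt_eqF.
  have x2 := real_normK (num_real x).
  have tx : 1 + `|x| <= (2 + 16 * s ^+ 2) * (1 + t).
    by have := sqr_ge0 (`|x| - 1); rewrite sqrrB1 x2 xE; nra.
  have x1 : 0 <= 1 + `|x| by rewrite addr_ge0.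
  by apply: (lerXn2r _ _ _ tx); rewrite nnegrE //; exact: le_trans x1 tx.
have pdf_le : normal_pdf m s x <= normal_peak s * expR (c - (t + t)).
  rewrite normal_pdf_expE ler_wpM2l ?normal_peak_ge0// ler_expR -subr_ge0.
  rewrite (_ : _ - _ = (x - 2 * m) ^+ 2 / (4 * s ^+ 2)); last first.
    by rewrite /c /t; field; rewrite gt_eqF.
  by rewrite divr_ge0 ?sqr_ge0// mulr_ge0// ltW.
apply: le_trans (ler_pM _ (normal_pdf_ge0 _ _ _) growth pdf_le) _.
  by rewrite exprn_ge0// addr_ge0.
rewrite normal_pdfE ?gt_eqF// /normal_fun subr0 -/N.
have -> : - x ^+ 2 / ((2 * s) ^+ 2 *+ 2) = - t.
  by rewrite /t exprMn mulNr; congr (- _); field; rewrite gt_eqF.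
rewrite (_ : c - (t + t) = c - t - t); last by ring.
rewrite le_eqVlt; apply/orP; left; apply/eqP.
have e0 : expR t != 0 by rewrite gt_eqF// expR_gt0.
by rewrite !expRD !expRN; field; rewrite e0 gt_eqF.
Qed.

Section growth.
Variables (u : R -> R) (C : R) (p : nat).
Hypothesis uC : forall x, `|u x| <= C * (1 + `|x|) ^+ p.

Let C0 : 0 <= C.
Proof. by have := uC 0; rewrite normr0 addr0 expr1n mulr1; apply: le_trans. Qed.

Lemma integrable_normal_dom : measurable_fun setT u ->
  mu.-integrable setT (fun x => (u x * normal_pdf m s x)%:E).
Proof.
move=> mu_; have [K K0 hK] := normal_growth_bound p.
have i1 : mu.-integrable setT (fun x => (C * K)%:E * (normal_pdf 0 (2 * s) x)%:E)%E.
  by apply: integrableZl => //; exact: integrable_normal_pdf.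
apply: le_integrable i1 => //.
  by apply/measurable_EFinP; apply: measurable_funM => //; exact: measurable_normal_pdf.
move=> x _ /=; rewrite lee_fin !normrM !(ger0_norm (normal_pdf_ge0 _ _ _)).
rewrite (ger0_norm C0) (ger0_norm K0) -mulrA.
apply: le_trans (ler_wpM2l C0 (hK x)); rewrite mulrA.
by rewrite ler_wpM2r// normal_pdf_ge0.
Qed.

(** Provides the boundary terms at [n] and [- n] of an integration by parts. *)
Lemma cvg_normal_pdf (v : nat -> R) : (forall n, `|v n| = n%:R) ->
  (u (v n) * normal_pdf m s (v n)) @[n --> \oo] --> (0 : R).
Proof.
move=> vE; have [K K0 hK] := normal_growth_bound p.+1.
apply: (@cvg0_decay _ (C * (K * normal_peak (2 * s)))) => n.
rewrite -vE normrM (ger0_norm (normal_pdf_ge0 _ _ _)).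
apply: (@le_trans _ _ (C * ((1 + `|v n|) ^+ p.+1 * normal_pdf m s (v n)))).
  rewrite [leLHS]mulrA [leRHS]mulrA ler_wpM2r ?normal_pdf_ge0// exprS mulrCA.
  by apply: ler_pM => //; rewrite lerDr.
rewrite ler_wpM2l//; apply: le_trans (hK _) _; rewrite ler_wpM2l//.
by apply: normal_pdf_ub; rewrite gt_eqF// mulr_gt0.
Qed.

End growth.

(** The integral of the derivative of [u * normal_pdf m s] vanishes. *)
Lemma normal_ibp (u u' : R -> R) (C : R) (p : nat) :
  (forall x, is_derive x (1 : R) u (u' x)) -> continuous u' ->
  (forall x, `|u x| <= C * (1 + `|x|) ^+ p) ->
  (forall x, `|u' x| <= C * (1 + `|x|) ^+ p) ->
  \int[mu]_x ((x - m) * u x * normal_pdf m s x) =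
  s ^+ 2 * \int[mu]_x (u' x * normal_pdf m s x).
Proof.
move=> du cu' uC u'C; have s2 : s ^+ 2 != 0 by rewrite expf_neq0// gt_eqF.
have cu := der_continuous du.
have cm : continuous (fun x => (x - m) * u x).
  by apply: contM => //; apply: contB => x; [exact: cvg_id|exact: cvg_cst].
have mC x : `|(x - m) * u x| <= (1 + `|m|) * C * (1 + `|x|) ^+ p.+1.
  rewrite normrM exprS mulrACA; apply: ler_pM => //; apply: le_trans (ler_normB _ _) _.
  by have := normr_ge0 x; have := normr_ge0 m; nra.
have i1 := integrable_normal_dom u'C (continuous_measurable_fun cu').
have i2 := integrable_normal_dom mC (continuous_measurable_fun cm).
pose g x := u' x * normal_pdf m s x - (s ^+ 2)^-1 * ((x - m) * u x * normal_pdf m s x).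
have dG x : is_derive x (1 : R) (fun y => u y * normal_pdf m s y) (g x).
  by apply: is_derive_eq (derM (du x) (der_normal_pdf x)) _; rewrite /g; ring.
have i2' : mu.-integrable setT
    (fun x => ((s ^+ 2)^-1 * ((x - m) * u x * normal_pdf m s x))%:E).
  by under eq_fun do rewrite EFinM; exact: integrableZl.
have ig : mu.-integrable setT (EFin \o g).
  by rewrite /comp /g; under eq_fun do rewrite EFinB; exact: integrableB.
have cg : continuous g.
  have cp := der_continuous der_normal_pdf.
  by apply: contB; [exact: contM|apply: contZ; exact: contM].
have GN : u (- n%:R) * normal_pdf m s (- n%:R) @[n --> \oo] --> (0 : R).
  by apply: (cvg_normal_pdf uC (v := fun n => - n%:R)) => n; rewrite normrN normr_nat.
have I0 := integral_derive0 dG cg ig (cvg_normal_pdf uC (fun n => normr_nat _ n)) GN.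
have : \int[mu]_x g x = 0 by rewrite /Rintegral I0.
rewrite /g RintegralB// RintegralZl// => /eqP; rewrite subr_eq0 => /eqP ->.
by rewrite mulrA mulfV// mul1r.
Qed.

End normal_density.

Section normal_moments.
Context {R : realType}.
Notation mu := (@lebesgue_measure R).
Variable s : R.
Hypothesis s0 : 0 < s.

Lemma integrable_normal_power (m : R) (p : nat) :
  mu.-integrable setT (fun x => (x ^+ p * normal_pdf m s x)%:E).
Proof.
apply: (@integrable_normal_dom _ m s s0 _ 1 p); last exact: (measurable_funX p).
by move=> x; rewrite mul1r normrX lerXn2r ?nnegrE ?addr_ge0// lerDr.
Qed.

Lemma normal_first_moment (m : R) : \int[mu]_x (x * normal_pdf m s x) = m.
Proof.
have i1 : mu.-integrable setT (EFin \o (fun x => x * normal_pdf m s x)).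
  by have := integrable_normal_power m 1.
have i0 := integrable_normal_pdf m s.
have im : mu.-integrable setT (EFin \o (fun x => m * normal_pdf m s x)).
  by rewrite /comp; under eq_fun do rewrite EFinM; exact: integrableZl.
have e := @normal_ibp _ m s s0 (fun=> 1) (fun=> 0) 1 0 (der_cst 1) (fun x => cvg_cst _).
have {e} : \int[mu]_x (x * normal_pdf m s x - m * normal_pdf m s x) = 0.
  transitivity (\int[mu]_x ((x - m) * 1 * normal_pdf m s x)).
    by apply: eq_Rintegral => x _; ring.
  rewrite e => [|x|x]; rewrite ?expr0 ?normr1 ?normr0 ?mulr1//.
  by under eq_Rintegral do rewrite mul0r; rewrite /Rintegral integral0 mulr0.
rewrite RintegralB// RintegralZl// => /eqP; rewrite subr_eq0 => /eqP ->.
by rewrite /Rintegral integral_normal_pdf mulr1.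
Qed.

Lemma normal_second_moment : \int[mu]_x (x ^+ 2 * normal_pdf 0 s x) = s ^+ 2.
Proof.
have ci : continuous (fun x : R => x) by move=> x; exact: cvg_id.
have e := @normal_ibp _ 0 s s0 (fun x => x) (fun=> 1) 1 1 (@der_id R) (fun x => cvg_cst _).
transitivity (\int[mu]_x ((x - 0) * x * normal_pdf 0 s x)).
  by apply: eq_Rintegral => x _; rewrite subr0.
rewrite e => [|x|x]; rewrite ?mul1r ?expr1 ?normr1 ?lerDl ?lerDr//.
under eq_Rintegral do rewrite mul1r.
by rewrite /Rintegral integral_normal_pdf mulr1.
Qed.

Lemma der_affine (t b x : R) : is_derive x (1 : R) (fun y => t * y + b) t.
Proof.
by apply: is_derive_eq (derD (derZ t (der_id x)) (der_cst b x)) _; rewrite mulr1 addr0.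
Qed.

Lemma der_cos_affine (t b x : R) :
  is_derive x (1 : R) (fun y => cos (t * y + b)) (- (t * sin (t * x + b))).
Proof.
have := der_comp (der_affine t b x) (is_derive_cos _).
by move/is_derive_eq; apply; rewrite mulNr mulrC.
Qed.

Lemma der_sin_affine (t b x : R) :
  is_derive x (1 : R) (fun y => sin (t * y + b)) (t * cos (t * x + b)).
Proof.
have := der_comp (der_affine t b x) (is_derive_sin _).
by move/is_derive_eq; apply; rewrite mulrC.
Qed.

Lemma measurable_cos_affine (t b : R) : measurable_fun setT (fun x => cos (t * x + b)).
Proof.
apply: continuous_measurable_fun => x.
exact: (der_continuous (der_cos_affine t b)).
Qed.

Lemma measurable_sin_affine (t b : R) : measurable_fun setT (fun x => sin (t * x + b)).
Proof.
apply: continuous_measurable_fun => x.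
exact: (der_continuous (der_sin_affine t b)).
Qed.

Let bounded1 (c x : R) : `|c| <= 1 -> `|c| <= 1 * (1 + `|x|) ^+ 0.
Proof. by rewrite mul1r. Qed.

Lemma integrable_cos_normal (t b : R) :
  mu.-integrable setT (fun x => (cos (t * x + b) * normal_pdf 0 s x)%:E).
Proof.
apply: (@integrable_normal_dom _ _ _ s0 _ 1 0); last exact: measurable_cos_affine.
by move=> x; exact: bounded1 (cos_max _).
Qed.

Let phi b t := \int[mu]_x (cos (t * x + b) * normal_pdf 0 s x).

Let ibp b t : \int[mu]_x (x * sin (t * x + b) * normal_pdf 0 s x) = s ^+ 2 * t * phi b t.
Proof.
have cc := contZ (c := t) (der_continuous (der_cos_affine t b)).
have gr (c x : R) : `|c| <= 1 -> `|t * c| <= (1 + `|t|) * (1 + `|x|) ^+ 0 /\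
    `|c| <= (1 + `|t|) * (1 + `|x|) ^+ 0.
  rewrite expr0 mulr1 normrM => c1.
  by have := normr_ge0 t; have := normr_ge0 c; split; nra.
have e := @normal_ibp _ 0 s s0 _ _ (1 + `|t|) 0 (der_sin_affine t b) cc
  (fun x => (gr _ x (sin_max _)).2) (fun x => (gr _ x (cos_max _)).1).
transitivity (\int[mu]_x ((x - 0) * sin (t * x + b) * normal_pdf 0 s x)).
  by apply: eq_Rintegral => x _; rewrite subr0.
rewrite e -mulrA; congr (_ * _).
under eq_Rintegral do rewrite -mulrA.
by rewrite RintegralZl//; exact: integrable_cos_normal.
Qed.

Let dphi b t : is_derive t (1 : R) (phi b) (- (s ^+ 2 * t * phi b t)).
Proof.
pose f t x := cos (t * x + b) * normal_pdf 0 s x.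
have df u x : is_derive u (1 : R) (f ^~ x) (- (x * sin (u * x + b) * normal_pdf 0 s x)).
  rewrite /f; under eq_fun do rewrite (mulrC _ x).
  apply: is_derive_eq (derM (der_cos_affine x b u) (der_cst _ _)) _.
  by rewrite (mulrC x u); ring.
have pE u x : partial1of2 f u x = - (x * sin (u * x + b) * normal_pdf 0 s x).
  by rewrite partial1of2E; apply: derive_val.
have tI : (`]t - 1, t + 1[%classic : set R) t.
  by rewrite /= in_itv/= ltrBlDr !ltrDl ltr01.
have iG : mu.-integrable setT (EFin \o (fun x : R => `|x| * normal_pdf 0 s x)).
  apply: (@integrable_normal_dom _ _ _ s0 _ 1 1); last exact: normr_measurable.
  by move=> x; rewrite normr_id mul1r expr1 lerDr.
have iF x : (`]t - 1, t + 1[%classic : set R) x -> mu.-integrable setT (EFin \o f x).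
  by move=> _; exact: integrable_cos_normal.
have dF u x : (`]t - 1, t + 1[%classic : set R) u -> setT x -> derivable (f ^~ x) u 1.
  by move=> _ _; apply: ex_derive.
have G0 (x : R) : 0 <= `|x| * normal_pdf 0 s x by rewrite mulr_ge0// normal_pdf_ge0.
have Gub u x : (`]t - 1, t + 1[%classic : set R) u -> setT x ->
    `|partial1of2 f u x| <= `|x| * normal_pdf 0 s x.
  move=> _ _; rewrite pE normrN !normrM (ger0_norm (normal_pdf_ge0 _ _ _)).
  by rewrite ler_wpM2r ?normal_pdf_ge0// ler_piMr// sin_max.
have D := @derivable_under_integral R _ _ mu f setT measurableT t (t - 1) (t + 1)
  tI iF dF _ G0 iG Gub.
have E := @differentiation_under_integral R _ _ mu f setT measurableT t (t - 1) (t + 1)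
  tI iF dF _ G0 iG Gub.
apply: DeriveDef => //; rewrite -derive1E E.
under eq_Rintegral do rewrite pE -mulN1r.
rewrite RintegralZl ?ibp ?mulN1r//.
apply: (@integrable_normal_dom _ _ _ s0 _ 1 1) => [x|].
  rewrite mul1r expr1 normrM (@le_trans _ _ `|x|)// ?lerDr//.
  by rewrite ler_piMr// sin_max.
by apply: measurable_funM => //; exact: measurable_sin_affine.
Qed.

(** phi(t) = E cos(tX + b) solves phi' = - s^2 t phi: differentiate under the integral
   sign, then use [normal_ibp]. *)
Lemma normal_cos (b : R) :
  \int[mu]_x (cos (x + b) * normal_pdf 0 s x) = expR (- (s ^+ 2 / 2)) * cos b.
Proof.
pose g t := phi b t * expR (s ^+ 2 / 2 * t ^+ 2).
have dg t : is_derive t (1 : R) g 0.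
  have d1 := der_comp (derZ (s ^+ 2 / 2) (der_sqr t)) (is_derive_expR _).
  by apply: is_derive_eq (derM (dphi b t) d1) _; field.
have := is_derive_0_is_cst 1 0 dg.
rewrite /g expr0n/= mulr0 expR0 mulr1 expr1n mulr1.
have -> : phi b 0 = cos b.
  rewrite /phi; under eq_Rintegral do rewrite mul0r add0r.
  rewrite RintegralZl//; last exact: integrable_normal_pdf.
  by rewrite /Rintegral integral_normal_pdf mulr1.
rewrite expRN => <-; rewrite mulrC mulfK ?gt_eqF ?expR_gt0// /phi.
by apply: eq_Rintegral => x _; rewrite mul1r.
Qed.

End normal_moments.

(** * Stein's equation *)

Section stein_equation.
Context {R : realType}.
Notation mu := (@lebesgue_measure R).
Notation pdf := (@normal_pdf R 0 1).

Let dpdf (x : R) : is_derive x (1 : R) pdf (- x * pdf x).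
Proof.
by apply: is_derive_eq (der_normal_pdf 0 ltr01 x) _; rewrite subr0 expr1n divr1.
Qed.

Let pdf_gt0 (x : R) : 0 < pdf x.
Proof. by rewrite normal_pdf_expE// mulr_gt0 ?expR_gt0// normal_peak_gt0// oner_eq0. Qed.

Section normal_tail.
Variables (K : R) (Psi w : R -> R).
Hypothesis K0 : 0 <= K.
Hypothesis dPsi : forall x, is_derive x (1 : R) Psi (w x).
Hypothesis w_le : forall x, `|w x| <= K * pdf x.
Hypothesis Psi_y : Psi n%:R @[n --> \oo] --> (0 : R).

(** On ]0, +oo[ the functions K pdf(x)/x +- Psi(x) are nonincreasing with limit 0. [Psi]
   is kept abstract because the bound for negative [x] is that of [Psi (- x)]. *)
Lemma normal_tail_bound (x : R) : 0 < x -> `|x * Psi x| <= K * pdf x.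
Proof.
move=> x0.
have key (e : R) : `|e| = 1 -> e * Psi x <= K * (pdf x / x).
  move=> e1; pose A y := K * (pdf y / y) - e * Psi y.
  rewrite -subr_ge0 -/(A x).
  pose A' y := K * (- pdf y - pdf y / y ^+ 2) - e * w y.
  have dA (y : R) : 0 < y -> is_derive y (1 : R) A (A' y).
    move=> y0; have yn0 : y != 0 by rewrite gt_eqF.
    have dinv := is_deriveV (f := fun z : R => z) yn0 (der_id y).
    apply: is_derive_eq (derB (derZ K (derM (dpdf y) dinv)) (derZ e (dPsi y))) _.
    by rewrite /GRing.scale/= /A'; congr (_ * _ - _); field.
  have A'_le0 (y : R) : 0 < y -> A' y <= 0.
    move=> y0; have h1 : - (e * w y) <= K * pdf y.
      by rewrite (le_trans _ (w_le y))// (le_trans (ler_norm _))// normrN normrM e1 mul1r.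
    have h2 : 0 <= K * (pdf y / y ^+ 2) by rewrite mulr_ge0// divr_ge0 ?sqr_ge0// ltW.
    by rewrite /A' mulrBr mulrN; lra.
  have A_cvg : A n%:R @[n --> \oo] --> (0 : R).
    rewrite -[X in _ --> X](subrr (0 : R)); apply: (@cvgB _ R^o).
      apply: (@cvg0_decay _ (K * normal_peak 1)) => n.
      rewrite normrM (ger0_norm K0) mulrCA ler_wpM2l//.
      have [->|n0] := eqVneq n 0%N; first by rewrite mul0r normal_peak_ge0.
      rewrite normrM normfV normr_nat (ger0_norm (ltW (pdf_gt0 _))).
      by rewrite mulrC divfK ?pnatr_eq0// normal_pdf_ub// oner_eq0.
    by rewrite -[X in _ --> X](mulr0 e); apply: cvgM; [exact: cvg_cst|exact: Psi_y].
  apply: (cvgr_to_le A_cvg); near=> n.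
  have xn : x <= n%:R by near: n; exact: nbhs_infty_ger.
  have dAi (y : R) : y \in `]x, n%:R[%R -> is_derive y (1 : R) A (A' y).
    by rewrite in_itv/= => /andP[xy _]; apply: dA; exact: lt_trans xy.
  have cA : {within `[x, n%:R]%classic, continuous A}.
    apply: derivable_within_continuous => y; rewrite in_itv/= => /andP[xy _].
    by have /@ex_derive := dA y (lt_le_trans x0 xy).
  have [c + e2] := MVT_segment xn dAi cA.
  rewrite in_itv/= => /andP[xc _].
  rewrite -subr_le0 e2 mulr_le0_ge0 ?subr_ge0// A'_le0//.
  exact: lt_le_trans xc.
have P_le : `|Psi x| <= K * (pdf x / x).
  rewrite ler_norml lerNl -mulN1r -[Psi x in X in _ && X]mul1r.
  by rewrite !key// ?normrN1 ?normr1.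
rewrite normrM (gtr0_norm x0) mulrC -ler_pdivlMr//.
by rewrite -mulrA.
Unshelve. all: by end_near. Qed.

End normal_tail.

Let cpdf : continuous pdf. Proof. exact: der_continuous dpdf. Qed.

Variables (h : R -> R) (M : R).
Hypothesis ch : continuous h.
Hypothesis hM : forall x, `|h x| <= M.

Let M0 : 0 <= M. Proof. exact: le_trans (hM 0). Qed.

Lemma integrable_bounded_normal : mu.-integrable setT (fun x => (h x * pdf x)%:E).
Proof.
apply: (@integrable_normal_dom _ _ _ ltr01 _ M 0); last exact: continuous_measurable_fun.
by move=> x; rewrite expr0 mulr1.
Qed.

Let iZ c : mu.-integrable setT (EFin \o (fun x => c * pdf x)).
Proof.
rewrite /comp; under eq_fun do rewrite EFinM.
by apply: integrableZl => //; exact: integrable_normal_pdf.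
Qed.

Definition normal_mean : R := \int[mu]_x (h x * pdf x).
Local Notation m := normal_mean.

Lemma normal_mean_le : `|m| <= M.
Proof.
rewrite /m; apply: le_trans (le_normr_Rintegral _ integrable_bounded_normal) _ => //.
have -> : M = \int[mu]_x (M * pdf x).
  rewrite RintegralZl//; last exact: integrable_normal_pdf.
  by rewrite /Rintegral integral_normal_pdf mulr1.
apply: le_Rintegral => //.
- exact: integrable_abse integrable_bounded_normal.
- by move=> x _; rewrite normrM (ger0_norm (ltW (pdf_gt0 x))) ler_wpM2r// ltW.
Qed.

Let w x := (h x - m) * pdf x.

Let w_le x : `|w x| <= 2 * M * pdf x.
Proof.
rewrite normrM (ger0_norm (ltW (pdf_gt0 x))); apply: ler_wpM2r; first exact: ltW.
have := ler_normB (h x) m; have := hM x; have := normal_mean_le; lra.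
Qed.

Let cw : continuous w.
Proof. by apply: contM => //; apply: contB => // x; exact: cvg_cst. Qed.

Let iw : mu.-integrable setT (EFin \o w).
Proof.
rewrite (_ : EFin \o w = fun x => ((h x * pdf x)%:E - (m * pdf x)%:E)%E); last first.
  by apply/funext => x /=; rewrite /w mulrBl EFinB.
apply: integrableB => //; first exact: integrable_bounded_normal.
exact: iZ.
Qed.

Let iwS (A : set R) : measurable A -> mu.-integrable A (EFin \o w).
Proof. by move=> mA; apply: integrableS iw. Qed.

Let w_int0 : \int[mu]_x w x = 0.
Proof.
under eq_Rintegral do rewrite /w mulrBl.
rewrite RintegralB//; last exact: integrable_bounded_normal.
rewrite RintegralZl//; last exact: integrable_normal_pdf.
by rewrite {2}/Rintegral integral_normal_pdf mulr1 /m subrr.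
Qed.

Let Psi x := \int[mu]_(y in `]-oo, x]) w y.

Let dPsi x : is_derive x (1 : R) Psi (w x).
Proof.
have x1 : x < x + 1 by rewrite ltrDl.
have H := @continuous_FTC1 R w (BInfty R true) x (x + 1) x1
  (iwS (measurable_itv _)).
have [|//|d1 d2] := H; first by rewrite ltNyr.
  exact: cw.
by apply: DeriveDef; rewrite // -derive1E.
Qed.

Let cvg_Psi (v : nat -> R) (A : set R) (l : R) :
  (forall x, ((EFin \o w) \_ (`]-oo, v n]) x @[n --> \oo] --> ((EFin \o w) \_ A) x)%classic) ->
  measurable A -> l = \int[mu]_(y in A) w y ->
  Psi (v n) @[n --> \oo] --> l.
Proof.
move=> vA mA ->.
have mw : measurable_fun setT (EFin \o w) by exact: measurable_int iw.
pose I n : set R := [set` `]-oo, v n]%R].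
have mI n : measurable (I n) by exact: measurable_itv.
have H : (\int[mu]_x ((EFin \o w) \_ (I n)) x)%E @[n --> \oo] -->
    (\int[mu]_x ((EFin \o w) \_ A) x)%E.
  have [] // := @dominated_convergence _ _ _ mu setT measurableT
    (fun n => (EFin \o w) \_ (I n)) ((EFin \o w) \_ A)
    (fun x => `|(w x)%:E|)%E.
  - move=> n; apply/(measurable_restrictT _ (mI n)); exact: measurable_funTS.
  - apply/(measurable_restrictT _ mA); exact: measurable_funTS.
  - by apply: aeW => x _; exact: vA.
  - exact: integrable_abse iw.
  - by apply: aeW => x n _; exact: norm_restrict_le.
rewrite /Psi /Rintegral.
apply: fine_cvg; rewrite fineK; last first.
  by apply: integrable_fin_num => //; exact: iwS.
by rewrite integral_mkcond; under eq_cvg do rewrite integral_mkcond.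
Qed.

Let cvg_Psi_y : Psi n%:R @[n --> \oo] --> (0 : R).
Proof.
apply: (@cvg_Psi _ setT) => //.
move=> x; rewrite patchE mem_setT; apply: cvg_near_cst; near=> n.
apply/eqP; rewrite patchE mem_set//= in_itv/=; near: n.
exact: nbhs_infty_ger.
Unshelve. all: by end_near. Qed.

Let cvg_Psi_Ny : Psi (- n%:R) @[n --> \oo] --> (0 : R).
Proof.
apply: (@cvg_Psi _ set0) => //; last by rewrite Rintegral_set0.
move=> x; rewrite patchE in_set0; apply: cvg_near_cst; near=> n.
apply/eqP; rewrite patchE memNset//= in_itv/=; apply/negP.
rewrite -ltNge ltrNl; near: n.
exact: nbhs_infty_gtr.
Unshelve. all: by end_near. Qed.

Let pdfN x : pdf (- x) = pdf x.
Proof. by rewrite !normal_pdf_expE// !subr0 sqrrN. Qed.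

Let Psi_tail (x : R) : `|x * Psi x| <= 2 * M * pdf x.
Proof.
have M20 : 0 <= 2 * M by rewrite mulr_ge0.
have [x0|x0] := ltP 0 x; first exact: (normal_tail_bound M20 dPsi w_le cvg_Psi_y).
move: x0; rewrite le_eqVlt => /predU1P[->|x0].
  by rewrite mul0r normr0 mulr_ge0// ltW.
have dN (y : R) : is_derive y (1 : R) (fun z => Psi (- z)) (- w (- y)).
  by apply: is_derive_eq (der_comp (derN (der_id y)) (dPsi _)) _; rewrite mulrN1.
have wN y : `|- w (- y)| <= 2 * M * pdf y by rewrite normrN -pdfN.
have := normal_tail_bound M20 dN wN cvg_Psi_Ny.
by move=> /(_ (- x)); rewrite oppr_gt0 opprK pdfN mulNr normrN; exact.
Qed.

(** The solution is [Psi / pdf], where [Psi] is the primitive of [(h - m) * pdf] that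
   vanishes at both ends; the tail bound on [x * Psi x] bounds [x * f x], hence [f']. *)
Lemma stein_solution : exists f f' : R -> R,
  [/\ forall x, is_derive x (1 : R) f (f' x), continuous f',
      forall x, f' x - x * f x = h x - m, forall x, `|f' x| <= 4 * M
    & forall x, `|f x| <= `|f 0| + 4 * M * `|x| ].
Proof.
have p0 x : pdf x != 0 by rewrite gt_eqF.
pose f x := Psi x * (pdf x)^-1.
pose f' x := h x - m + x * f x.
have df x : is_derive x (1 : R) f (f' x).
  have dinv := is_deriveV (p0 x) (dpdf x).
  apply: is_derive_eq (derM (dPsi x) dinv) _.
  by rewrite /f' /f /w /GRing.scale/=; field.
have f'M x : `|f' x| <= 4 * M.
  have h1 : `|h x - m| <= 2 * M.
    by have := ler_normB (h x) m; have := hM x; have := normal_mean_le; lra.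
  have h2 : `|x * f x| <= 2 * M.
    rewrite /f mulrA normrM normfV (ger0_norm (ltW (pdf_gt0 x))).
    by rewrite ler_pdivrMr// Psi_tail.
  by have := ler_normD (h x - m) (x * f x); rewrite /f'; lra.
exists f, f'; split => //.
- have cf := der_continuous df.
  have ci : continuous (fun x : R => x) by move=> x; exact: cvg_id.
  apply: contD; last exact: contM.
  by apply: contB => // x; exact: cvg_cst.
- by move=> x; rewrite /f' addrK.
- move=> x; have := mean_value_norm df f'M 0 x; rewrite subr0.
  have := ler_normD (f x - f 0) (f 0); rewrite subrK; lra.
Qed.

End stein_equation.

(** * Gaussian variables *)

Section gaussian_variable.
Context {R : realType}.
Notation mu := (@lebesgue_measure R).

Context {d : measure_display} {T : measurableType d} (P : probability T R).

Lemma Rintegral_law (X : {RV P >-> R}) (m s : R) (u : R -> R) :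
  has_normal_law X m s -> measurable_fun setT u ->
  mu.-integrable setT (fun x => (u x * normal_pdf m s x)%:E) ->
  \int[P]_w u (X w) = \int[mu]_x (u x * normal_pdf m s x).
Proof. by move=> lX mu_ iu; congr fine; exact: (integral_law lX mu_ iu).2. Qed.

Lemma Rintegral_ae_cst (X : {RV P >-> R}) (c : R) (u : R -> R) :
  measurable_fun setT u -> {ae P, forall w, X w = c} ->
  P.-integrable setT (fun w => (u (X w))%:E) /\ \int[P]_w u (X w) = u c.
Proof.
move=> mu_ Xc.
have mX : measurable_fun setT (fun w => (u (X w))%:E).
  by apply/measurable_EFinP; exact: measurableT_comp.
have ae : ae_eq P setT (fun w => (u (X w))%:E) (fun=> (u c)%:E).
  by move: Xc; apply: filterS => w -> _.
have ic : P.-integrable setT (fun=> (u c)%:E).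
  exact: finite_measure_integrable_cst.
split.
  apply/integrableP; split => //.
  rewrite (@ae_eq_integral _ _ _ _ _ (fun=> `|(u c)%:E|%E))//.
  - by case/integrableP : ic.
  - exact: measurableT_comp.
  - by move: ae; apply: filterS => w + I => /(_ I) ->.
rewrite /Rintegral (ae_eq_integral _ _ _ _ _ ae)// integral_cst//=.
by rewrite probability_setT mule1.
Qed.

Lemma gaussian_moments (X : {RV P >-> R}) (p : nat) : is_gaussian X ->
  P.-integrable setT (fun w => (`|X w| ^+ p)%:E).
Proof.
have mn : measurable_fun setT (fun x : R => `|x| ^+ p).
  by apply: (measurable_funX p); exact: normr_measurable.
case=> [[m [s [s0 lX]]]|[m Xm]].
  have [] // := integral_law lX mn.
  apply: (@integrable_normal_dom _ _ _ s0 _ 1 p) => // x.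
  by rewrite mul1r normrX normr_id lerXn2r ?nnegrE ?addr_ge0// lerDr.
by have [] := Rintegral_ae_cst mn Xm.
Qed.

(** For a normal law, the first two moments identify the parameters in [normal_cos]; a
   constant variable of mean 0 is 0 almost surely. *)
Lemma gaussian_cos (X : {RV P >-> R}) (b : R) : is_gaussian X ->
  \int[P]_w X w = 0 ->
  \int[P]_w cos (X w + b) = expR (- (\int[P]_w (X w) ^+ 2 / 2)) * cos b.
Proof.
have mc : measurable_fun setT (fun x : R => cos (x + b)).
  by have := measurable_cos_affine 1 b; under eq_fun do rewrite mul1r.
have mi : measurable_fun setT (fun x : R => x) by [].
have m2 : measurable_fun setT (fun x : R => x ^+ 2) by exact: (measurable_funX 2).
case=> [[m [s [s0 lX]]]|[m Xm]] X0.
  have m0 : m = 0.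
    rewrite -X0 (Rintegral_law lX mi) ?normal_first_moment//.
    by have := integrable_normal_power s0 m 1.
  rewrite {}m0 in lX.
  have ic : mu.-integrable setT (fun x => (cos (x + b) * normal_pdf 0 s x)%:E).
    by have := integrable_cos_normal s0 1 b; under eq_fun do rewrite mul1r.
  rewrite (Rintegral_law lX mc ic) normal_cos//.
  rewrite (Rintegral_law lX m2) ?normal_second_moment//.
  exact: integrable_normal_power.
have [_ e1] := Rintegral_ae_cst mi Xm; rewrite X0 in e1; rewrite -{}e1 in Xm.
have [_ ->] := Rintegral_ae_cst mc Xm; have [_ ->] := Rintegral_ae_cst m2 Xm.
by rewrite add0r expr0n/= mul0r oppr0 expR0 mul1r.
Qed.

End gaussian_variable.

(** * Polynomial approximation *)

Section bernstein.
Context {R : realType}.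

(** E g(S_n) for S_n binomial of parameters n and x, as a polynomial in x, computed by
   conditioning on the first trial. *)
Fixpoint bernstein (n : nat) (g : nat -> R) : {poly R} :=
  if n is m.+1 then (1 - 'X) * bernstein m g + 'X * bernstein m (g \o succn)
  else (g 0%N)%:P.

Lemma bernsteinS n g x : (bernstein n.+1 g).[x] =
  (1 - x) * (bernstein n g).[x] + x * (bernstein n (g \o succn)).[x].
Proof. by rewrite /= !hornerE. Qed.

Lemma bernstein_lin n a g h x :
  (bernstein n (fun k => a * g k + h k)).[x] =
  a * (bernstein n g).[x] + (bernstein n h).[x].
Proof.
elim: n g h => [|n IH] g h; first by rewrite /= !hornerC.
rewrite !bernsteinS; have := IH g h; have := IH (g \o succn) (h \o succn).
by rewrite /comp => -> ->; ring.
Qed.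

Lemma bernstein_cst n c x : (bernstein n (fun=> c)).[x] = c.
Proof.
elim: n => [|n IH]; first by rewrite /= hornerC.
by rewrite bernsteinS /comp IH; ring.
Qed.

Lemma bernstein_le n g h x : 0 <= x <= 1 ->
  (forall k, (k <= n)%N -> g k <= h k) ->
  (bernstein n g).[x] <= (bernstein n h).[x].
Proof.
move=> /andP[x0 x1]; elim: n g h => [|n IH] g h gh.
  by rewrite /= !hornerC gh.
rewrite !bernsteinS; apply: lerD; apply: ler_wpM2l; rewrite ?subr_ge0//; apply: IH => k kn.
  by rewrite gh// ltnW.
exact: gh.
Qed.

Lemma bernstein_sqr n (a x : R) : (bernstein n (fun k => (k%:R + a) ^+ 2)).[x] =
  (n%:R * x + a) ^+ 2 + n%:R * (x * (1 - x)).
Proof.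
elim: n a => [|n IH] a; first by rewrite /= hornerC; ring.
rewrite bernsteinS IH.
have -> : (fun k => (k%:R + a) ^+ 2) \o succn = (fun k => (k%:R + (a + 1)) ^+ 2).
  by apply/funext => k /=; rewrite -natr1; congr (_ ^+ 2); ring.
by rewrite IH -natr1; ring.
Qed.

(** For [|y - x| < d] this is uniform continuity; otherwise [(y - x)^2 / d^2] is at least
   1 and pays for the oscillation [2 * M] of [f]. *)
Lemma segment_modulus (f : R -> R) (e : R) : continuous f -> 0 < e ->
  exists2 K : R, 0 <= K & forall x y, 0 <= x <= 1 -> 0 <= y <= 1 ->
    `|f y - f x| <= e + K * (y - x) ^+ 2.
Proof.
move=> cf e0.
have cn : continuous (fun x => `|f x|) by apply: cont_comp cf => x; exact: norm_continuous.
have [c _ hc] := EVT_max (@ler01 R) (continuous_subspaceT cn).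
pose M := `|f c|.
have fM x : 0 <= x <= 1 -> `|f x| <= M by move=> x01; apply: hc; rewrite in_itv.
have cov := (@compact_near_coveringP R^o `[0, 1]%classic).1 (@segment_compact R 0 1).
have H := cov R (0^'+) (fun d x => forall y, `|y - x| < d -> `|f y - f x| <= e) _.
have {H} : \forall d \near (0 : R)^'+, `[0, 1]%classic `<=`
    (fun x : R => forall y, `|y - x| < d -> `|f y - f x| <= e).
  apply: H => x _.
  have e20 : 0 < e / 2 by rewrite divr_gt0.
  have /cvgrPdist_lt /(_ _ e20) /nbhs_ballP [d /= d0 hd] := cf x.
  exists (ball x (d / 2), [set z | z < d / 2]).
    split => /=; first by apply: nbhsx_ballx; rewrite divr_gt0.
    by near=> z; near: z; apply: nbhs_right_lt; rewrite divr_gt0.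
  move=> [z d'] /= [xz d'd] y yz.
  have h1 : ball x d z by apply: le_ball xz; rewrite ler_pdivrMr// ler_peMr ?(ltW d0)// ler1n.
  have h2 : ball x d y.
    rewrite /ball/=; rewrite /ball/= in xz.
    have h := ler_distD z x y; rewrite (distrC z y) in h; apply: le_lt_trans h _; rewrite [ltRHS](splitr d); apply: ltrD => //; exact: lt_trans yz d'd.
  have := hd _ h1; have := hd _ h2; rewrite /=.
  have := ler_distD (f x) (f y) (f z); rewrite (distrC (f y) (f x)); lra.
move=> near0.
have [d [d0 hd]] : exists d : R, 0 < d /\ forall x, 0 <= x <= 1 ->
    forall y, `|y - x| < d -> `|f y - f x| <= e.
  near (0 : R)^'+ => d; exists d; split; first by near: d; exact: nbhs_right_gt.
  move=> x x01; have : `[0, 1]%classic `<=`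
      (fun x : R => forall y, `|y - x| < d -> `|f y - f x| <= e) by near: d.
  by apply; rewrite /= in_itv.
have M0 : 0 <= M by exact: normr_ge0.
exists (2 * M / d ^+ 2); first by rewrite divr_ge0 ?sqr_ge0// mulr_ge0.
move=> x y x01 y01; have [xy|xy] := ltP `|y - x| d.
  apply: le_trans (hd _ x01 _ xy) _; rewrite lerDl mulr_ge0 ?sqr_ge0//.
  by rewrite divr_ge0 ?sqr_ge0// mulr_ge0.
have h1 : 2 * M <= 2 * M / d ^+ 2 * (y - x) ^+ 2.
  rewrite -mulrA ler_peMr ?mulr_ge0// mulrC ler_pdivlMr ?exprn_gt0// mul1r.
  by rewrite -(real_normK (num_real (y - x))) lerXn2r ?nnegrE// ltW.
have := ler_normB (f y) (f x); have := fM _ x01; have := fM _ y01; lra.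
Unshelve. all: by end_near. Qed.

(** E f(S_n/n) differs from f(x) by at most e/2 plus K times the variance of S_n/n. *)
Lemma weierstrass01 (f : R -> R) (e : R) : continuous f -> 0 < e ->
  exists p : {poly R}, forall x, 0 <= x <= 1 -> `|p.[x] - f x| <= e.
Proof.
move=> cf e0; have e20 : 0 < e / 2 by rewrite divr_gt0.
have [K K0 hK] := segment_modulus cf e20.
have [n n0 hn] : exists2 n, (0 < n)%N & K / n%:R <= e / 2.
  near \oo => n; exists n; first by near: n; exact: nbhs_infty_gt.
  rewrite ler_pdivrMr; last by rewrite ltr0n; near: n; exact: nbhs_infty_gt.
  by rewrite -ler_pdivrMl//; near: n; exact: nbhs_infty_ger.
have n0R : 0 < n%:R :> R by rewrite ltr0n.
pose g k := f (k%:R / n%:R).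
exists (bernstein n g) => x x01.
have [x0 x1] := andP x01.
have gk k : (k <= n)%N ->
    `|g k - f x| <= K / n%:R ^+ 2 * (k%:R + - (n%:R * x)) ^+ 2 + e / 2.
  move=> kn; have k01 : 0 <= (k%:R / n%:R : R) <= 1.
    by rewrite divr_ge0//= ler_pdivrMr// mul1r ler_nat.
  apply: le_trans (hK _ _ x01 k01) _; rewrite addrC lerD2r.
  by rewrite le_eqVlt; apply/orP; left; apply/eqP; field; rewrite gt_eqF.
(* [s] is a sign: [bernstein_le] is one-sided. *)
have bE (s : R) : s ^+ 2 = 1 -> s * ((bernstein n g).[x] - f x) <= e.
  move=> s1.
  have -> : s * ((bernstein n g).[x] - f x) =
      (bernstein n (fun k => s * g k + (- s * f x))).[x].
    by rewrite bernstein_lin bernstein_cst; ring.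
  apply: (@le_trans _ _ (bernstein n (fun k => K / n%:R ^+ 2 *
      (k%:R + - (n%:R * x)) ^+ 2 + e / 2)).[x]).
    apply: bernstein_le => // k kn; apply: le_trans (gk k kn).
    rewrite mulNr -mulrBr (le_trans (ler_norm _))// normrM.
    have -> : `|s| = 1.
      by apply/eqP; rewrite -(@eqrXn2 _ 2)// ?nnegrE// real_normK ?num_real// s1 expr1n.
    by rewrite mul1r.
  rewrite bernstein_lin bernstein_cst bernstein_sqr subrr expr0n/= add0r.
  have -> : K / n%:R ^+ 2 * (n%:R * (x * (1 - x))) = K / n%:R * (x * (1 - x)).
    by field; rewrite gt_eqF.
  have : K / n%:R * (x * (1 - x)) <= K / n%:R.
    by rewrite ler_piMr// ?divr_ge0//; nra.
  lra.
rewrite ler_norml; apply/andP; split.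
  by have := bE (-1) (etrans (sqrrN 1) (expr1n _ _)); rewrite mulN1r; lra.
by have := bE 1 (expr1n _ _); rewrite mul1r.
Unshelve. all: by end_near. Qed.

Lemma weierstrass (f : R -> R) (L e : R) : continuous f -> 0 < L -> 0 < e ->
  exists p : {poly R}, forall x, `|x| <= L -> `|p.[x] - f x| <= e.
Proof.
move=> cf L0 e0.
have cg : continuous (fun t : R => f (L * (2 * t - 1))).
  apply: (cont_comp cf); apply: contZ; apply: contB; last by move=> x; exact: cvg_cst.
  by apply: contZ => x; exact: cvg_id.
have [p hp] := weierstrass01 cg e0.
exists (p \Po ((2 * L)^-1 *: ('X + L%:P))) => x; rewrite ler_norml => /andP[x1 x2].
have /hp : 0 <= (2 * L)^-1 * (x + L) <= 1.
  have L20 : 0 < 2 * L by rewrite mulr_gt0.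
  rewrite mulrC; apply/andP; split; last by rewrite ler_pdivrMr//; lra.
  by apply: divr_ge0; [lra|exact: ltW].
rewrite [X in f X](_ : _ = x); last by field; rewrite gt_eqF.
by rewrite horner_comp !hornerE.
Qed.

Lemma poly_antiderivative (p : {poly R}) : exists P : {poly R}, P^`() = p.
Proof.
exists (\poly_(i < (size p).+1) (p`_i.-1 / i%:R)).
apply/polyP => i; rewrite coef_deriv coef_poly ltnS /=.
case: ltnP => [ip|pi]; last by rewrite mul0rn nth_default.
by rewrite -[LHS]mulr_natr divfK// pnatr_eq0.
Qed.

(** Approximate the derivative, then integrate. *)
Lemma weierstrass_C1 (f f' : R -> R) (L e : R) :
  (forall x, is_derive x (1 : R) f (f' x)) -> continuous f' -> 0 < L -> 0 < e ->
  exists p : {poly R}, forall x, `|x| <= L ->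
    `|p.[x] - f x| <= e /\ `|p^`().[x] - f' x| <= e.
Proof.
move=> df cf' L0 e0.
pose e1 := Num.min e (e / L).
have e10 : 0 < e1 by rewrite lt_min e0 divr_gt0.
have [q hq] := weierstrass cf' L0 e10.
have [Q Qq] := poly_antiderivative q.
pose c := f 0 - Q.[0].
exists (Q + c%:P) => x xL; rewrite derivD derivC addr0 Qq; split; last first.
  by apply: le_trans (hq x xL) _; rewrite ge_min lexx.
have dD y : is_derive y (1 : R) (fun y => (Q + c%:P).[y] - f y) (q.[y] - f' y).
  apply: derB => //; have := is_derive_poly (Q + c%:P) y.
  by rewrite derivD derivC addr0 Qq.
have cD := der_continuous dD.
have e1L : e1 * L <= e.
  by apply: (@le_trans _ _ (e / L * L)); [rewrite ler_pM2r// ge_min lexx orbT|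
     rewrite divfK// gt_eqF].
have D0 : (Q + c%:P).[0] - f 0 = 0 by rewrite hornerD hornerC /c; ring.
have key a b : a <= b -> `|a| <= L -> `|b| <= L ->
    `|((Q + c%:P).[b] - f b) - ((Q + c%:P).[a] - f a)| <= e1 * (b - a).
  move=> ab aL bL; have [z /andP[az zb] ->] := mean_value dD ab.
  rewrite normrM (ger0_norm (_ : 0 <= b - a)) ?subr_ge0// ler_wpM2r ?subr_ge0//.
  apply: hq; move: aL bL; rewrite !ler_norml; lra.
have L00 : `|0 : R| <= L by rewrite normr0 ltW.
have [x0|x0] := leP 0 x.
  have := key 0 x x0 L00 xL; rewrite D0 !subr0 => /le_trans; apply.
  apply: le_trans e1L; rewrite ler_wpM2l ?(ltW e10)//.
  by rewrite (le_trans _ xL)// ler_norm.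
have := key x 0 (ltW x0) xL L00; rewrite D0 !sub0r normrN => /le_trans; apply.
apply: le_trans e1L; rewrite ler_wpM2l ?(ltW e10)//.
by rewrite (le_trans _ xL)// -normrN ler_norm.
Qed.

End bernstein.

(** * Moments and integration by parts *)

(** One majorant with moments of all orders replaces the moment conditions on individual
   variables: the functions bounded by a multiple of one of its powers are integrable and
   stable under all the operations needed. *)
Record weight {R : realType} {d : measure_display} {T : measurableType d}
    (P : probability T R) := Weight {
  weight_fun :> T -> R ;
  weight_ge1 : forall w, 1 <= weight_fun w ;
  weight_integrable : forall p : nat,
    P.-integrable setT (fun w => (weight_fun w ^+ p)%:E) }.

Section tame_functions.
Context {R : realType} {d : measure_display} {T : measurableType d}.
Variable P : probability T R.
Variable N : weight P.
Let N1 := weight_ge1 N.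
Let iN := weight_integrable N.

Implicit Types (g u : T -> R) (C : R) (p : nat).

Definition tame g := measurable_fun setT g /\
  exists C p, forall w, `|g w| <= C * N w ^+ p.

Notation Ex g := (\int[P]_w g w).

Let N0 w : 0 <= N w. Proof. exact: le_trans (N1 w). Qed.

Let Np0 p w : 0 <= N w ^+ p. Proof. by rewrite exprn_ge0. Qed.

Let Np_le p q w : (p <= q)%N -> N w ^+ p <= N w ^+ q.
Proof. by move=> pq; rewrite ler_weXn2l. Qed.

Lemma tame_bound g : tame g -> measurable_fun setT g /\
  exists2 C, 0 <= C & exists p, forall w, `|g w| <= C * N w ^+ p.
Proof.
move=> [mg [C [p gC]]]; split => //; exists `|C| => //; exists p => w.
by apply: le_trans (gC w) _; rewrite ler_wpM2r// ler_norm.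
Qed.

Lemma tame_cst (c : R) : tame (fun=> c).
Proof. by split => //; exists `|c|, 0%N => w; rewrite expr0 mulr1. Qed.

Lemma tameD g h : tame g -> tame h -> tame (fun w => g w + h w).
Proof.
move=> /tame_bound[mg [C C0 [p gC]]] /tame_bound[mh [K K0 [q hK]]].
split; first exact: measurable_funD.
exists (C + K), (p + q)%N => w; rewrite mulrDl; apply: le_trans (ler_normD _ _) _.
apply: lerD; [apply: le_trans (gC w) _|apply: le_trans (hK w) _];
  by rewrite ler_wpM2l// Np_le// ?leq_addr ?leq_addl.
Qed.

Lemma tameM g h : tame g -> tame h -> tame (fun w => g w * h w).
Proof.
move=> /tame_bound[mg [C C0 [p gC]]] /tame_bound[mh [K K0 [q hK]]].
split; first exact: measurable_funM.
exists (C * K), (p + q)%N => w; rewrite normrM exprD mulrACA.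
exact: ler_pM.
Qed.

Lemma tameZ c g : tame g -> tame (fun w => c * g w).
Proof. by apply: tameM; exact: tame_cst. Qed.

Lemma tameN g : tame g -> tame (fun w => - g w).
Proof. by move/(tameZ (-1)); under eq_fun do rewrite mulN1r. Qed.

Lemma tameB g h : tame g -> tame h -> tame (fun w => g w - h w).
Proof. by move=> tg /tameN; exact: tameD. Qed.

Lemma tame_sum (I : Type) (s : seq I) (g : I -> T -> R) :
  (forall i, tame (g i)) -> tame (fun w => \sum_(i <- s) g i w).
Proof.
move=> tg; elim: s => [|i s IH].
  under eq_fun do rewrite big_nil; exact: tame_cst.
under eq_fun do rewrite big_cons; exact: tameD.
Qed.

Lemma tame_norm g : tame g -> tame (fun w => `|g w|).
Proof.
move=> [mg [C [p gC]]]; split; first exact: measurableT_comp.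
by exists C, p => w; rewrite normr_id.
Qed.

Lemma tameX g p : tame g -> tame (fun w => g w ^+ p).
Proof.
move=> tg; elim: p => [|p IH]; first exact: tame_cst.
by under eq_fun do rewrite exprS; exact: tameM.
Qed.

Lemma tame_le g h : measurable_fun setT g -> tame h ->
  (forall w, `|g w| <= `|h w|) -> tame g.
Proof.
move=> mg [_ [C [p hC]]] gh; split => //; exists C, p => w.
exact: le_trans (gh w) (hC w).
Qed.

Lemma tame_comp (phi : R -> R) C p u : continuous phi ->
  (forall x, `|phi x| <= C * (1 + `|x|) ^+ p) -> tame u ->
  tame (fun w => phi (u w)).
Proof.
move=> cphi phiC tu; apply: (@tame_le _ (fun w => C * (1 + `|u w|) ^+ p)).
- apply: measurableT_comp; first exact: continuous_measurable_fun.
  by case: tu.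
- by apply/tameZ/tameX/tameD; [exact: tame_cst|exact: tame_norm].
- by move=> w; apply: le_trans (phiC _) (ler_norm _).
Qed.

Lemma tame_integrable g : tame g -> P.-integrable setT (EFin \o g).
Proof.
move=> /tame_bound[mg [C C0 [p gC]]].
have i1 : P.-integrable setT (fun w => C%:E * (N w ^+ p)%:E)%E.
  exact: integrableZl.
apply: le_integrable i1 => //; first exact/measurable_EFinP.
by move=> w _ /=; rewrite lee_fin (ger0_norm (mulr_ge0 C0 (Np0 p w))).
Qed.

Lemma ExD g h : tame g -> tame h -> Ex (fun w => g w + h w) = Ex g + Ex h.
Proof. by move=> /tame_integrable ? /tame_integrable ?; rewrite RintegralD. Qed.

Lemma ExZ c g : tame g -> Ex (fun w => c * g w) = c * Ex g.
Proof. by move=> /tame_integrable ?; rewrite RintegralZl. Qed.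

Lemma ExB g h : tame g -> tame h -> Ex (fun w => g w - h w) = Ex g - Ex h.
Proof. by move=> /tame_integrable ? /tame_integrable ?; rewrite RintegralB. Qed.

Lemma Ex_cst c : Ex (fun=> c) = c.
Proof. by rewrite Rintegral_cst//=; rewrite probability_setT mulr1. Qed.

Lemma Ex_sum (I : Type) (s : seq I) (g : I -> T -> R) :
  (forall i, tame (g i)) ->
  Ex (fun w => \sum_(i <- s) g i w) = \sum_(i <- s) Ex (g i).
Proof.
move=> tg; elim: s => [|i s IH].
  by rewrite big_nil; under eq_Rintegral do rewrite big_nil; rewrite Ex_cst.
rewrite big_cons; under eq_Rintegral do rewrite big_cons.
by rewrite ExD// ?IH//; exact: tame_sum.
Qed.

Lemma Ex_le g h : tame g -> tame h -> (forall w, g w <= h w) -> Ex g <= Ex h.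
Proof. by move=> /tame_integrable ? /tame_integrable ? gh; exact: le_Rintegral. Qed.

Lemma Ex_norm g : tame g -> `|Ex g| <= Ex (fun w => `|g w|).
Proof. by move=> /tame_integrable ?; exact: le_normr_Rintegral. Qed.

Lemma Ex_cvg (g_ : nat -> T -> R) g C p : (forall m, measurable_fun setT (g_ m)) ->
  (forall m w, `|g_ m w| <= C * N w ^+ p) ->
  (forall w, g_ m w @[m --> \oo] --> g w) ->
  tame g /\ Ex (g_ m) @[m --> \oo] --> Ex g.
Proof.
move=> mg_ g_C g_g.
have mg : measurable_fun setT g.
  by apply: (measurable_fun_cvg mg_) => w _; exact: g_g.
have tg : tame g.
  split => //; exists C, p => w.
  by apply: (cvgr_to_le (cvg_norm (g_g w))); exact: nearW.
split => //.
have iC : P.-integrable setT (fun w => C%:E * (N w ^+ p)%:E)%E by exact: integrableZl.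
have [] := @dominated_convergence _ _ _ P setT measurableT
  (fun m w => (g_ m w)%:E) (EFin \o g) (fun w => C%:E * (N w ^+ p)%:E)%E.
- by move=> m; exact/measurable_EFinP.
- exact/measurable_EFinP.
- by apply: aeW => w _; apply: cvg_EFin; [exact: nearW|exact: g_g].
- exact: iC.
- by apply: aeW => w m _; rewrite /= lee_fin g_C.
move=> _ _ H; apply: fine_cvg; rewrite fineK//.
by apply: integrable_fin_num => //; exact: tame_integrable.
Qed.

Section ibp.
Variable Y : T -> R.
Hypothesis tY : tame Y.

(** [g'] stands for the derivative of [g] in the direction of the Gaussian variable
   [Y]. *)
Definition ibp g g' := [/\ tame g, tame g' & Ex (fun w => Y w * g w) = Ex g'].

Lemma ibp_lin a b g g' h h' : ibp g g' -> ibp h h' ->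
  ibp (fun w => a * g w + b * h w) (fun w => a * g' w + b * h' w).
Proof.
move=> [tg tg' eg] [th th' eh]; split; try by apply: tameD; exact: tameZ.
rewrite ExD ?ExZ// ?eg ?eh//; try exact: tameZ.
rewrite -eg -eh -!ExZ -?ExD//; try (exact: tameM || by apply: tameZ; exact: tameM).
by apply: eq_Rintegral => w _; ring.
Qed.

(** Derivation is a closed operator, by dominated convergence. *)
Lemma ibp_cvg (g_ g'_ : nat -> T -> R) g g' C p :
  (forall m, ibp (g_ m) (g'_ m)) ->
  (forall m w, `|g_ m w| <= C * N w ^+ p) ->
  (forall m w, `|g'_ m w| <= C * N w ^+ p) ->
  (forall w, g_ m w @[m --> \oo] --> g w) ->
  (forall w, g'_ m w @[m --> \oo] --> g' w) -> ibp g g'.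
Proof.
move=> H gC g'C gg g'g'.
have mg m : measurable_fun setT (g_ m) by case: (H m) => -[].
have mg' m : measurable_fun setT (g'_ m) by case: (H m) => _ [].
have [tg _] := Ex_cvg mg gC gg.
have [tg' lim'] := Ex_cvg mg' g'C g'g'.
have [mY [CY CY0 [q YC]]] := tame_bound tY.
have mYg m : measurable_fun setT (fun w => Y w * g_ m w) by exact: measurable_funM.
have YgC m w : `|Y w * g_ m w| <= (CY * C) * N w ^+ (q + p).
  by rewrite normrM exprD mulrACA; apply: ler_pM.
have Yg w : (Y w * g_ m w) @[m --> \oo] --> Y w * g w.
  by apply: cvgM; [exact: cvg_cst|exact: gg].
have [_ lim] := Ex_cvg mYg YgC Yg.
split => //; move: lim lim'.
have -> : (fun m => Ex (fun w => Y w * g_ m w)) = fun m => Ex (g'_ m).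
  by apply/funext => m; case: (H m).
by move=> l1 l2; have := cvg_unique _ l1 l2; exact.
Qed.

End ibp.
End tame_functions.

(** * The chain rule *)

Section sine_scaling.
Context {R : realType}.

Lemma sin_le_norm (x : R) : `|sin x| <= `|x|.
Proof.
have := mean_value_norm (@is_derive_sin R) (@cos_max R) 0 x.
by rewrite sin0 !subr0 mul1r.
Qed.

Lemma sin_sub_id (x : R) : `|sin x - x| <= `|x| ^+ 2.
Proof.
have c1 (y : R) : `|cos y - 1| <= `|y|.
  have := mean_value_norm (@is_derive_cos R) (C := 1) _ 0 y.
  rewrite cos0 subr0 mul1r; apply => z; rewrite normrN; exact: sin_max.
wlog x0 : x / 0 <= x.
  move=> H; have [/H//|/ltW] := leP 0 x; rewrite -oppr_ge0 => /H.
  by rewrite sinN normrN -opprD normrN.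
have dD y : is_derive y (1 : R) (fun z : R => sin z - z) (cos y - 1).
  exact: derB (is_derive_sin y) (der_id y).
have [c /andP[c0 cx]] := mean_value dD x0.
rewrite sin0 subrr !subr0 => ->; rewrite normrM expr2 ler_wpM2r//.
by apply: le_trans (c1 c) _; rewrite !ger0_norm.
Qed.

Lemma cvg_sin_scaling (x : R) :
  (m.+1%:R * sin (x / m.+1%:R)) @[m --> \oo] --> x.
Proof.
apply: cvg_zero.
have : (m.+1%:R * sin (x / m.+1%:R) - x) @[m --> \oo] --> (0 : R).
  apply: (@cvg0_decay _ (x ^+ 2)) => m.
  have m0 : (m.+1%:R : R) != 0 by rewrite pnatr_eq0.
  have -> : m.+1%:R * sin (x / m.+1%:R) - x =
      m.+1%:R * (sin (x / m.+1%:R) - x / m.+1%:R) by field.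
  rewrite normrM normr_nat mulrA.
  apply: (@le_trans _ _ (m%:R * m.+1%:R * `|x / m.+1%:R| ^+ 2)).
    by rewrite ler_wpM2l ?mulr_ge0// sin_sub_id.
  rewrite normrM exprMn real_normK ?num_real// normfV normr_nat.
  have -> : m%:R * m.+1%:R * (x ^+ 2 * m.+1%:R^-1 ^+ 2) =
      x ^+ 2 * (m%:R / m.+1%:R) by field.
  by rewrite ler_piMr ?sqr_ge0// ler_pdivrMr// mul1r ler_nat.
exact: cvg_trans.
Qed.

End sine_scaling.

Section ibp_composition.
Context {R : realType} {d : measure_display} {T : measurableType d}.
Context {P : probability T R} {N : weight P} {Y g g' u u' : T -> R}.
Hypotheses (tY : tame N Y) (tg : tame N g) (tg' : tame N g').
Hypotheses (tu : tame N u) (tu' : tame N u').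

Hypothesis ibp_cos : forall s b,
  ibp N Y (fun w => g w * cos (s * u w + b))
    (fun w => g' w * cos (s * u w + b) - g w * u' w * (s * sin (s * u w + b))).

(** The pairs (psi, psi') for which integration by parts holds along [g * psi(u)], whose
   derivative is [g' * psi(u) + g * u' * psi'(u)]. *)
Let J (psi psi' : R -> R) :=
  ibp N Y (fun w => g w * psi (u w)) (fun w => g' w * psi (u w) + g w * u' w * psi' (u w)).

Let J_ext psi1 psi1' psi2 psi2' : psi1 =1 psi2 -> psi1' =1 psi2' ->
  J psi1 psi1' -> J psi2 psi2'.
Proof. by move=> /funext -> /funext ->. Qed.

Let J_lin a b psi1 psi1' psi2 psi2' : J psi1 psi1' -> J psi2 psi2' ->
  J (fun x => a * psi1 x + b * psi2 x) (fun x => a * psi1' x + b * psi2' x).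
Proof.
move=> j1 j2; have := ibp_lin tY a b j1 j2; rewrite /J.
congr ibp; apply/funext => w; ring.
Qed.

Let J_cos s b : J (fun x => cos (s * x + b)) (fun x => - (s * sin (s * x + b))).
Proof. by rewrite /J; under [X in ibp _ _ _ X]eq_fun do rewrite mulrN; exact: ibp_cos. Qed.

(** The additional cosine makes the class stable under products with a sine, since such a
   product only shifts the frequency of the cosine. *)
Let Jc (psi psi' : R -> R) := forall s b,
  J (fun x => cos (s * x + b) * psi x)
    (fun x => cos (s * x + b) * psi' x - s * sin (s * x + b) * psi x).

Let Jc_sin L psi psi' : Jc psi psi' ->
  Jc (fun x => psi x * sin (L * x)) (fun x => psi' x * sin (L * x) + psi x * (L * cos (L * x))).
Proof.
move=> jc s b.
have := J_lin 2^-1 (- 2^-1) (jc (s + L) (b - pi / 2)) (jc (s - L) (b - pi / 2)).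
have c1 x : cos ((s + L) * x + (b - pi / 2)) = sin ((s * x + b) + L * x).
  by rewrite -cosBpihalf; congr cos; ring.
have c2 x : cos ((s - L) * x + (b - pi / 2)) = sin ((s * x + b) - L * x).
  by rewrite -cosBpihalf; congr cos; ring.
have s1 x : sin ((s + L) * x + (b - pi / 2)) = - cos ((s * x + b) + L * x).
  rewrite (_ : _ + _ = (s * x + b + L * x) - pi / 2); last by ring.
  by rewrite -cosBpihalf -addrA -opprD -splitr cosB cospi sinpi mulr0 addr0 mulrN1.
have s2 x : sin ((s - L) * x + (b - pi / 2)) = - cos ((s * x + b) - L * x).
  rewrite (_ : _ + _ = (s * x + b - L * x) - pi / 2); last by ring.
  by rewrite -cosBpihalf -addrA -opprD -splitr cosB cospi sinpi mulr0 addr0 mulrN1.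
apply: J_ext => x; rewrite !c1 !c2 ?s1 ?s2; move: (s * x + b) (L * x) => A B;
  by rewrite ?sinB ?cosB ?sinD ?cosD; field.
Qed.

Let Jc_lin a b psi1 psi1' psi2 psi2' : Jc psi1 psi1' -> Jc psi2 psi2' ->
  Jc (fun x => a * psi1 x + b * psi2 x) (fun x => a * psi1' x + b * psi2' x).
Proof.
move=> j1 j2 s c; have := J_lin a b (j1 s c) (j2 s c).
by apply: J_ext => x; ring.
Qed.

Let Jc_1 : Jc (fun=> 1) (fun=> 0).
Proof. by move=> s b; apply: J_ext (J_cos s b) => x; ring. Qed.

Let Jc_poly L (p : {poly R}) : 0 < L ->
  Jc (fun x => p.[L * sin (L^-1 * x)]) (fun x => p^`().[L * sin (L^-1 * x)] * cos (L^-1 * x)).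
Proof.
move=> L0; have Ln0 : L != 0 by rewrite gt_eqF.
elim/poly_ind: p => [|p c IH].
  have := Jc_lin 0 0 Jc_1 Jc_1.
  by move=> H s b; have := H s b; apply: J_ext => x; rewrite ?deriv0 !horner0; ring.
have := Jc_lin L c (Jc_sin L^-1 IH) Jc_1.
move=> H s b; have := H s b; apply: J_ext => x;
  rewrite ?derivD ?derivC ?derivM ?derivX ?mulr1 ?addr0 ?hornerD ?hornerMX ?hornerC; field => //.
Qed.

Let J_cvg (psi_ psi_' : nat -> R -> R) psi psi' C p :
  (forall m, J (psi_ m) (psi_' m)) ->
  (forall m x, `|psi_ m x| <= C * (1 + `|x|) ^+ p) ->
  (forall m x, `|psi_' m x| <= C * (1 + `|x|) ^+ p) ->
  (forall x, psi_ m x @[m --> \oo] --> psi x) ->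
  (forall x, psi_' m x @[m --> \oo] --> psi' x) -> J psi psi'.
Proof.
move=> jm bC b'C lim lim'.
have tb : tame N (fun w => C * (1 + `|u w|) ^+ p).
  by apply/tameZ/tameX/tameD; [exact: tame_cst|exact: tame_norm].
have tb1 : tame N (fun w => `|g w| * (C * (1 + `|u w|) ^+ p)).
  by apply: tameM => //; exact: tame_norm.
have tb2 : tame N (fun w => (`|g' w| + `|g w * u' w|) * (C * (1 + `|u w|) ^+ p)).
  by apply: tameM => //; apply: tameD; apply: tame_norm => //; exact: tameM.
have [_ [K [q K0]]] := tameD (tame_norm tb1) (tame_norm tb2).
have Kb1 w : `|g w| * (C * (1 + `|u w|) ^+ p) <= K * N w ^+ q.
  apply: le_trans (K0 w); apply: le_trans (ler_norm _).
  by apply: le_trans (ler_norm _) _; rewrite lerDl.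
have Kb2 w : (`|g' w| + `|g w * u' w|) * (C * (1 + `|u w|) ^+ p) <= K * N w ^+ q.
  apply: le_trans (K0 w); apply: le_trans (ler_norm _).
  by apply: le_trans (ler_norm _) _; rewrite lerDr.
apply: (ibp_cvg tY jm (C := K) (p := q)).
- by move=> m w; apply: le_trans (Kb1 w); rewrite normrM ler_wpM2l.
- move=> m w; apply: le_trans (Kb2 w); apply: le_trans (ler_normD _ _) _.
  by rewrite mulrDl; apply: lerD; rewrite normrM ler_wpM2l.
- by move=> w; apply: cvgM; [exact: cvg_cst|exact: lim].
- move=> w; apply: (@cvgD _ R^o); apply: cvgM; try exact: cvg_cst.
    exact: lim.
  exact: lim'.
Qed.

(** Every C1 function [phi] of polynomial growth is reached from cosines: products of sines
   give [P(L sin(u/L))] for [P] polynomial, C1 approximation on [[-L, L]] gives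
   [phi(L sin(u/L))], and [L] tends to infinity. *)
Lemma ibp_comp (phi phi' : R -> R) C p :
  (forall x, is_derive x (1 : R) phi (phi' x)) -> continuous phi' ->
  (forall x, `|phi x| <= C * (1 + `|x|) ^+ p) ->
  (forall x, `|phi' x| <= C * (1 + `|x|) ^+ p) ->
  ibp N Y (fun w => g w * phi (u w)) (fun w => g' w * phi (u w) + g w * u' w * phi' (u w)).
Proof.
move=> dphi cphi' phiC phi'C.
have C0 : 0 <= C.
  by have := phiC 0; rewrite normr0 addr0 expr1n mulr1; apply: le_trans.
have JL L : 0 < L -> J (fun x => phi (L * sin (L^-1 * x)))
    (fun x => phi' (L * sin (L^-1 * x)) * cos (L^-1 * x)).
  move=> L0.
  have e_ m : 0 < (m.+1%:R)^-1 :> R by rewrite invr_gt0.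
  have /choice[p_ hp] m := weierstrass_C1 dphi cphi' L0 (e_ m).
  have sL x : `|L * sin (L^-1 * x)| <= L.
    by rewrite normrM (gtr0_norm L0) ler_piMr ?sin_max// ltW.
  pose K := C * (1 + L) ^+ p + 1.
  have bnd (z r : R) (f : R -> R) m : `|z| <= L -> (forall x, `|f x| <= C * (1 + `|x|) ^+ p) ->
      `|r - f z| <= m.+1%:R^-1 -> `|r| <= K.
    move=> zL fC rf; have := ler_normD (r - f z) (f z); rewrite subrK => /le_trans; apply.
    rewrite addrC; apply: lerD; last first.
      by apply: le_trans rf _; rewrite invf_le1// ler1n.
    apply: le_trans (fC z) _; rewrite ler_wpM2l// lerXn2r ?nnegrE ?addr_ge0 ?(ltW L0)//.
    by rewrite lerD2l.
  have cvgE (f : R -> R) (r : nat -> R) (z : R) : (forall m, `|r m - f z| <= m.+1%:R^-1) ->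
      r m @[m --> \oo] --> f z.
    move=> rf; apply: cvg_zero; apply: (@cvg0_decay _ 1) => m.
    apply: (@le_trans _ _ (m.+1%:R * m.+1%:R^-1)); last by rewrite divff.
    by apply: ler_pM => //; rewrite ler_nat.
  apply: (@J_cvg (fun m x => (p_ m).[L * sin (L^-1 * x)])
    (fun m x => (p_ m)^`().[L * sin (L^-1 * x)] * cos (L^-1 * x)) _ _ K 0).
  - move=> m; have := Jc_poly (p_ m) L0 0 0.
    by apply: J_ext => x; rewrite mul0r addr0 cos0 ?mul0r; ring.
  - by move=> m x; rewrite expr0 mulr1; apply: bnd (sL x) phiC (hp m _ (sL x)).1.
  - move=> m x; rewrite expr0 mulr1 normrM; apply: (@le_trans _ _ (K * 1)); last by rewrite mulr1.
    by apply: ler_pM; rewrite ?cos_max//; apply: bnd (sL x) phi'C (hp m _ (sL x)).2.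
  - by move=> x; apply: (cvgE phi) => m; exact: (hp m _ (sL x)).1.
  - move=> x; apply: cvgM; last exact: cvg_cst.
    by apply: (cvgE phi') => m; exact: (hp m _ (sL x)).2.
have le1 (x : R) m : `|m.+1%:R * sin (m.+1%:R^-1 * x)| <= `|x|.
  rewrite normrM normr_nat -ler_pdivlMl//.
  by apply: le_trans (sin_le_norm _) _; rewrite normrM normfV normr_nat.
have bnd (f : R -> R) m x : (forall x, `|f x| <= C * (1 + `|x|) ^+ p) ->
    `|f (m.+1%:R * sin (m.+1%:R^-1 * x))| <= C * (1 + `|x|) ^+ p.
  move=> fC; apply: le_trans (fC _) _.
  by rewrite ler_wpM2l// lerXn2r ?nnegrE ?addr_ge0// lerD2l.
have lim x : (m.+1%:R * sin (m.+1%:R^-1 * x)) @[m --> \oo] --> (x : R).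
  by under eq_cvg do rewrite (mulrC _ x); exact: cvg_sin_scaling.
apply: (@J_cvg (fun m x => phi (m.+1%:R * sin (m.+1%:R^-1 * x)))
  (fun m x => phi' (m.+1%:R * sin (m.+1%:R^-1 * x)) * cos (m.+1%:R^-1 * x)) _ _ C p).
- by move=> m; exact: JL.
- by move=> m x; exact: bnd.
- move=> m x; rewrite normrM -[leRHS]mulr1.
  by apply: ler_pM => //; [exact: bnd|exact: cos_max].
- by move=> x; apply: continuous_cvg (lim x); exact: (der_continuous dphi).
- move=> x; rewrite -[X in _ --> X]mulr1; apply: cvgM.
    by apply: continuous_cvg (lim x); exact: cphi'.
  rewrite -[X in _ --> X](@cos0 R); apply: continuous_cvg; first exact: continuous_cos.
  apply: (@cvg0_decay _ `|x|) => m; rewrite normrM normfV normr_nat mulrA.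
  by rewrite ler_piMl// ler_pdivrMr// mul1r ler_nat.
Qed.

End ibp_composition.

(** * Gaussian families *)

Section polynomial_growth.
Context {R : realType}.

Definition C1_growth (phi phi' : R -> R) :=
  [/\ forall x, is_derive x (1 : R) phi (phi' x), continuous phi' &
      exists C p, forall x, `|phi x| <= C * (1 + `|x|) ^+ p /\
                            `|phi' x| <= C * (1 + `|x|) ^+ p].

Lemma poly_growth (q : {poly R}) :
  exists2 C, 0 <= C & exists p, forall x, `|q.[x]| <= C * (1 + `|x|) ^+ p.
Proof.
elim/poly_ind: q => [|q c [C C0 [p hC]]].
  by exists 0 => //; exists 0%N => x; rewrite horner0 normr0 mul0r.
exists (C + `|c|); first by rewrite addr_ge0.
exists p.+1 => x; rewrite hornerMXaddC mulrDl; apply: le_trans (ler_normD _ _) _.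
apply: lerD.
  rewrite normrM exprSr mulrA; apply: ler_pM => //.
  by rewrite lerDr.
by rewrite ler_peMr// exprn_ege1// lerDl.
Qed.

Lemma C1_growth_poly (q : {poly R}) : C1_growth (horner q) (horner q^`()).
Proof.
split=> [x||]; first exact: is_derive_poly.
  exact: continuous_horner.
have [C C0 [p hC]] := poly_growth q; have [K K0 [r hK]] := poly_growth q^`().
exists (C + K), (p + r)%N => x; split.
  apply: le_trans (hC x) _; apply: ler_pM; rewrite ?exprn_ge0 ?addr_ge0// ?lerDl//.
  by rewrite ler_weXn2l ?leq_addr// lerDl.
apply: le_trans (hK x) _; apply: ler_pM; rewrite ?exprn_ge0 ?addr_ge0// ?lerDr//.
by rewrite ler_weXn2l ?leq_addl// lerDl.
Qed.

Lemma C1_growthZ (a : R) (phi phi' : R -> R) : C1_growth phi phi' ->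
  C1_growth (fun x => a * phi x) (fun x => a * phi' x).
Proof.
move=> [df cf' [Kf [pf hf]]]; split.
- by move=> x; exact: derZ.
- exact: contZ.
- exists (`|a| * Kf), pf => x; rewrite !normrM -mulrA.
  by split; rewrite ler_wpM2l//; apply hf.
Qed.


Lemma C1_growth_bounded_comp (f f' phi phi' : R -> R) :
  (forall x, is_derive x (1 : R) f (f' x)) -> continuous f' ->
  (forall x, `|f x| <= 1) -> (forall x, `|f' x| <= 1) ->
  C1_growth phi phi' -> C1_growth (fun x => f (phi x)) (fun x => f' (phi x) * phi' x).
Proof.
move=> df cf' f1 f'1 [dp cp' [C [p hC]]]; split.
- by move=> x; exact: der_comp (dp x) (df _).
- by apply: contM cp'; apply: cont_comp cf' (der_continuous dp).
have C0 : 0 <= C.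
  by have := (hC 0).1; rewrite normr0 addr0 expr1n mulr1; apply: le_trans.
exists (1 + C), p => x.
have p1 : 1 <= (1 + `|x|) ^+ p by rewrite exprn_ege1// lerDl.
split.
  apply: le_trans (f1 _) _; rewrite mulrDl mul1r.
  by rewrite (le_trans p1)// lerDl mulr_ge0// (le_trans _ p1).
rewrite normrM -[leRHS]mul1r; apply: ler_pM => //; apply: le_trans (hC x).2 _.
by rewrite ler_wpM2r ?lerDr// (le_trans _ p1).
Qed.

Lemma sum_delta (n : nat) (j : 'I_n) (f : 'I_n -> R) :
  \sum_(i < n) (i == j)%:R * f i = f j.
Proof.
rewrite (bigD1 j)//= eqxx mul1r big1 ?addr0// => i /negbTE ->.
by rewrite mul0r.
Qed.

Lemma der_seq (f : R -> R) (x l : R) : is_derive x (1 : R) f l ->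
  (m.+1%:R * (f (x + m.+1%:R^-1) - f x)) @[m --> \oo] --> l.
Proof.
move=> [/cvg_ex[l' H] e]; have {e} e : l' = l by rewrite -e; apply/esym/cvg_lim.
rewrite {}e in H.
have h0 : (m.+1%:R^-1 : R) @[m --> \oo] --> (0 : R).
  apply: (@cvg0_decay _ 1) => m; rewrite normfV normr_nat.
  by rewrite ler_pdivrMr// mul1r ler_nat.
have hn m : (m.+1%:R^-1 : R) != 0 by rewrite invr_eq0 pnatr_eq0.
move/cvgr_dnbhsP : H => /(_ (fun m => m.+1%:R^-1) (conj hn h0)).
apply: cvg_trans; apply: near_eq_cvg; near=> m.
by rewrite /= invrK /GRing.scale/= mulr1 (addrC x).
Unshelve. all: by end_near. Qed.

End polynomial_growth.

(** Gaussianity enters through the characteristic function; the phase [b] gives both its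
   real and its imaginary part. *)
Record gaussian_family {R : realType} {d : measure_display} {T : measurableType d}
    {P : probability T R} (N : weight P) (n : nat) (X : 'I_n -> T -> R)
    (C : 'I_n -> 'I_n -> R) : Prop := GaussianFamily {
  family_measurable : forall i, measurable_fun setT (X i) ;
  family_le : forall i w, `|X i w| <= N w ;
  family_sym : forall i j, C i j = C j i ;
  family_cos : forall (t : 'I_n -> R) b,
    \int[P]_w cos (\sum_(i < n) t i * X i w + b) =
    expR (- (\sum_(i < n) \sum_(j < n) t i * t j * C i j / 2)) * cos b }.

Section gaussian_family.
Context {R : realType} {d : measure_display} {T : measurableType d}.
Context {P : probability T R} {N : weight P} {n : nat}.
Context {X : 'I_n -> T -> R} {C : 'I_n -> 'I_n -> R}.
Hypothesis GF : gaussian_family N X C.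
Let mX := family_measurable GF.
Let XN := family_le GF.
Let C_sym := family_sym GF.
Let X_cos := family_cos GF.

Notation Ex g := (\int[P]_w g w).
Notation "<< t >>" := (fun w => \sum_(i < n) t i * X i w).

Lemma tame_gaussian i : tame N (X i).
Proof. by split => //; exists 1, 1%N => w; rewrite mul1r expr1. Qed.

Let tame_lf t : tame N <<t>>.
Proof. by apply: tame_sum => i; apply: tameZ; exact: tame_gaussian. Qed.

Let tame_cos (u : T -> R) b : tame N u -> tame N (fun w => cos (u w + b)).
Proof.
move=> tu; apply: (@tame_comp _ _ _ _ _ cos 1 0); first exact: continuous_cos.
  by move=> x; rewrite mul1r expr0 cos_max.
by apply: tameD tu _; exact: tame_cst.
Qed.

Let tame_sin (u : T -> R) b : tame N u -> tame N (fun w => sin (u w + b)).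
Proof.
move=> tu; apply: (@tame_comp _ _ _ _ _ sin 1 0); first exact: continuous_sin.
  by move=> x; rewrite mul1r expr0 sin_max.
by apply: tameD tu _; exact: tame_cst.
Qed.

Variable k : 'I_n.
Let c t := \sum_(i < n) C k i * t i.

Let shift (t : 'I_n -> R) s j := fun i : 'I_n => t i + s * (i == j)%:R.

Let lf_shift t s j w : <<shift t s j>> w = <<t>> w + s * X j w.
Proof.
rewrite /shift; under eq_bigr do rewrite mulrDl -mulrA.
by rewrite big_split/= -mulr_sumr sum_delta.
Qed.

Let c_shift t s j : c (shift t s j) = c t + s * C k j.
Proof.
rewrite /c /shift; under eq_bigr do rewrite mulrDr mulrC (mulrC (C _ _) (s * _)) -mulrA.
rewrite big_split/= -mulr_sumr sum_delta; congr (_ + _).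
by apply: eq_bigr => i _; rewrite mulrC.
Qed.

Let q t := \sum_(i < n) \sum_(j < n) t i * t j * C i j / 2.

Let q_shift t s : q (shift t s k) = q t + s * c t + s ^+ 2 * (C k k / 2).
Proof.
have inner i : \sum_(j < n) shift t s k i * shift t s k j * C i j / 2 =
    (\sum_(j < n) t i * t j * C i j / 2 + s * (t i * C i k / 2)) +
    (i == k)%:R * (s * c t / 2 + s ^+ 2 * C k k / 2).
  have -> : (i == k)%:R * (s * c t / 2 + s ^+ 2 * C k k / 2) =
      (i == k)%:R * (s * \sum_(j < n) C i j * t j / 2 + s ^+ 2 * C i k / 2).
    by case: eqP => [->|_]; rewrite ?mul0r// /c -(mulrA s) mulr_suml.
  have e1 : \sum_(j < n) (j == k)%:R * (t i * s * C i j / 2) = t i * s * C i k / 2.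
    exact: sum_delta.
  have e2 : \sum_(j < n) (j == k)%:R * (s ^+ 2 * C i j / 2) = s ^+ 2 * C i k / 2.
    exact: sum_delta.
  have -> : s * (t i * C i k / 2) = t i * s * C i k / 2 by ring.
  rewrite -e1 -e2 mulr_sumr -!big_split/= mulr_sumr -big_split/=.
  by apply: eq_bigr => j _; rewrite /shift; ring.
rewrite /q; under eq_bigr do rewrite inner.
rewrite !big_split/= sum_delta -mulr_sumr -[RHS]addrA -[LHS]addrA; congr (_ + _).
have -> : \sum_(i < n) t i * C i k / 2 = c t / 2.
  by rewrite /c mulr_suml; apply: eq_bigr => i _; rewrite C_sym (mulrC (t i)).
by field.
Qed.

(** Differentiate E cos(<t, X> + s X_k + b) at s = 0 in two ways. *)
Let Ex_sin t b : Ex (fun w => X k w * sin (<<t>> w + b)) = c t * Ex (fun w => cos (<<t>> w + b)).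
Proof.
pose D m w := m.+1%:R * (cos (<<t>> w + b + m.+1%:R^-1 * X k w) - cos (<<t>> w + b)).
have cexp : Ex (D m) @[m --> \oo] --> - (c t * Ex (fun w => cos (<<t>> w + b))).
  pose f s := expR (- (q t + s * c t + s ^+ 2 * (C k k / 2))) * cos b.
  have df : is_derive (0 : R) (1 : R) f (- (c t * Ex (fun w => cos (<<t>> w + b)))).
    have d1 := derD (derD (der_cst (q t) 0) (derM (der_id 0) (der_cst (c t) 0)))
      (derM (der_sqr 0) (der_cst (C k k / 2) 0)).
    have d2 := derM (der_comp (derN d1) (is_derive_expR _)) (der_cst (cos b) 0).
    apply: is_derive_eq d2 _; rewrite X_cos -/(q t) expr0n/= !mul0r !addr0.
    by ring.
  have := der_seq df; apply: cvg_trans; apply: near_eq_cvg; near=> m.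
  have e1 : Ex (fun w => cos (<<t>> w + b + m.+1%:R^-1 * X k w)) = f (0 + m.+1%:R^-1).
    rewrite add0r /f -q_shift -X_cos; apply: eq_Rintegral => w _.
    by rewrite lf_shift; congr cos; ring.
  have e2 : Ex (fun w => cos (<<t>> w + b)) = f 0.
    by rewrite X_cos /f expr0n/= !mul0r !addr0.
  have t1 : tame N (fun w => cos (<<t>> w + b)) by exact: tame_cos.
  have t2 : tame N (fun w => cos (<<t>> w + b + m.+1%:R^-1 * X k w)).
    under eq_fun do rewrite addrAC.
    by apply: tame_cos; apply: tameD => //; apply: tameZ; exact: tame_gaussian.
  by rewrite -e1 -e2 -(ExB t2 t1) -(ExZ _ (tameB t2 t1)).
have mD m : measurable_fun setT (D m).
  have [] // : tame N (D m).
  apply: tameZ; apply: tameB; last exact: tame_cos.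
  under eq_fun do rewrite addrAC.
  by apply: tame_cos; apply: tameD => //; apply: tameZ; exact: tame_gaussian.
have DN m w : `|D m w| <= 1 * N w ^+ 1.
  rewrite mul1r expr1 normrM normr_nat -ler_pdivlMl//.
  have s1 (x : R) : `|- sin x| <= 1 by rewrite normrN sin_max.
  have := mean_value_norm (@is_derive_cos R) s1 (<<t>> w + b) (<<t>> w + b + m.+1%:R^-1 * X k w).
  move=> /le_trans; apply; rewrite mul1r addrC addKr normrM normfV normr_nat.
  by rewrite ler_wpM2l.
have Dlim w : D m w @[m --> \oo] --> - (X k w * sin (<<t>> w + b)).
  have d1 := derD (der_cst (<<t>> w + b) 0) (derM (der_id 0) (der_cst (X k w) 0)).
  have d2 := der_comp d1 (is_derive_cos _).
  have := der_seq d2; rewrite mul0r addr0 mul1r mulr0 addr0 add0r mulNr (mulrC (sin _)).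
  by under eq_cvg do rewrite add0r.
have [_ lim] := Ex_cvg mD DN Dlim.
have ts : tame N (fun w => X k w * sin (<<t>> w + b)).
  by apply: tameM; [exact: tame_gaussian|exact: tame_sin].
have e : Ex (fun w => - (X k w * sin (<<t>> w + b))) =
    - (c t * Ex (fun w => cos (<<t>> w + b))).
  by have := cvg_unique _ lim cexp; exact.
apply: oppr_inj; rewrite -e -mulN1r -(ExZ _ ts).
by apply: eq_Rintegral => w _; rewrite mulN1r.
Unshelve. all: by end_near. Qed.

(** [g'] is the derivative of [g] in the direction of [X k], as tested against all
   cosines of linear forms: this makes the hypothesis of [ibp_comp] for [u = X j] an
   instance of the same property, so that the class is closed under products with
   functions of the variables. *)
Definition smooth (g g' : T -> R) := forall t b,
  ibp N (X k) (fun w => g w * cos (<<t>> w + b))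
    (fun w => g' w * cos (<<t>> w + b) - g w * (c t * sin (<<t>> w + b))).

Lemma smooth_1 : smooth (fun=> 1) (fun=> 0).
Proof.
move=> t b; split.
- by under eq_fun do rewrite mul1r; exact: tame_cos.
- under eq_fun do rewrite mul0r sub0r mul1r.
  by apply: tameN; apply: tameZ; exact: tame_sin.
have := Ex_sin t (b + pi / 2).
under eq_Rintegral do rewrite addrA sinDpihalf.
under [X in _ = _ * X -> _]eq_Rintegral do rewrite addrA cosDpihalf.
have ts : tame N (fun w => - sin (<<t>> w + b)) by apply: tameN; exact: tame_sin.
rewrite -(ExZ _ ts).
move=> e; transitivity (Ex (fun w => X k w * cos (<<t>> w + b))).
  by apply: eq_Rintegral => w _; rewrite mul1r.
by rewrite e; apply: eq_Rintegral => w _; ring.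
Qed.

Lemma smooth_ibp g g' : smooth g g' -> ibp N (X k) g g'.
Proof.
move/(_ (fun=> 0) 0).
have l0 w : <<(fun=> 0)>> w + 0 = 0 by rewrite big1 ?addr0// => i _; rewrite mul0r.
have -> : (fun w => g w * cos (<<(fun=> 0)>> w + 0)) = g.
  by apply/funext => w; rewrite l0 cos0 mulr1.
have -> // : (fun w => g' w * cos (<<(fun=> 0)>> w + 0) -
    g w * (c (fun=> 0) * sin (<<(fun=> 0)>> w + 0))) = g'.
by apply/funext => w; rewrite l0 cos0 sin0 !mulr0 subr0 mulr1.
Qed.

Lemma smooth_lin a a' g g' h h' : smooth g g' -> smooth h h' ->
  smooth (fun w => a * g w + a' * h w) (fun w => a * g' w + a' * h' w).
Proof.
move=> sg sh t b; have := ibp_lin (tame_gaussian k) a a' (sg t b) (sh t b).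
by congr ibp; apply/funext => w; ring.
Qed.

(** A product of two cosines of linear forms is a half sum of two such cosines. *)
Lemma smooth_mul (phi phi' : R -> R) j g g' : C1_growth phi phi' -> smooth g g' ->
  smooth (fun w => g w * phi (X j w))
         (fun w => g' w * phi (X j w) + g w * (C k j * phi' (X j w))).
Proof.
move=> [dphi cphi' [K [p hK]]] sg t b.
have [tg tg' _] := smooth_ibp sg.
have tg1 : tame N (fun w => g w * cos (<<t>> w + b)).
  by apply: tameM => //; exact: tame_cos.
have tg1' : tame N (fun w => g' w * cos (<<t>> w + b) - g w * (c t * sin (<<t>> w + b))).
  by case: (sg t b).
have icos s b' : ibp N (X k) (fun w => g w * cos (<<t>> w + b) * cos (s * X j w + b'))
    (fun w => (g' w * cos (<<t>> w + b) - g w * (c t * sin (<<t>> w + b))) * cos (s * X j w + b')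
      - g w * cos (<<t>> w + b) * C k j * (s * sin (s * X j w + b'))).
  have := ibp_lin (tame_gaussian k) 2^-1 2^-1 (sg (shift t s j) (b + b'))
    (sg (shift t (- s) j) (b - b')).
  congr ibp; apply/funext => w; rewrite !lf_shift ?c_shift.
    rewrite (_ : _ + _ + (b + b') = (<<t>> w + b) + (s * X j w + b')); last by ring.
    rewrite (_ : _ + _ + (b - b') = (<<t>> w + b) - (s * X j w + b')); last by ring.
    by rewrite (cosB (<<t>> w + b)) (cosD (<<t>> w + b)); field.
  rewrite (_ : _ + _ + (b + b') = (<<t>> w + b) + (s * X j w + b')); last by ring.
  rewrite (_ : _ + _ + (b - b') = (<<t>> w + b) - (s * X j w + b')); last by ring.
  by rewrite (cosB (<<t>> w + b)) (cosD (<<t>> w + b)) (sinB (<<t>> w + b))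
    (sinD (<<t>> w + b)); field.
have := ibp_comp (tame_gaussian k) tg1 tg1' (tame_gaussian j)
  (tame_cst N (C k j)) icos dphi cphi' (fun x => (hK x).1) (fun x => (hK x).2).
by congr ibp; apply/funext => w; ring.
Qed.

(** The addition formulas split off one summand, as a factor to which [smooth_mul]
   applies. *)
Lemma smooth_cos_sum (I : Type) (s : seq I) (f f' : I -> R -> R) (r : I -> 'I_n) g g' b :
  (forall i, C1_growth (f i) (f' i)) -> smooth g g' ->
  smooth (fun w => g w * cos (\sum_(i <- s) f i (X (r i) w) + b))
    (fun w => g' w * cos (\sum_(i <- s) f i (X (r i) w) + b) -
       g w * (\sum_(i <- s) C k (r i) * f' i (X (r i) w)) *
             sin (\sum_(i <- s) f i (X (r i) w) + b)).
Proof.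
move=> fg; elim: s g g' b => [|i s IH] g g' b sg.
  have := smooth_lin (cos b) 0 sg sg; congr smooth; apply/funext => w;
    rewrite !big_nil add0r; ring.
have s1 (x : R) : `|- sin x| <= 1 by rewrite normrN sin_max.
have cns : continuous (fun x : R => - sin x).
  by move=> x; apply: (@cvgN _ R^o); exact: continuous_sin.
have ccos := C1_growth_bounded_comp (@is_derive_cos R) cns (@cos_max R) s1 (fg i).
have csin := C1_growth_bounded_comp (@is_derive_sin R) (@continuous_cos R)
  (@sin_max R) (@cos_max R) (fg i).
have h1 := IH _ _ b (smooth_mul (r i) ccos sg).
have h2 := IH _ _ (b - pi / 2) (smooth_mul (r i) csin sg).
have := smooth_lin 1 (- 1) h1 h2; congr smooth; apply/funext => w; rewrite !big_cons;
  rewrite !addrA cosBpihalf ?sinBpihalf -!addrA; move: (\sum_(i <- s) f i (X (r i) w) + b) => A;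
  rewrite ?(cosD (f i _)) ?(sinD (f i _)); ring.
Qed.

(** Integration by parts for a nonlinear function of the sum [F] of the [f i (X (r i))]:
   [smooth_cos_sum] is the hypothesis of [ibp_comp] for [u = F]. *)
Lemma ibp_fun_sum (I : Type) (s : seq I) (f f' : I -> R -> R) (r : I -> 'I_n) g g'
    (phi phi' : R -> R) :
  (forall i, C1_growth (f i) (f' i)) -> smooth g g' -> C1_growth phi phi' ->
  ibp N (X k) (fun w => g w * phi (\sum_(i <- s) f i (X (r i) w)))
    (fun w => g' w * phi (\sum_(i <- s) f i (X (r i) w)) +
       g w * (\sum_(i <- s) C k (r i) * f' i (X (r i) w)) *
             phi' (\sum_(i <- s) f i (X (r i) w))).
Proof.
move=> fg sg [dphi cphi' [K [p hK]]].
have [tg tg' _] := smooth_ibp sg.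
have tf i : tame N (fun w => f i (X (r i) w)).
  have [df _ [Kf [pf hf]]] := fg i.
  exact: tame_comp (der_continuous df) (fun x => (hf x).1) (tame_gaussian _).
have tf' i : tame N (fun w => C k (r i) * f' i (X (r i) w)).
  have [_ cf' [Kf [pf hf]]] := fg i.
  by apply: tameZ; exact: tame_comp cf' (fun x => (hf x).2) (tame_gaussian _).
apply: (ibp_comp (tame_gaussian k) tg tg' (tame_sum s tf) (tame_sum s tf') _
  dphi cphi' (fun x => (hK x).1) (fun x => (hK x).2)) => a b.
have fga i := C1_growthZ a (fg i).
have := smooth_ibp (smooth_cos_sum s r b fga sg).
congr ibp; apply/funext => w; rewrite -mulr_sumr//.
rewrite (_ : \sum_(i <- s) C k (r i) * (a * f' i (X (r i) w)) =
  a * \sum_(i <- s) C k (r i) * f' i (X (r i) w)); first by ring.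
by rewrite mulr_sumr; apply: eq_bigr => i _; rewrite mulrCA.
Qed.

End gaussian_family.

Arguments smooth {R d T P} N {n} X C k g g'.

(** * Diagrams *)

Section wick.
Context {R : realType} {V : finType}.
Implicit Types (delta : V -> nat) (i j : V) (m : seq (V * V)).

Definition dec j delta : V -> nat := fun v => (delta v - (v == j))%N.

(** The recursion satisfied by the expectation of the product of the Hermite polynomials of
   degrees [delta v] of Gaussian variables of unit variances and covariances [y]: an edge
   at [i] ends at some other vertex [j]. *)
Definition wick_rec (y : V -> V -> R) (W : (V -> nat) -> R) :=
  W (fun=> 0%N) = 1 /\ forall delta i, (0 < delta i)%N ->
    (delta i)%:R * W delta =
    \sum_(j | (j != i) && (0 < delta j)%N) y i j * W (dec j (dec i delta)).

(** A diagram is a multigraph without loops, given by the list of its edges. *)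
Definition deg m v : nat := (\sum_(e <- m) ((e.1 == v) + (e.2 == v)))%N.

Definition diagram delta m :=
  all (fun e => e.1 != e.2) m /\ forall v, deg m v = delta v.

Definition weight_of (y : V -> V -> R) m := \prod_(e <- m) `|y e.1 e.2|.

Lemma diagram_cons delta i j m : j != i -> (0 < delta i)%N -> (0 < delta j)%N ->
  diagram (dec j (dec i delta)) m -> diagram delta ((i, j) :: m).
Proof.
move=> ji di dj [nl dm]; split; first by rewrite /= eq_sym ji.
move=> v; rewrite /deg big_cons/= -/(deg m v) dm /dec.
rewrite (eq_sym i v) (eq_sym j v); move: di dj.
have [->|vi] := eqVneq v i; first by rewrite eq_sym (negbTE ji); lia.
by have [->|vj] := eqVneq v j; lia.
Qed.

Lemma size_dec (A : pred V) delta i j : j != i -> A i -> (0 < delta i)%N ->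
  (\sum_(v | A v) dec j (dec i delta) v < \sum_(v | A v) delta v)%N.
Proof.
move=> ji Ai di; rewrite (bigD1 i)//= [ltnRHS](bigD1 i)//= -addSn leq_add//.
  by rewrite /dec eqxx; move: di; lia.
by apply: leq_sum => v _; rewrite /dec; lia.
Qed.

(** One step of the recursion for a quantity [D], all of whose terms are bounded by sums
   over diagrams satisfying [Q]. The list of diagrams depends on the degrees only, which
   makes the constants derived from it uniform in [y]. *)
Lemma diagram_step (Q : seq (V * V) -> Prop) (E : V -> (V -> V -> R) -> ((V -> nat) -> R) -> R)
    (D : (V -> V -> R) -> ((V -> nat) -> R) -> R) delta i :
  (0 < delta i)%N ->
  (forall j, j != i -> (0 < delta j)%N -> exists L : seq (seq (V * V)),
    (forall m, m \in L -> diagram (dec j (dec i delta)) m /\ Q ((i, j) :: m)) /\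
    forall y W, wick_rec y W -> `|E j y W| <= \sum_(m <- L) weight_of y m) ->
  (forall y W, wick_rec y W -> (delta i)%:R * D y W =
    \sum_(j | (j != i) && (0 < delta j)%N) y i j * E j y W) ->
  exists L : seq (seq (V * V)), (forall m, m \in L -> diagram delta m /\ Q m) /\
    forall y W, wick_rec y W -> `|D y W| <= \sum_(m <- L) weight_of y m.
Proof.
move=> di IH Dr.
have /choice[L_ hL] : forall j, exists L : seq (seq (V * V)),
    (j != i) && (0 < delta j)%N ->
    (forall m, m \in L -> diagram (dec j (dec i delta)) m /\ Q ((i, j) :: m)) /\
    forall y W, wick_rec y W -> `|E j y W| <= \sum_(m <- L) weight_of y m.
  move=> j; have [/andP[ji dj]|_] := boolP ((j != i) && (0 < delta j)%N).
    by have [L hL] := IH j ji dj; exists L.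
  by exists [::].
exists (flatten [seq [seq (i, j) :: m | m <- L_ j] | j <- enum V & (j != i) && (0 < delta j)%N]).
split.
  move=> m /flattenP[s /mapP[j]]; rewrite mem_filter => /andP[cj _] -> /mapP[m' m'L ->].
  have [h _] := hL j cj; have [dm Qm] := h m' m'L.
  by have [ji dj] := andP cj; split => //; exact: diagram_cons.
move=> y W wr.
have d1 : 1 <= (delta i)%:R :> R by rewrite ler1n.
apply: (@le_trans _ _ `|(delta i)%:R * D y W|).
  by rewrite normrM normr_nat ler_peMl.
rewrite Dr// big_flatten/= big_map big_filter.
apply: le_trans (ler_norm_sum _ _ _) _.
rewrite big_enum_cond/=; apply: ler_sum => j cj.
rewrite big_map normrM; have [_ h] := hL j cj.
apply: le_trans (ler_wpM2l (normr_ge0 _) (h y W wr)) _.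
rewrite mulr_sumr; apply: ler_sum => m _.
by rewrite [leRHS]/weight_of big_cons.
Qed.

Lemma wick_bound delta : exists L : seq (seq (V * V)),
  (forall m, m \in L -> diagram delta m) /\
  forall y W, wick_rec y W -> `|W delta| <= \sum_(m <- L) weight_of y m.
Proof.
have [k] := ubnP (\sum_v delta v); elim: k delta => // k IH delta dk.
have [[i di]|d0] := pselect (exists i, (0 < delta i)%N).
  have [|y W [_ wr]|L [h1 h2]] := @diagram_step (fun=> True)
    (fun j y W => W (dec j (dec i delta))) (fun y W => W delta) delta i di.
  - move=> j ji dj; have [|L [h1 h2]] := IH (dec j (dec i delta)).
      by apply: leq_trans (size_dec (A := predT) ji isT di) _; rewrite -ltnS.
    by exists L; split => // m /h1.
  - exact: wr.
  - by exists L; split => // m /h1[].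
have -> : delta = fun=> 0%N.
  by apply/funext => i; have [//|di] := posnP (delta i); case: d0; exists i.
exists [:: [::]]; split => [m|y W [-> _]].
  by rewrite inE => /eqP ->; split => // v; rewrite /deg big_nil.
by rewrite big_seq1 /weight_of big_nil normr1.
Qed.

Variable A : pred V.

Definition crossing m := has (fun e : V * V => A e.1 (+) A e.2) m.

Definition restrict_deg (B : pred V) delta : V -> nat := fun v => if B v then delta v else 0%N.

(** The diagrams without an edge between [A] and its complement are exactly those of the
   product of the two separate moments. The induction unfolds vertices of [A] only. *)
Lemma wick_cov_bound delta : exists L : seq (seq (V * V)),
  (forall m, m \in L -> diagram delta m /\ crossing m) /\
  forall y W, wick_rec y W ->
    `|W delta - W (restrict_deg A delta) * W (restrict_deg (predC A) delta)|
      <= \sum_(m <- L) weight_of y m.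
Proof.
have [k] := ubnP (\sum_(v | A v) delta v); elim: k delta => // k IH delta dk.
have [[i [Ai di]]|d0] := pselect (exists i, A i /\ (0 < delta i)%N); last first.
  exists [::]; split => // y W [W0 _]; rewrite big_nil.
  have -> : restrict_deg A delta = fun=> 0%N.
    apply/funext => i; rewrite /restrict_deg; case: ifP => // Ai.
    by have [//|di] := posnP (delta i); case: d0; exists i.
  have -> : restrict_deg (predC A) delta = delta.
    apply/funext => i; rewrite /restrict_deg/=; case: ifPn => //= /negPn Ai.
    by have [//|di] := posnP (delta i); case: d0; exists i.
  by rewrite W0 mul1r subrr normr0.
have rA : restrict_deg A delta i = delta i by rewrite /restrict_deg Ai.
have decA j : A j -> dec j (dec i (restrict_deg A delta)) = restrict_deg A (dec j (dec i delta)).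
  move=> Aj; apply/funext => v; rewrite /dec /restrict_deg.
  by case: ifPn => // /negbTE Av; lia.
have decC j : A j -> restrict_deg (predC A) (dec j (dec i delta)) = restrict_deg (predC A) delta.
  move=> Aj; apply/funext => v; rewrite /dec /restrict_deg/=.
  case: ifPn => // Av; have -> : (v == i) = false by apply: contraNF Av => /eqP ->.
  by have -> : (v == j) = false by [apply: contraNF Av => /eqP ->]; rewrite !subn0.
(* An edge inside [A] leaves a covariance; an edge leaving [A] makes all diagrams cross. *)
pose E j (y : V -> V -> R) W := if A j then W (dec j (dec i delta)) -
    W (restrict_deg A (dec j (dec i delta))) * W (restrict_deg (predC A) (dec j (dec i delta)))
  else W (dec j (dec i delta)) : R.
apply: (@diagram_step crossing E _ delta i di) => [j ji dj|y W [_ wr]].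
  rewrite /E; have [Aj|nAj] := boolP (A j).
    have [|L [h1 h2]] := IH (dec j (dec i delta)).
      by apply: leq_trans (size_dec ji Ai di) _; rewrite -ltnS.
    by exists L; split => // m /h1[dm cm]; split => //; apply/orP; right.
  have [L [h1 h2]] := wick_bound (dec j (dec i delta)).
  by exists L; split => // m /h1 dm; split => //; rewrite /crossing/= Ai (negbTE nAj).
have wA := wr (restrict_deg A delta) i; rewrite rA in wA.
rewrite mulrBr wr// mulrA wA//.
rewrite (bigID A)/= [RHS](bigID A)/= addrAC; congr (_ + _); last first.
  by apply: eq_bigr => j /andP[_ /negbTE nAj]; rewrite /E nAj.
rewrite mulr_suml [X in _ - X](eq_bigl (fun j => (j != i) && (0 < delta j)%N && A j)); last first.
  by move=> j; rewrite /restrict_deg; case: (A j); rewrite ?andbT ?andbF.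
rewrite -sumrB; apply: eq_bigr => j /andP[_ Aj].
by rewrite /E Aj decA// decC// mulrBr mulrA.
Qed.

End wick.

Section four_vertices.
Context {R : realType}.

Let o0 : 'I_4 := @Ordinal 4 0 isT.
Let o1 : 'I_4 := @Ordinal 4 1 isT.
Let o2 : 'I_4 := @Ordinal 4 2 isT.
Let o3 : 'I_4 := @Ordinal 4 3 isT.

Definition low : pred 'I_4 := fun v => (v < 2)%N.

Let ord4E (e : 'I_4) : [\/ e = o0, e = o1, e = o2 | e = o3].
Proof.
case: e => [[|[|[|[|//]]]] h]; [apply: Or41|apply: Or42|apply: Or43|apply: Or44];
  exact: val_inj.
Qed.

(** A loop-free multigraph on four vertices is determined by its six multiplicities. *)
Let counted m := exists c01 c02 c03 c12 c13 c23 : nat,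
  [/\ forall y : 'I_4 -> 'I_4 -> R, (forall i j, y i j = y j i) -> weight_of y m =
        `|y o0 o1| ^+ c01 * `|y o0 o2| ^+ c02 * `|y o0 o3| ^+ c03 *
        `|y o1 o2| ^+ c12 * `|y o1 o3| ^+ c13 * `|y o2 o3| ^+ c23,
      (deg m o0 = c01 + c02 + c03 /\ deg m o1 = c01 + c12 + c13)%N,
      (deg m o2 = c02 + c12 + c23 /\ deg m o3 = c03 + c13 + c23)%N
    & crossing low m -> (0 < c02 + c03 + c12 + c13)%N].

Let diagram4_counts m : all (fun e => e.1 != e.2) m -> counted m.
Proof.
elim: m => [_|[e e'] m IH /= /andP[nl /IH]].
  exists 0%N, 0%N, 0%N, 0%N, 0%N, 0%N.
  by split => // [y _||]; rewrite /weight_of /deg ?big_nil ?expr0 ?mulr1.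
move=> [c01 [c02 [c03 [c12 [c13 [c23 [hw [h0 h1] [h2 h3] hc]]]]]]].
have wE y : weight_of y ((e, e') :: m) = `|y e e'| * weight_of y m.
  by rewrite /weight_of big_cons.
have dE v : deg ((e, e') :: m) v = ((e == v) + (e' == v) + deg m v)%N.
  by rewrite /deg big_cons.
have cE : crossing low ((e, e') :: m) = (low e (+) low e') || crossing low m by [].
have fin c01' c02' c03' c12' c13' c23' :
   (forall y : 'I_4 -> 'I_4 -> R, (forall i j, y i j = y j i) -> `|y e e'| =
        `|y o0 o1| ^+ c01' * `|y o0 o2| ^+ c02' * `|y o0 o3| ^+ c03' *
        `|y o1 o2| ^+ c12' * `|y o1 o3| ^+ c13' * `|y o2 o3| ^+ c23') ->
   ((e == o0) + (e' == o0) = c01' + c02' + c03')%N ->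
   ((e == o1) + (e' == o1) = c01' + c12' + c13')%N ->
   ((e == o2) + (e' == o2) = c02' + c12' + c23')%N ->
   ((e == o3) + (e' == o3) = c03' + c13' + c23')%N ->
   (low e (+) low e' -> 0 < c02' + c03' + c12' + c13')%N ->
   counted ((e, e') :: m).
  move=> fy f0 f1 f2 f3 fc.
  exists (c01' + c01)%N, (c02' + c02)%N, (c03' + c03)%N, (c12' + c12)%N,
    (c13' + c13)%N, (c23' + c23)%N; split.
  - by move=> y ys; rewrite wE (fy y ys) (hw y ys) !exprD; ring.
  - by rewrite !dE h0 h1 f0 f1; split; clear; lia.
  - by rewrite !dE h2 h3 f2 f3; split; clear; lia.
  - by rewrite cE => /orP[/fc|/hc]; clear; lia.
have [ee|ee|ee|ee] := ord4E e; have [ee'|ee'|ee'|ee'] := ord4E e';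
  rewrite {}ee {}ee' //= in nl fin *.
- by apply: (fin 1 0 0 0 0 0)%N => // y _; ring.
- by apply: (fin 0 1 0 0 0 0)%N => // y _; ring.
- by apply: (fin 0 0 1 0 0 0)%N => // y _; ring.
- by apply: (fin 1 0 0 0 0 0)%N => // y ys; rewrite (ys o1); ring.
- by apply: (fin 0 0 0 1 0 0)%N => // y _; ring.
- by apply: (fin 0 0 0 0 1 0)%N => // y _; ring.
- by apply: (fin 0 1 0 0 0 0)%N => // y ys; rewrite (ys o2); ring.
- by apply: (fin 0 0 0 1 0 0)%N => // y ys; rewrite (ys o2); ring.
- by apply: (fin 0 0 0 0 0 1)%N => // y _; ring.
- by apply: (fin 0 0 1 0 0 0)%N => // y ys; rewrite (ys o3); ring.
- by apply: (fin 0 0 0 0 1 0)%N => // y ys; rewrite (ys o3); ring.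
- by apply: (fin 0 0 0 0 0 1)%N => // y ys; rewrite (ys o3); ring.
Qed.

Lemma mulXX_le (A B : R) (u v : nat) : 0 <= A -> 0 <= B ->
  A ^+ u * B ^+ v <= A ^+ (u + v) + B ^+ (u + v).
Proof.
move=> A0 B0; wlog AB : A B u v A0 B0 / A <= B.
  move=> H; have [/H|/ltW/H] := leP A B; first exact.
  by rewrite addrC mulrC addnC; apply.
apply: (@le_trans _ _ (B ^+ (u + v))); last by rewrite lerDr exprn_ge0.
by rewrite exprD ler_wpM2r ?exprn_ge0// lerXn2r.
Qed.

(** With all four degrees equal, opposite edges have equal multiplicities r, u, v, and
   r + u + v = a; the diagram crosses when u + v > 0, that is when r < a. *)
Lemma diagram4_weight (a : nat) (m : seq ('I_4 * 'I_4)) (y : 'I_4 -> 'I_4 -> R) :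
  (forall i j, y i j = y j i) -> diagram (fun=> a) m -> crossing low m ->
  weight_of y m <= \sum_(r < a) (`|y o0 o1| * `|y o2 o3|) ^+ r *
    ((`|y o0 o2| * `|y o1 o3|) ^+ (a - r) + (`|y o0 o3| * `|y o1 o2|) ^+ (a - r)).
Proof.
move=> ys [nl dm] cm.
have [c01 [c02 [c03 [c12 [c13 [c23 [hw [h0 h1] [h2 h3] hc]]]]]]] := diagram4_counts nl.
rewrite !dm in h0 h1 h2 h3; have {}hc := hc cm.
have e1 : c23 = c01 by lia.
have e2 : c13 = c02 by lia.
have e3 : c12 = c03 by lia.
have ra : (c01 < a)%N by lia.
rewrite hw// (bigD1 (Ordinal ra))//= e1 e2 e3.
rewrite (_ : (a - c01)%N = (c02 + c03)%N); last by lia.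
rewrite -[leLHS]addr0; apply: lerD; last first.
  by apply: sumr_ge0 => r _; rewrite mulr_ge0 ?addr_ge0 ?exprn_ge0 ?mulr_ge0.
apply: (@le_trans _ _ ((`|y o0 o1| * `|y o2 o3|) ^+ c01 *
  ((`|y o0 o2| * `|y o1 o3|) ^+ c02 * (`|y o0 o3| * `|y o1 o2|) ^+ c03))).
  by rewrite !exprMn le_eqVlt; apply/orP; left; apply/eqP; ring.
by rewrite ler_wpM2l ?exprn_ge0 ?mulr_ge0// mulXX_le// mulr_ge0.
Qed.

(** The only diagram on two vertices is a multiple edge. *)
Lemma wick_pair (y : 'I_4 -> 'I_4 -> R) (W : ('I_4 -> nat) -> R) (i j : 'I_4) (a : nat) :
  wick_rec y W -> i != j ->
  W (fun v => if (v == i) || (v == j) then a else 0%N) = y i j ^+ a / a`!%:R.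
Proof.
move=> [W0 wr] ij; elim: a => [|a IH].
  rewrite expr0 fact0 divr1 -W0; congr W.
  by apply/funext => v; case: ifP.
have a0 : (a.+1%:R : R) != 0 by rewrite pnatr_eq0.
apply: (mulfI a0).
have := wr (fun v => if (v == i) || (v == j) then a.+1 else 0%N) i.
rewrite eqxx/= => /(_ isT) ->.
rewrite (bigD1 j)/=; last by rewrite eqxx orbT eq_sym ij.
rewrite big1 ?addr0 => [|v]; last first.
  by move=> /andP[/andP[/negbTE vi]]; rewrite vi/=; case: (v == j).
rewrite (_ : dec _ _ = fun v => if (v == i) || (v == j) then a else 0%N); last first.
  apply/funext => v; rewrite /dec.
  have [->|vi] := eqVneq v i; first by rewrite (negbTE ij)/=; lia.
  by have [_|_] := eqVneq v j; rewrite /= ?subn0 ?subn1.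
rewrite IH factS natrM exprS.
have f0 : (a`!%:R : R) != 0 by rewrite pnatr_eq0 -lt0n fact_gt0.
by move: (a.+1%:R : R) a0 => b b0; field; rewrite b0 f0.
Qed.

Definition wick4_bound (a : nat) (K : R) :=
  forall (y : 'I_4 -> 'I_4 -> R) (W : ('I_4 -> nat) -> R),
  (forall i j, y i j = y j i) -> wick_rec y W ->
  `|W (fun=> a) - y o0 o1 ^+ a / a`!%:R * (y o2 o3 ^+ a / a`!%:R)| <=
  K * \sum_(r < a) (`|y o0 o1| * `|y o2 o3|) ^+ r *
    ((`|y o0 o2| * `|y o1 o3|) ^+ (a - r) + (`|y o0 o3| * `|y o1 o2|) ^+ (a - r)).

Lemma wick4_cov_bound (a : nat) : exists2 K : R, 0 <= K & wick4_bound a K.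
Proof.
have [L [hL hb]] := @wick_cov_bound R _ low (fun=> a).
exists (size L)%:R => // y W ys wr.
have -> : y o0 o1 ^+ a / a`!%:R = W (restrict_deg low (fun=> a)).
  rewrite -(wick_pair _ wr)//; congr W; apply/funext => v; rewrite /restrict_deg.
  by have [->|->|->|->] := ord4E v.
have -> : y o2 o3 ^+ a / a`!%:R = W (restrict_deg (predC low) (fun=> a)).
  rewrite -(wick_pair _ wr)//; congr W; apply/funext => v; rewrite /restrict_deg.
  by have [->|->|->|->] := ord4E v.
apply: le_trans (hb y W wr) _; rewrite mulr_natl.
set S := \sum_(r < a) _.
rewrite -[X in _ *+ X]sum1_size -sumrMnr big_seq [leRHS]big_seq.
by apply: ler_sum => m mL; have [dm cm] := hL m mL; exact: diagram4_weight.
Qed.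

End four_vertices.

(** * Hermite polynomials of a Gaussian family *)

Section hermite_polynomials.
Context {R : realType}.

Lemma gauss_factor_deriv (q : nat) :
  (gauss_factor q.+1)^`() = - ((q.+1)%:R *: gauss_factor q) :> {poly R}.
Proof.
elim: q => [|q IH].
  by rewrite /= derivC mulr1 sub0r derivN derivX scale1r.
have e : gauss_factor q.+1 = (gauss_factor q)^`() - 'X * gauss_factor q :> {poly R} by [].
rewrite [X in X^`()](_ : _ = (gauss_factor q.+1)^`() - 'X * gauss_factor q.+1)//.
rewrite derivB derivM derivX mul1r IH derivN derivZ e.
rewrite -[q.+2]addn1 natrD scalerDl scale1r -!mul_polyC.
by ring.
Qed.

Definition hermite_poly (q : nat) : {poly R} := ((-1) ^+ q / q`!%:R) *: gauss_factor q.

Lemma horner_hermite_poly q x : (hermite_poly q).[x] = hermite q x.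
Proof. by rewrite hermiteE /hermite_poly hornerZ. Qed.

Lemma deriv_hermite_poly q : (hermite_poly q.+1)^`() = hermite_poly q.
Proof.
rewrite /hermite_poly derivZ gauss_factor_deriv scalerN scalerA -scaleNr.
congr (_ *: _); rewrite exprS factS natrM.
have f0 : (q`!%:R : R) != 0 by rewrite pnatr_eq0 -lt0n fact_gt0.
have q0 : (q.+1%:R : R) != 0 by rewrite pnatr_eq0.
by move: (q.+1%:R : R) q0 => a a0; field; rewrite a0 f0.
Qed.

Lemma hermite_rec q x :
  q.+1%:R * hermite q.+1 x = x * hermite q x - (hermite_poly q)^`().[x].
Proof.
rewrite -!horner_hermite_poly /hermite_poly derivZ !hornerZ /=.
rewrite hornerD hornerN hornerM hornerX exprS factS natrM.
have f0 : (q`!%:R : R) != 0 by rewrite pnatr_eq0 -lt0n fact_gt0.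
have q0 : (q.+1%:R : R) != 0 by rewrite pnatr_eq0.
by move: (q.+1%:R : R) q0 => a a0; field; rewrite a0 f0.
Qed.

Lemma hermite0 x : hermite 0 x = 1 :> R.
Proof. by rewrite hermiteE /= expr0 fact0 divr1 mul1r hornerC. Qed.

Lemma C1_growth_hermite q :
  C1_growth (@hermite R q) (fun x => (hermite_poly q)^`().[x]).
Proof.
have := C1_growth_poly (hermite_poly q).
by congr C1_growth; apply/funext => x; rewrite horner_hermite_poly.
Qed.

End hermite_polynomials.

Section hermite_functionals.
Context {R : realType} {d : measure_display} {T : measurableType d}.
Context {P : probability T R} {N : weight P} {n : nat}.
Context {X : 'I_n -> T -> R} {C : 'I_n -> 'I_n -> R}.
Hypothesis GF : gaussian_family N X C.
Hypothesis C1 : forall i, C i i = 1.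
Notation Ex g := (\int[P]_w g w).

Lemma tame_hermite q i : tame N (fun w => hermite q (X i w)).
Proof.
have [df _ [K [p hK]]] := @C1_growth_hermite R q.
exact: tame_comp (der_continuous df) (fun x => (hK x).1) (tame_gaussian GF i).
Qed.

Lemma tame_hermite' q i : tame N (fun w => (hermite_poly q)^`().[X i w]).
Proof.
have [_ cf [K [p hK]]] := @C1_growth_hermite R q.
exact: tame_comp cf (fun x => (hK x).2) (tame_gaussian GF i).
Qed.

Lemma tame_prod (I : Type) (s : seq I) (Q : pred I) (g : I -> T -> R) :
  (forall i, tame N (g i)) -> tame N (fun w => \prod_(i <- s | Q i) g i w).
Proof.
move=> tg; elim: s => [|i s IH].
  by under eq_fun do rewrite big_nil; exact: tame_cst.
under eq_fun do rewrite big_cons; case: (Q i) => //.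
exact: tameM.
Qed.

Lemma smooth_prod (V : eqType) (r : V -> 'I_n) (phi phi' : V -> R -> R) (s : seq V) k :
  (forall v, C1_growth (phi v) (phi' v)) -> uniq s ->
  smooth N X C k (fun w => \prod_(v <- s) phi v (X (r v) w))
    (fun w => \sum_(j <- s) C k (r j) * phi' j (X (r j) w) *
                \prod_(v <- s | v != j) phi v (X (r v) w)).
Proof.
move=> hphi; elim: s => [_|i s IH /= /andP[ns us]].
  by have := smooth_1 GF k; congr smooth; apply/funext => w; rewrite !big_nil.
have := smooth_mul GF (r i) (hphi i) (IH us).
congr smooth; apply/funext => w; rewrite !big_cons mulrC// eqxx /=.
rewrite addrC; congr (_ + _).
  rewrite mulrCA mulrA [LHS]mulrAC [in RHS]big_seq_cond; congr (_ * _).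
  rewrite [in LHS]big_seq; apply: eq_bigl => v.
  by case: (boolP (v \in s)) => //= vs; apply/esym; apply: contraNneq ns => <-.
rewrite mulr_sumr; apply: eq_big_seq => j js; rewrite big_cons.
have -> /= : i != j by apply: contraNneq ns => ->.
by rewrite mulrCA.
Qed.

Definition hermite_moment (V : finType) (r : V -> 'I_n) (delta : V -> nat) : R :=
  Ex (fun w => \prod_v hermite (delta v) (X (r v) w)).

(** Write (b+1) H_(b+1) = x H_b - H_b' and integrate by parts along [X (r i)]: the term in
   H_b' cancels the derivative of the factor at [i], whose variance is 1. *)
Lemma hermite_wick_rec (V : finType) (r : V -> 'I_n) :
  wick_rec (fun v v' => C (r v) (r v')) (hermite_moment r).
Proof.
split.
  transitivity (Ex (fun _ : T => (1 : R))); last exact: Ex_cst.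
  by apply: eq_Rintegral => w _; rewrite big1// => v _; exact: hermite0.
move=> delta i di; set e := dec i delta.
have ei : delta i = (e i).+1 by rewrite /e /dec eqxx; move: di; lia.
have ev v : v != i -> delta v = e v by move=> /negbTE vi; rewrite /e /dec vi subn0.
pose S w := \prod_(v | v != i) hermite (delta v) (X (r v) w).
have tS : tame N S by apply: tame_prod => v; exact: tame_hermite.
pose Q j w := C (r i) (r j) * (hermite_poly (e j))^`().[X (r j) w] *
   \prod_(v | v != j) hermite (e v) (X (r v) w).
have tQ j : tame N (Q j).
  apply: tameM; first by apply: tameZ; exact: tame_hermite'.
  by apply: tame_prod => v; exact: tame_hermite.
have [tp tp' E] := smooth_ibp (smooth_prod r (r i) (fun v => @C1_growth_hermite R (e v))
  (index_enum_uniq V)).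
have SE w : \prod_(v | v != i) hermite (e v) (X (r v) w) = S w.
  by apply: eq_bigr => v vi; rewrite ev.
have Qi w : Q i w = (hermite_poly (e i))^`().[X (r i) w] * S w.
  by rewrite /Q C1 mul1r SE.
have e1 : (delta i)%:R * hermite_moment r delta =
    Ex (fun w => X (r i) w * \prod_v hermite (e v) (X (r v) w)) - Ex (Q i).
  have th : tame N (fun w => X (r i) w * \prod_v hermite (e v) (X (r v) w)).
    apply: tameM; first exact: (tame_gaussian GF).
    by apply: tame_prod => v; exact: tame_hermite.
  have tm : tame N (fun w => \prod_v hermite (delta v) (X (r v) w)).
    by apply: tame_prod => v; exact: tame_hermite.
  rewrite -(ExB th (tQ i)) /hermite_moment -(ExZ _ tm).
  apply: eq_Rintegral => w _; rewrite Qi (bigD1 i)//= -/(S w) [in RHS](bigD1 i)//= SE.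
  by rewrite mulrA ei hermite_rec; ring.
rewrite e1 E (Ex_sum _ tQ) (bigD1 i)//= addrAC subrr add0r.
rewrite big_mkcond [RHS]big_mkcond; apply: eq_bigr => j _.
have [//|ji] := eqVneq j i; rewrite /=.
rewrite /Q ev//; case ej : (e j) => [|b] /=.
  under eq_Rintegral do rewrite /hermite_poly /= derivZ derivC scaler0 horner0 mulr0 mul0r.
  by rewrite Ex_cst.
have tm : tame N (fun w => \prod_v hermite (dec j e v) (X (r v) w)).
  by apply: tame_prod => v; exact: tame_hermite.
rewrite /hermite_moment -(ExZ _ tm); apply: eq_Rintegral => w _.
rewrite deriv_hermite_poly horner_hermite_poly [in RHS](bigD1 j)//= -mulrA.
congr (_ * (_ * _)); first by rewrite /dec eqxx ej subn1.
by apply: eq_bigr => v /negbTE vj; rewrite /dec vj subn0.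
Qed.

Variables (q : nat) (kappa : R).

(** The rank of the sum is [q.+1], so that [q] is the degree met in the next
   definition. *)
Definition hermite_sum w := \sum_(i < n) kappa * hermite q.+1 (X i w).

(** The scalar product of D F and - D L^-1 F for [F = hermite_sum], in the notation of
   Malliavin calculus. *)
Definition stein_factor w := kappa ^+ 2 / q.+1%:R *
  \sum_(k < n) \sum_(j < n) C k j * (hermite q (X k w) * hermite q (X j w)).

Lemma tame_hermite_sum : tame N hermite_sum.
Proof. by apply: tame_sum => i; apply: tameZ; exact: tame_hermite. Qed.

Lemma tame_stein_factor : tame N stein_factor.
Proof.
apply: tameZ; apply: tame_sum => k; apply: tame_sum => j; apply: tameZ.
by apply: tameM; exact: tame_hermite.
Qed.

(** Integrate by parts X_k H_q(X_k) phi(F): by the Hermite recursion the derivative of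
   H_q(X_k) disappears, and that of phi(F) gives the right-hand side. *)
Lemma stein_identity (phi phi' : R -> R) : C1_growth phi phi' ->
  Ex (fun w => hermite_sum w * phi (hermite_sum w)) =
  Ex (fun w => stein_factor w * phi' (hermite_sum w)).
Proof.
move=> gphi; have [dphi cphi' [K [p hK]]] := gphi.
have tphi : tame N (fun w => phi (hermite_sum w)).
  exact: tame_comp (der_continuous dphi) (fun x => (hK x).1) tame_hermite_sum.
have tphi' : tame N (fun w => phi' (hermite_sum w)).
  exact: tame_comp cphi' (fun x => (hK x).2) tame_hermite_sum.
have q0 : (q.+1%:R : R) != 0 by rewrite pnatr_eq0.
have term k : Ex (fun w => kappa * hermite q.+1 (X k w) * phi (hermite_sum w)) =
   Ex (fun w => kappa ^+ 2 / q.+1%:R * (\sum_(j < n) C k j * (hermite q (X k w) * hermite q (X j w)))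
     * phi' (hermite_sum w)).
  have gf (i : 'I_n) : C1_growth (fun x => kappa * @hermite R q.+1 x) (fun x => kappa * hermite q x).
    have := C1_growthZ kappa (@C1_growth_hermite R q.+1); congr C1_growth.
    by apply/funext => x; rewrite deriv_hermite_poly horner_hermite_poly.
  have sg := smooth_mul GF k (@C1_growth_hermite R q) (smooth_1 GF k).
  have [t1 t2 E] := ibp_fun_sum GF (index_enum 'I_n) id gf sg gphi.
  set A := (fun w => X k w * (1 * hermite q (X k w) * phi (hermite_sum w))) in E.
  pose B w := (hermite_poly q)^`().[X k w] * phi (hermite_sum w).
  have tA : tame N (fun w => X k w * (1 * hermite q (X k w) * phi (hermite_sum w))).
    apply: tameM; first exact: (tame_gaussian GF).
    by apply: tameM tphi; apply: tameM; [exact: tame_cst|exact: tame_hermite].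
  have tB : tame N B by apply: tameM => //; exact: tame_hermite'.
  have -> : Ex (fun w => kappa * hermite q.+1 (X k w) * phi (hermite_sum w)) =
      kappa / q.+1%:R * (Ex A - Ex B).
    rewrite -(ExB tA tB) -(ExZ _ (tameB tA tB)); apply: eq_Rintegral => w _.
    rewrite /A /B mul1r mulrA -mulrBl -hermite_rec !mulrA divfK//.
  rewrite E -(ExB t2 tB) -(ExZ _ (tameB t2 tB)); apply: eq_Rintegral => w _.
  rewrite /B mul0r add0r C1 !mul1r.
  have -> : \sum_(i < n) C k i * (kappa * hermite q (X i w)) =
     kappa * \sum_(i < n) C k i * hermite q (X i w).
    by rewrite mulr_sumr; apply: eq_bigr => i _; rewrite mulrCA.
  have -> : \sum_(j < n) C k j * (hermite q (X k w) * hermite q (X j w)) =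
     hermite q (X k w) * \sum_(j < n) C k j * hermite q (X j w).
    by rewrite mulr_sumr; apply: eq_bigr => i _; rewrite mulrCA.
  rewrite /hermite_sum; field => //.
transitivity (Ex (fun w => \sum_(k < n) kappa * hermite q.+1 (X k w) * phi (hermite_sum w))).
  by apply: eq_Rintegral => w _; rewrite {1}/hermite_sum mulr_suml.
have t1 k : tame N (fun w => kappa * hermite q.+1 (X k w) * phi (hermite_sum w)).
  by apply: tameM => //; apply: tameZ; exact: tame_hermite.
have t2 k : tame N (fun w => kappa ^+ 2 / q.+1%:R *
    (\sum_(j < n) C k j * (hermite q (X k w) * hermite q (X j w))) * phi' (hermite_sum w)).
  apply: tameM => //; apply: tameZ; apply: tame_sum => j; apply: tameZ.
  by apply: tameM; exact: tame_hermite.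
rewrite (Ex_sum _ t1); under eq_bigr do rewrite term.
rewrite -(Ex_sum _ t2).
by apply: eq_Rintegral => w _; rewrite -mulr_suml -mulr_sumr.
Qed.

End hermite_functionals.

(** * Stein's bound and the variance of the Stein factor *)

Arguments hermite {R} q x : simpl never.

Section stein_bound.
Context {R : realType} {d : measure_display} {T : measurableType d}.
Context {P : probability T R} {N : weight P} {n : nat}.
Context {X : 'I_n -> T -> R} {C : 'I_n -> 'I_n -> R}.
Hypothesis GF : gaussian_family N X C.
Hypothesis C1 : forall i, C i i = 1.
Variables (q : nat) (kappa : R).
Notation Ex g := (\int[P]_w g w).
Notation F := (@hermite_sum R d T n X q kappa).
Notation G := (@stein_factor R d T n X C q kappa).

(** For the solution f of Stein's equation, E h(F) - E h(Z) = E (f'(F) - F f(F)) =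
   E ((1 - G) f'(F)). *)
Lemma stein_bound (h : R -> R) (M : R) : continuous h -> (forall x, `|h x| <= M) ->
  `|Ex (fun w => h (F w)) - normal_mean h| <= 4 * M * Ex (fun w => `|1 - G w|).
Proof.
move=> ch hM; have [f [f' [df cf' fe f'M fM]]] := stein_solution ch hM.
have M0 : 0 <= M by apply: le_trans (hM 0).
have tF := tame_hermite_sum GF q kappa; have tG := tame_stein_factor GF q kappa.
have gf : C1_growth f f'.
  split => //; exists (`|f 0| + 4 * M), 1%N => x; rewrite expr1.
  have f00 := normr_ge0 (f 0); have x0 := normr_ge0 x.
  split; [have := fM x|have := f'M x]; nra.
have [_ _ [K [p hK]]] := gf.
have tf : tame N (fun w => f (F w)).
  exact: tame_comp (der_continuous df) (fun x => (hK x).1) tF.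
have tf' : tame N (fun w => f' (F w)).
  exact: tame_comp cf' (fun x => (hK x).2) tF.
have th : tame N (fun w => h (F w)).
  by apply: (@tame_comp _ _ _ _ _ _ M 0 _ ch) tF => x; rewrite expr0 mulr1.
have tGf' : tame N (fun w => G w * f' (F w)) by exact: tameM.
have tFf : tame N (fun w => F w * f (F w)) by exact: tameM.
have -> : Ex (fun w => h (F w)) - normal_mean h = Ex (fun w => (1 - G w) * f' (F w)).
  transitivity (Ex (fun w => h (F w) - normal_mean h)).
    by rewrite (ExB th (tame_cst N _)) Ex_cst.
  transitivity (Ex (fun w => f' (F w) - F w * f (F w))).
    by apply: eq_Rintegral => w _; rewrite fe.
  rewrite (ExB tf' tFf) (stein_identity GF C1 q kappa gf) -(ExB tf' tGf').
  by apply: eq_Rintegral => w _; rewrite mulrBl mul1r.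
have t1 : tame N (fun w => 1 - G w) by apply: tameB => //; exact: tame_cst.
have tp : tame N (fun w => (1 - G w) * f' (F w)) by exact: tameM.
apply: le_trans (Ex_norm tp) _; rewrite -(ExZ _ (tame_norm t1)).
apply: (Ex_le (tame_norm tp) (tameZ _ (tame_norm t1))).
by move=> w; rewrite normrM mulrC ler_wpM2r.
Qed.

(** From |g| <= g^2/(2b) + b/2. *)
Lemma Ex_norm_le_sqr (g : T -> R) (b : R) : tame N g -> 0 < b ->
  Ex (fun w => g w ^+ 2) <= b ^+ 2 -> Ex (fun w => `|g w|) <= b.
Proof.
move=> tg b0 gb; have tg2 : tame N (fun w => g w ^+ 2) by exact: tameX.
apply: (@le_trans _ _ (Ex (fun w => (2 * b)^-1 * g w ^+ 2 + b / 2))).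
  apply: (Ex_le (tame_norm tg) (tameD (tameZ _ tg2) (tame_cst N _))).
  move=> w; rewrite -subr_ge0 -(real_normK (num_real (g w))).
  have -> : (2 * b)^-1 * `|g w| ^+ 2 + b / 2 - `|g w| = (2 * b)^-1 * (`|g w| - b) ^+ 2.
    by field; rewrite gt_eqF.
  by rewrite mulr_ge0 ?sqr_ge0// invr_ge0 mulr_ge0// ltW.
rewrite (ExD (tameZ _ tg2) (tame_cst N _)) (ExZ _ tg2) Ex_cst.
have : (2 * b)^-1 * Ex (fun w => g w ^+ 2) <= (2 * b)^-1 * b ^+ 2.
  by rewrite ler_wpM2l// invr_ge0 mulr_ge0// ltW.
have -> : (2 * b)^-1 * b ^+ 2 = b / 2 by field; rewrite gt_eqF.
lra.
Qed.

Let mom (k j i l : 'I_n) (delta : 'I_4 -> nat) : R :=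
  hermite_moment (P := P) (X := X) (fun v : 'I_4 => nth k [:: k; j; i; l] v) delta.

Let momE k j i l delta : mom k j i l delta =
  Ex (fun w => hermite (delta (@Ordinal 4 0 isT)) (X k w) *
    hermite (delta (@Ordinal 4 1 isT)) (X j w) *
    hermite (delta (@Ordinal 4 2 isT)) (X i w) * hermite (delta (@Ordinal 4 3 isT)) (X l w)).
Proof.
apply: eq_Rintegral => w _; rewrite !big_ord_recl big_ord0 /= mulr1 !mulrA.
have e0 : (ord0 : 'I_4) = @Ordinal 4 0 isT by exact: val_inj.
have e1 : lift ord0 ord0 = @Ordinal 4 1 isT by exact: val_inj.
have e2 : lift ord0 (lift ord0 ord0) = @Ordinal 4 2 isT by exact: val_inj.
have e3 : lift ord0 (lift ord0 (lift ord0 ord0)) = @Ordinal 4 3 isT by exact: val_inj.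
by rewrite e1 e2 e3 e0.
Qed.

Let mom_rec k j i l := hermite_wick_rec GF C1 (fun v : 'I_4 => nth k [:: k; j; i; l] v).

Lemma hermite_cov k j :
  Ex (fun w => hermite q (X k w) * hermite q (X j w)) = C k j ^+ q / q`!%:R.
Proof.
have := @wick_pair R _ _ (@Ordinal 4 0 isT) (@Ordinal 4 1 isT) q (mom_rec k j k k) isT.
rewrite -/(mom k j k k _) momE /= => <-; apply: eq_Rintegral => w _.
by rewrite !hermite0 !mulr1.
Qed.

Lemma Ex_stein_factor : Ex G =
  kappa ^+ 2 / q.+1`!%:R * \sum_(k < n) \sum_(j < n) C k j ^+ q.+1.
Proof.
have th k j : tame N (fun w => hermite q (X k w) * hermite q (X j w)).
  by apply: tameM; exact: (tame_hermite GF).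
have t1 k : tame N (fun w => \sum_(j < n) C k j * (hermite q (X k w) * hermite q (X j w))).
  by apply: tame_sum => j; apply: tameZ.
rewrite /stein_factor (ExZ _ (tame_sum _ t1)) (Ex_sum _ t1).
have f0 : (q`!%:R : R) != 0 by rewrite pnatr_eq0 -lt0n fact_gt0.
have q0 : (q.+1%:R : R) != 0 by rewrite pnatr_eq0.
have -> : \sum_(k < n) Ex (fun w => \sum_(j < n) C k j * (hermite q (X k w) * hermite q (X j w))) =
    (q`!%:R)^-1 * \sum_(k < n) \sum_(j < n) C k j ^+ q.+1.
  rewrite mulr_sumr; apply: eq_bigr => k _.
  rewrite (Ex_sum _ (fun j => tameZ (C k j) (th k j))) mulr_sumr; apply: eq_bigr => j _.
  by rewrite (ExZ _ (th k j)) hermite_cov exprS; field.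
by rewrite factS natrM mulrA; congr (_ * _); move: (q.+1%:R : R) q0 => a a0; field; rewrite a0 f0.
Qed.

Let quad r k j i l :=
  `|C k j| ^+ r.+1 * `|C i l| ^+ r.+1 * (`|C k i| ^+ (q - r) * `|C j l| ^+ (q - r)).

(** Up to a constant factor, and with absolute values on the covariances, the squared norm
   of the contraction of order [r.+1] of the kernel of F with itself. *)
Definition contraction (r : nat) := \sum_(k < n) \sum_(j < n) \sum_(i < n) \sum_(l < n)
  quad r k j i l.

(** G - E G is a double sum of centered products, whose square is a quadruple sum of
   covariances of two such products. *)
Lemma stein_factor_var (K : R) : 0 <= K -> wick4_bound q K ->
  Ex (fun w => (G w - Ex G) ^+ 2) <= kappa ^+ 4 * (2 * K) * \sum_(r < q) contraction r.
Proof.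
move=> K0 HK.
pose m k j := C k j ^+ q / q`!%:R.
pose D k j w := C k j * (hermite q (X k w) * hermite q (X j w) - m k j).
have th k j : tame N (fun w => hermite q (X k w) * hermite q (X j w)).
  by apply: tameM; exact: (tame_hermite GF).
have tD k j : tame N (D k j) by apply: tameZ; apply: tameB => //; exact: tame_cst.
have q0 : (q.+1%:R : R) != 0 by rewrite pnatr_eq0.
have f0 : (q`!%:R : R) != 0 by rewrite pnatr_eq0 -lt0n fact_gt0.
have GE w : G w - Ex G = kappa ^+ 2 / q.+1%:R * \sum_(k < n) \sum_(j < n) D k j w.
  rewrite Ex_stein_factor factS natrM /stein_factor.
  have -> : kappa ^+ 2 / (q.+1%:R * q`!%:R) = kappa ^+ 2 / q.+1%:R * (q`!%:R)^-1.
    by rewrite invfM mulrA.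
  rewrite -(mulrA (kappa ^+ 2 / q.+1%:R) (q`!%:R)^-1) -mulrBr; congr (_ * _); rewrite mulr_sumr -sumrB; apply: eq_bigr => k _.
  rewrite mulr_sumr -sumrB; apply: eq_bigr => j _.
  by rewrite /D /m exprS; field.
have sq w : (\sum_(k < n) \sum_(j < n) D k j w) ^+ 2 =
    \sum_(k < n) \sum_(j < n) \sum_(i < n) \sum_(l < n) D k j w * D i l w.
  rewrite expr2 mulr_suml; apply: eq_bigr => k _; rewrite mulr_suml; apply: eq_bigr => j _.
  rewrite mulr_sumr; apply: eq_bigr => i _; by rewrite mulr_sumr.
have t4 k j i l : tame N (fun w => D k j w * D i l w) by exact: tameM.
have t3 k j i : tame N (fun w => \sum_(l < n) D k j w * D i l w) by apply: tame_sum.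
have t2 k j : tame N (fun w => \sum_(i < n) \sum_(l < n) D k j w * D i l w) by apply: tame_sum.
have t1 k : tame N (fun w => \sum_(j < n) \sum_(i < n) \sum_(l < n) D k j w * D i l w).
  by apply: tame_sum.
have cov k j i l : `|Ex (fun w => D k j w * D i l w)| <= K * \sum_(r < q)
   (quad r k j i l + quad r k j l i).
  have tp : tame N (fun w => hermite q (X k w) * hermite q (X j w) * hermite q (X i w) * hermite q (X l w)).
    by rewrite -[X in tame _ X]/(fun w => _ * _ * _); apply: tameM (tame_hermite GF _ _);
      apply: tameM (tame_hermite GF _ _).
  have -> : Ex (fun w => D k j w * D i l w) =
      C k j * C i l * (mom k j i l (fun=> q) - m k j * m i l).
    transitivity (Ex (fun w => C k j * C i l * ((hermite q (X k w) * hermite q (X j w) *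
        hermite q (X i w) * hermite q (X l w) - m i l * (hermite q (X k w) * hermite q (X j w)))
        - (m k j * (hermite q (X i w) * hermite q (X l w)) - m k j * m i l)))).
      by apply: eq_Rintegral => w _; rewrite /D; ring.
    have ta : tame N (fun w => m i l * (hermite q (X k w) * hermite q (X j w))) by apply: tameZ.
    have tb : tame N (fun w => m k j * (hermite q (X i w) * hermite q (X l w))) by apply: tameZ.
    have tc := tame_cst N (m k j * m i l).
    rewrite (ExZ _ (tameB (tameB tp ta) (tameB tb tc))) (ExB (tameB tp ta) (tameB tb tc)).
    rewrite (ExB tp ta) (ExB tb tc) Ex_cst (ExZ _ (th k j)) (ExZ _ (th i l)) !hermite_cov.
    by rewrite momE -/(m k j) -/(m i l); congr (_ * _); ring.
  have /= := HK _ _ (fun v v' => family_sym GF _ _) (mom_rec k j i l).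
  rewrite normrM => H; apply: le_trans (ler_wpM2l (normr_ge0 _) H) _.
  rewrite mulrCA ler_wpM2l// mulr_sumr; apply: ler_sum => r _.
  by rewrite normrM /quad (family_sym GF l i) !exprMn !exprS le_eqVlt; apply/orP; left; apply/eqP; ring.
have -> : Ex (fun w => (G w - Ex G) ^+ 2) = (kappa ^+ 2 / q.+1%:R) ^+ 2 *
    \sum_(k < n) \sum_(j < n) \sum_(i < n) \sum_(l < n) Ex (fun w => D k j w * D i l w).
  transitivity (Ex (fun w => (kappa ^+ 2 / q.+1%:R) ^+ 2 *
      \sum_(k < n) \sum_(j < n) \sum_(i < n) \sum_(l < n) D k j w * D i l w)).
    by apply: eq_Rintegral => w _; rewrite GE exprMn sq.
  rewrite (ExZ _ (tame_sum _ t1)) (Ex_sum _ t1); congr (_ * _); apply: eq_bigr => k _.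
  rewrite (Ex_sum _ (t2 k)); apply: eq_bigr => j _.
  rewrite (Ex_sum _ (t3 k j)); apply: eq_bigr => i _.
  by rewrite (Ex_sum _ (t4 k j i)).
have ck : (kappa ^+ 2 / q.+1%:R) ^+ 2 <= kappa ^+ 4.
  rewrite exprMn -exprM ler_piMr ?exprn_even_ge0// exprVn invf_le1 ?exprn_gt0//.
  by rewrite exprn_ege1// ler1n.
set S := \sum_(k < n) _; rewrite -mulrA.
have S1 : S <= 2 * K * \sum_(r < q) contraction r.
  apply: (@le_trans _ _ (\sum_(k < n) \sum_(j < n) \sum_(i < n) \sum_(l < n)
    K * \sum_(r < q)
   (quad r k j i l + quad r k j l i))).
    do 4 (apply: ler_sum => ? _); exact: le_trans (ler_norm _) (cov _ _ _ _).
  have pull (g : 'I_n -> 'I_q -> R) : \sum_l K * \sum_r g l r = K * \sum_r \sum_l g l r.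
    by rewrite -mulr_sumr exchange_big.
  under eq_bigr => k _ do under eq_bigr => j _ do under eq_bigr => i _ do rewrite pull.
  under eq_bigr => k _ do under eq_bigr => j _ do rewrite pull.
  under eq_bigr => k _ do rewrite pull.
  rewrite pull -mulrA mulrCA ler_wpM2l// mulr_sumr; apply: ler_sum => r _.
  rewrite /contraction mulr_sumr; apply: ler_sum => k _.
  rewrite mulr_sumr; apply: ler_sum => j _.
  under eq_bigr do rewrite big_split/=.
  by rewrite big_split/= [X in _ + X]exchange_big/= mulrDl mul1r.
apply: (@le_trans _ _ ((kappa ^+ 2 / q.+1%:R) ^+ 2 * (2 * K * \sum_(r < q) contraction r))).
  by rewrite ler_wpM2l// sqr_ge0.
rewrite ler_wpM2r// mulr_ge0 ?mulr_ge0//; apply: sumr_ge0 => r _.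
by do 4 (apply: sumr_ge0 => ? _); rewrite !mulr_ge0 ?exprn_ge0.
Qed.

End stein_bound.

(** * Sums over pairs and quadruples *)

Section kernel_sums.
Context {R : realType}.
Implicit Types (g h : nat -> R) (n : nat).

Definition dist (i j : nat) : nat := ((i - j) + (j - i))%N.

Lemma distC i j : dist i j = dist j i.
Proof. by rewrite /dist addnC. Qed.

Lemma row_sum_le h n (k : 'I_n) : (forall t, 0 <= h t) ->
  \sum_(j < n) h (dist k j) <= 2 * \sum_(t < n) h t.
Proof.
move=> h0; have kn := ltn_ord k.
rewrite -(big_mkord xpredT (fun j => h (dist k j))) -(big_mkord xpredT h).
rewrite (@big_cat_nat _ _ _ k)//=; last exact: ltnW.
rewrite mulr_natl mulr2n; apply: lerD.
  rewrite big_nat_rev/= add0n [leRHS](@big_cat_nat _ _ _ k.+1)//=.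
  rewrite big_nat_recl//= -addrA [leRHS]addrCA.
  rewrite (eq_big_nat _ _ (F2 := fun t => h t.+1)) => [|t /andP[_ tk]].
    by rewrite lerDl addr_ge0// sumr_ge0.
  by rewrite /dist; congr h; lia.
rewrite -{1}(add0n (k : nat)) big_addn [leRHS](@big_cat_nat _ _ _ (n - k)%N)//=; last by lia.
rewrite (eq_big_nat _ _ (F2 := h)) => [|t /andP[_ tk]].
  by rewrite lerDl sumr_ge0.
by rewrite /dist; congr h; lia.
Qed.

Definition quad_sum g h n := \sum_(k < n) \sum_(j < n) \sum_(i < n) \sum_(l < n)
  g (dist k j) * g (dist i l) * (h (dist k i) * h (dist j l)).

Lemma quad_sumC g h n : quad_sum g h n = quad_sum h g n.
Proof.
apply: eq_bigr => k _; rewrite exchange_big; apply: eq_bigr => i _.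
by apply: eq_bigr => j _; apply: eq_bigr => l _; rewrite mulrC.
Qed.

(** g(k-j) g(i-l) <= (g(k-j)^2 + g(i-l)^2)/2 leaves two free sums of h. *)
Lemma quad_sum_le g h n : (forall t, 0 <= g t) -> (forall t, 0 <= h t) ->
  quad_sum g h n <=
  n%:R * (2 * \sum_(t < n) h t) ^+ 2 * (2 * \sum_(t < n) g t ^+ 2).
Proof.
move=> g0 h0; set Hs := 2 * \sum_(t < n) h t; set Gs := 2 * _.
have Hs0 : 0 <= Hs by rewrite mulr_ge0// sumr_ge0.
have Gs0 : 0 <= Gs by rewrite mulr_ge0// sumr_ge0// => t _; rewrite sqr_ge0.
have rowG (k : 'I_n) : \sum_(j < n) g (dist k j) ^+ 2 <= Gs.
  by apply: (@row_sum_le (fun t => g t ^+ 2)) => t; rewrite sqr_ge0.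
have rowH (k : 'I_n) : \sum_(j < n) h (dist k j) <= Hs by exact: row_sum_le.
pose Q1 := \sum_(k < n) \sum_(j < n) \sum_(i < n) \sum_(l < n)
  g (dist k j) ^+ 2 * (h (dist k i) * h (dist j l)).
pose Q2 := \sum_(k < n) \sum_(j < n) \sum_(i < n) \sum_(l < n)
  g (dist i l) ^+ 2 * (h (dist k i) * h (dist j l)).
have hQ1 : Q1 <= n%:R * Hs ^+ 2 * Gs.
  rewrite -mulrA mulr_natl -[X in _ *+ X]card_ord -sumr_const.
  apply: ler_sum => k _.
  apply: (@le_trans _ _ (\sum_(j < n) g (dist k j) ^+ 2 * Hs ^+ 2)); last first.
    by rewrite -mulr_suml mulrC ler_wpM2l// sqr_ge0.
  apply: ler_sum => j _.
  under eq_bigr do rewrite -mulr_sumr -mulr_sumr.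
  rewrite -mulr_sumr ler_wpM2l ?sqr_ge0// -mulr_suml expr2.
  by apply: ler_pM; rewrite ?sumr_ge0.
have hQ2 : Q2 = Q1.
  rewrite /Q2; under eq_bigr do rewrite exchange_big/=.
  rewrite exchange_big/=; apply: eq_bigr => i _.
  under eq_bigr do rewrite exchange_big/=.
  rewrite exchange_big/=; apply: eq_bigr => l _.
  by apply: eq_bigr => k _; apply: eq_bigr => j _; rewrite (distC k) (distC j).
apply: (@le_trans _ _ (2^-1 * (Q1 + Q2))); last by rewrite hQ2; lra.
rewrite /Q1 /Q2 -big_split/= mulr_sumr; apply: ler_sum => k _.
rewrite -big_split/= mulr_sumr; apply: ler_sum => j _.
rewrite -big_split/= mulr_sumr; apply: ler_sum => i _.
rewrite -big_split/= mulr_sumr; apply: ler_sum => l _.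
rewrite -mulrDl [leRHS]mulrA ler_wpM2r ?mulr_ge0//.
by have := sqr_ge0 (g (dist k j) - g (dist i l)); rewrite sqrrB; lra.
Qed.

(** Sums over the diagonals of the square. *)
Lemma double_sum_dist (f : nat -> R) n :
  \sum_(k < n) \sum_(j < n) f (dist k j) =
  n%:R * f 0%N + 2 * \sum_(1 <= t < n) (n%:R - t%:R) * f t.
Proof.
elim: n => [|n IH]; first by rewrite big_ord0 big_geq// mul0r mulr0 addr0.
rewrite big_ord_recr/=; under eq_bigr do rewrite big_ord_recr/=.
rewrite big_split/= IH big_ord_recr/=.
have rowE : \sum_(i < n) f (dist i n) = \sum_(1 <= t < n.+1) f t.
  rewrite -(big_mkord xpredT (fun i => f (dist i n))) big_nat_rev/= add0n big_add1/=.
  by apply: eq_big_nat => t /andP[_ tn]; rewrite /dist; congr f; lia.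
have -> : \sum_(i < n) f (dist n i) = \sum_(1 <= t < n.+1) f t.
  by rewrite -rowE; apply: eq_bigr => i _; rewrite distC.
rewrite rowE (_ : dist n n = 0%N); last by rewrite /dist subnn.
have -> : \sum_(1 <= t < n.+1) (n.+1%:R - t%:R) * f t =
    \sum_(1 <= t < n) (n%:R - t%:R) * f t + \sum_(1 <= t < n.+1) f t.
  transitivity (\sum_(1 <= t < n.+1) (n%:R - t%:R) * f t + \sum_(1 <= t < n.+1) f t).
    rewrite -big_split/=; apply: eq_bigr => t _.
    by rewrite -natr1; ring.
  congr (_ + _); case: n {IH rowE} => [|n]; first by rewrite !big_geq.
  by rewrite big_nat_recr//= subrr mul0r addr0.
by rewrite -natr1; ring.
Qed.

End kernel_sums.

(** * Power counting *)

Section power_sums.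
Context {R : realType}.
Implicit Types (a b e p : R) (n M : nat).

Lemma powR_mean_value (p x y : R) : 0 < x -> x <= y ->
  exists2 c, x <= c <= y & y `^ p - x `^ p = p * c `^ (p - 1) * (y - x).
Proof.
move=> x0 xy.
have dp (z : R) : z \in `]x, y[%R -> is_derive z (1 : R) (fun z : R => z `^ p) (p * z `^ (p - 1)).
  by rewrite in_itv/= => /andP[xz _]; by apply: is_derive1_powR; exact: lt_trans xz.
have cp : {within `[x, y]%classic, continuous (fun z : R => z `^ p)}.
  apply: derivable_within_continuous => z; rewrite in_itv/= => /andP[xz _].
  by have [] := @is_derive1_powR R p z (lt_le_trans x0 xz).
have [c + e] := MVT_segment xy dp cp.
by rewrite in_itv/= => cxy; exists c.
Qed.

Lemma powR_antitone p (x y : R) : p <= 0 -> 0 < x -> x <= y -> y `^ p <= x `^ p.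
Proof.
move=> p0 x0 xy; have y0 : 0 < y by exact: lt_le_trans xy.
rewrite -(opprK p); have : 0 <= - p by rewrite oppr_ge0.
move: (- p) => r r0; rewrite !powRN lef_pV2 ?posrE ?powR_gt0//.
by apply: ge0_ler_powR; rewrite ?nnegrE ?(ltW x0) ?(ltW y0).
Qed.

(** Here and in [sum_powR_tail], by the mean value theorem, each term after the first is at
   most the corresponding increment of a primitive. *)
Lemma sum_powR_le e n : 0 < e <= 1 ->
  \sum_(1 <= t < n) t%:R `^ (e - 1) <= e^-1 * n%:R `^ e.
Proof.
move=> /andP[e0 e1].
have key m : \sum_(1 <= t < m.+1) t%:R `^ (e - 1) <= e^-1 * m%:R `^ e.
  elim: m => [|m IH].
    by rewrite big_geq// mulr_ge0 ?powR_ge0// invr_ge0 ltW.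
  rewrite big_nat_recr//=.
  suff : m.+1%:R `^ (e - 1) <= e^-1 * (m.+1%:R `^ e - m%:R `^ e) by rewrite mulrBr; lra.
  case: m {IH} => [|m].
    by rewrite !powR1 powR0 ?gt_eqF// subr0 mulr1 invf_ge1.
  have m0 : 0 < (m.+1%:R : R) by rewrite ltr0n.
  have mm : (m.+1%:R : R) <= m.+2%:R by rewrite ler_nat.
  have [c /andP[c1 c2] ->] := powR_mean_value e m0 mm.
  rewrite -natrB// subSnn mulr1 mulKf ?gt_eqF//.
  by apply: powR_antitone => //; [rewrite subr_le0|exact: lt_le_trans c1].
case: n => [|n]; first by rewrite big_geq// mulr_ge0 ?powR_ge0// invr_ge0 ltW.
apply: le_trans (key n) _; rewrite ler_wpM2l ?invr_ge0 ?(ltW e0)//.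
by apply: ge0_ler_powR; rewrite ?nnegrE ?(ltW e0)// ler_nat.
Qed.

Lemma sum_powR_tail b n M : 1 < b -> (0 < n)%N ->
  \sum_(n <= t < M) t%:R `^ (- b) <= (1 + (b - 1)^-1) * n%:R `^ (1 - b).
Proof.
move=> b1 n0; have b10 : 0 < b - 1 by rewrite subr_gt0.
have nR : 0 < (n%:R : R) by rewrite ltr0n.
have [Mn|nM] := leqP M n.
  by rewrite big_geq// mulr_ge0 ?powR_ge0// addr_ge0// invr_ge0 ltW.
have key : \sum_(n.+1 <= t < M) t%:R `^ (- b) <=
    (b - 1)^-1 * (n%:R `^ (1 - b) - M.-1%:R `^ (1 - b)).
  case: M nM => // M; rewrite ltnS /=; elim: M => [|M IH] nM.
    by rewrite big_geq// (_ : n = 0%N) ?subrr ?mulr0//; case: n nM n0 {nR} => //.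
  move: nM; rewrite leq_eqVlt => /predU1P[<-|]; first by rewrite big_geq// subrr mulr0.
  rewrite ltnS => nM; rewrite big_nat_recr//=.
  suff : M.+1%:R `^ (- b) <= (b - 1)^-1 * (M%:R `^ (1 - b) - M.+1%:R `^ (1 - b)).
    by have := IH nM; rewrite !mulrBr; lra.
  have M0 : 0 < (M%:R : R) by rewrite ltr0n (leq_trans n0).
  have MM : (M%:R : R) <= M.+1%:R by rewrite ler_nat.
  have [c /andP[c1 c2] e] := powR_mean_value (1 - b) M0 MM.
  rewrite -[X in _ <= _ * X]opprB e -natrB// subSnn mulr1 -mulNr opprB mulKf ?gt_eqF//.
  rewrite (_ : 1 - b - 1 = - b); last by ring.
  by apply: powR_antitone => //; [rewrite oppr_le0; lra|exact: lt_le_trans c1].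
rewrite big_ltn// mulrDl mul1r; apply: lerD.
  by apply: ler_powR; [rewrite ler1n|lra].
apply: le_trans key _; rewrite ler_wpM2l ?invr_ge0 ?(ltW b10)//.
by rewrite lerBlDr lerDl powR_ge0.
Qed.

(** The partial sums of t^-b grow at most like n^e; for b = 1 the logarithm is absorbed in
   an arbitrary e > 0. *)
Definition sum_exponent b e := (0 < e <= 1 /\ 1 - b <= e) \/ (e = 0 /\ 1 < b).

Lemma sum_exponent_ge0 b e : sum_exponent b e -> 0 <= e.
Proof. by case=> [[/andP[/ltW]]|[-> _]]. Qed.

Lemma sum_powR_exponent b e : sum_exponent b e -> exists2 K : R, 0 <= K &
  forall n, (0 < n)%N -> \sum_(1 <= t < n) t%:R `^ (- b) <= K * n%:R `^ e.
Proof.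
case=> [[e01 be]|[-> b1]].
  have [e0 e1] := andP e01.
  exists e^-1; first by rewrite invr_ge0 ltW.
  move=> n n0; apply: le_trans (sum_powR_le n e01).
  rewrite !big_seq; apply: ler_sum => t; rewrite mem_index_iota => /andP[t1 _].
  by apply: ler_powR; [rewrite ler1n|lra].
exists (1 + (b - 1)^-1); first by rewrite addr_ge0// invr_ge0 subr_ge0 ltW.
move=> n n0; have := sum_powR_tail n b1 (isT : (0 < 1)%N).
by rewrite powR1 powRr0.
Qed.

Variables (A a : R).
Hypothesis A0 : 0 <= A.

Definition decay (x : nat -> R) := x 0%N <= A /\
  forall t, 0 <= x t /\ ((0 < t)%N -> x t <= A * t%:R `^ (- a)).

Lemma decay_pow x m t : decay x -> (0 < t)%N ->
  x t ^+ m <= A ^+ m * t%:R `^ (- (a * m%:R)).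
Proof.
move=> [_ hx] t0; have [x0 /(_ t0) xt] := hx t.
have -> : t%:R `^ (- (a * m%:R)) = (t%:R `^ (- a)) ^+ m.
  by rewrite -powR_mulrn ?powR_ge0// -powRrM mulNr.
by rewrite -exprMn lerXn2r// nnegrE mulr_ge0 ?powR_ge0.
Qed.

Lemma power_sum_bound m e : sum_exponent (a * m%:R) e ->
  exists2 K : R, 0 <= K & forall x, decay x -> forall n, (0 < n)%N ->
    \sum_(t < n) x t ^+ m <= K * n%:R `^ e.
Proof.
move=> se; have [K K0 hK] := sum_powR_exponent se.
exists (A ^+ m * (1 + K)); first by rewrite mulr_ge0 ?exprn_ge0 ?addr_ge0.
move=> x dx n n0; have [xA hx] := dx.
rewrite -(big_mkord xpredT (fun t => x t ^+ m)) big_ltn//.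
rewrite mulrDr mulr1 mulrDl; apply: lerD.
  apply: (@le_trans _ _ (A ^+ m)).
    by rewrite lerXn2r ?nnegrE//; case: (hx 0%N).
  rewrite ler_peMr ?exprn_ge0// -[leLHS](powRr0 n%:R).
  by apply: ler_powR; [rewrite ler1n|exact: sum_exponent_ge0 se].
rewrite -mulrA; apply: le_trans (ler_wpM2l (exprn_ge0 _ A0) (hK n n0)).
rewrite mulr_sumr !big_seq; apply: ler_sum => t; rewrite mem_index_iota => /andP[t1 _].
exact: decay_pow.
Qed.

End power_sums.

Section regime.
Context {R : realType}.

(** The conditions under which n^-delta is a rate for a covariance decaying like t^-a and
   the Hermite rank Q: the second one serves the mean of the Stein factor, and the last
   one its variance, e1 and e2 being growth exponents of the sums of the s-th and 2r-th
   powers of the covariance. *)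
Definition regime (a : R) (Q : nat) (delta : R) :=
  [/\ 0 < delta < 1, delta <= a * Q%:R - 1, 0 <= a &
  forall r s : nat, (0 < r <= s)%N -> (r + s)%N = Q ->
    exists e1 e2 : R, [/\ sum_exponent (a * s%:R) e1, sum_exponent (a * (2 * r)%:R) e2
                        & 2 * e1 + e2 <= 1 - 2 * delta] ].

Lemma regime_short (a : R) (Q : nat) : (2 <= Q)%N -> 1 < a -> regime a Q (1 / 2).
Proof.
move=> Q2 a1; have Q2R : 2 <= Q%:R :> R by rewrite (ler_nat R 2).
split; [by lra|nra|by lra|move=> r s /andP[r0 rs] rsQ].
have r1 : 1 <= r%:R :> R by rewrite ler1n.
have rsR : r%:R <= s%:R :> R by rewrite ler_nat.
exists 0, 0; split; [right|right|by lra]; split => //; first by nra.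
by rewrite natrM; nra.
Qed.

(** When r = s, one has 2ar = aQ > 1, and e1 = 1/2 - delta is allowed by the last
   hypothesis. Otherwise 2(1 - as)^+ + (1 - 2ar)^+ is strictly below 1 - 2 delta, which
   leaves room for exponents above the critical ones. *)
Lemma regime_long (a : R) (Q : nat) (delta : R) : 0 < a < 1 -> 0 < delta ->
  delta <= a / 2 -> delta <= (a * Q%:R - 1) / 2 -> regime a Q delta.
Proof.
move=> /andP[a0 a1] d0 d1 d2.
split; [lra|lra|lra|move=> r s /andP[r0 rs] rsQ].
have r1 : 1 <= r%:R :> R by rewrite ler1n.
have QE : Q%:R = r%:R + s%:R :> R by rewrite -natrD rsQ.
rewrite natrM; set u : R := r%:R in r1 QE *; set v : R := s%:R in QE *.
have [rs_eq|rs_lt] : r = s \/ (r < s)%N.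
    by move: rs; rewrite leq_eqVlt => /predU1P[->|]; [left|right].
  have uv : u = v by rewrite /u /v rs_eq.
  exists (1 / 2 - delta), 0; split; [left|right|lra].
    by split; nra.
  by split => //; nra.
have uv : u + 1 <= v by rewrite /u /v natr1 ler_nat.
rewrite QE in d2.
have au : a <= a * u by nra.
have auv : a * u + a <= a * v by nra.
have [e1 [e2 [e10 e20 h1 [h2 h3]]]] : exists e1 e2 : R,
    [/\ 0 < e1, 0 < e2, 2 * e1 + e2 <= 1 - 2 * delta & 1 - a * v <= e1 /\ 1 - a * (2 * u) <= e2].
  have -> : a * (2 * u) = 2 * (a * u) by ring.
  rewrite mulrDr in d2; move: (a * u) (a * v) au auv d2 => x y au auv d2.
  have [y1|y1] := leP 1 y; have [x1|x1] := leP 1 (2 * x).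
  - by exists ((1 - 2 * delta) / 3), ((1 - 2 * delta) / 3); split; try split; lra.
  - exists ((2 * x - 2 * delta) / 3), (1 - 2 * x + (2 * x - 2 * delta) / 3).
    by split; try split; lra.
  - exists (1 - y + (2 * y - 1 - 2 * delta) / 3), ((2 * y - 1 - 2 * delta) / 3).
    by split; try split; lra.
  - pose z := (2 * x + 2 * y - 2 - 2 * delta) / 3.
    by exists (1 - y + z), (1 - 2 * x + z); rewrite /z; split; try split; lra.
exists e1, e2; split => //; left; split => //; apply/andP; split; lra.
Qed.

Variables (A a delta : R) (q : nat).
Hypothesis A0 : 0 <= A.
Hypothesis reg : regime a q.+1 delta.

(** The kernel with the smaller power is the one to be squared; [quad_sumC] exchanges the
   two. *)
Lemma quad_sum_rate (r : nat) : (r < q)%N -> exists2 K : R, 0 <= K &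
  forall x, decay A a x -> forall n, (0 < n)%N ->
    quad_sum (fun t => x t ^+ r.+1) (fun t => x t ^+ (q - r)) n <=
    K * n%:R `^ (2 - 2 * delta).
Proof.
move=> rq; have [_ _ _ hreg] := reg.
have main (r1 s1 : nat) : (0 < r1 <= s1)%N -> (r1 + s1)%N = q.+1 -> exists2 K : R, 0 <= K &
  forall x, decay A a x -> forall n, (0 < n)%N ->
    quad_sum (fun t => x t ^+ r1) (fun t => x t ^+ s1) n <= K * n%:R `^ (2 - 2 * delta).
  move=> rs rsQ; have [e1 [e2 [se1 se2 e12]]] := hreg _ _ rs rsQ.
  have [K1 K10 hK1] := power_sum_bound A0 se1.
  have [K2 K20 hK2] := power_sum_bound A0 se2.
  exists ((2 * K1) ^+ 2 * (2 * K2)); first by rewrite mulr_ge0 ?sqr_ge0// mulr_ge0.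
  move=> x dx n n0; have [_ hx] := dx.
  have x0 t : 0 <= x t by case: (hx t).
  apply: le_trans (quad_sum_le _ _ _) _ => //; try by move=> t; rewrite exprn_ge0.
  have -> : \sum_(t < n) (x t ^+ r1) ^+ 2 = \sum_(t < n) x t ^+ (2 * r1).
    by apply: eq_bigr => t _; rewrite -exprM mulnC.
  have n1 : 1 <= n%:R :> R by rewrite ler1n.
  have s1n : 2 * \sum_(t < n) x t ^+ s1 <= 2 * K1 * n%:R `^ e1.
    by rewrite -mulrA ler_wpM2l// hK1.
  have s2n : 2 * \sum_(t < n) x t ^+ (2 * r1) <= 2 * K2 * n%:R `^ e2.
    by rewrite -mulrA ler_wpM2l// hK2.
  have S10 : 0 <= 2 * \sum_(t < n) x t ^+ s1.
    by rewrite mulr_ge0// sumr_ge0// => t _; rewrite exprn_ge0.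
  have S20 : 0 <= 2 * \sum_(t < n) x t ^+ (2 * r1).
    by rewrite mulr_ge0// sumr_ge0// => t _; rewrite exprn_ge0.
  apply: (@le_trans _ _ (n%:R * (2 * K1 * n%:R `^ e1) ^+ 2 * (2 * K2 * n%:R `^ e2))).
    apply: ler_pM => //; first by rewrite mulr_ge0 ?sqr_ge0.
    by rewrite ler_wpM2l// lerXn2r// nnegrE// (le_trans S10).
  have nn : n%:R != 0 :> R by rewrite pnatr_eq0 -lt0n.
  have -> : n%:R * (2 * K1 * n%:R `^ e1) ^+ 2 * (2 * K2 * n%:R `^ e2) =
      (2 * K1) ^+ 2 * (2 * K2) * n%:R `^ (1 + (e1 + e1) + e2).
    rewrite !powRD ?nn ?implybT// powRr1//; ring.
  rewrite ler_wpM2l ?mulr_ge0 ?sqr_ge0//.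
  by apply: ler_powR => //; lra.
have [rs|sr] := leqP r.+1 (q - r); first by apply: main; lia.
have [||K K0 hK] := main (q - r)%N r.+1; [lia|lia|].
by exists K => // x dx n n0; rewrite quad_sumC; exact: hK.
Qed.

End regime.

(** * Convergence of the Stein factor to 1 *)

Section mean_rate.
Context {R : realType}.

(** The normalized double sum is the partial sum [s n] minus the Cesaro correction
   (2/n) * \sum_(1 <= t < n) t * f t; both errors are of the stated order. *)
Lemma double_sum_rate (B beta delta : R) : 0 <= B -> 0 < delta < 1 ->
  delta <= beta - 1 -> exists2 K : R, 0 <= K &
  forall (f : nat -> R) (S : R),
    (forall t, (0 < t)%N -> `|f t| <= B * t%:R `^ (- beta)) ->
    (f 0%N + 2 * \sum_(1 <= t < M) f t) @[M --> \oo] --> S ->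
    forall n, (0 < n)%N ->
      `|n%:R^-1 * (\sum_(k < n) \sum_(j < n) f (dist k j)) - S| <= K * n%:R `^ (- delta).
Proof.
move=> B0 d01 db; have [d0 d1] := andP d01; have b1 : 1 < beta by lra.
have se : sum_exponent (beta - 1) (1 - delta).
  by left; split; [apply/andP; split; lra|lra].
have [K1 K10 hK1] := sum_powR_exponent se.
pose K2 := 1 + (beta - 1)^-1.
have K20 : 0 <= K2 by rewrite addr_ge0// invr_ge0; lra.
exists (2 * B * K2 + 2 * B * K1); first by rewrite addr_ge0// !mulr_ge0.
move=> f S fB fS n n0.
have nR : 0 < (n%:R : R) by rewrite ltr0n.
have n1 : 1 <= n%:R :> R by rewrite ler1n.
pose s M := f 0%N + 2 * \sum_(1 <= t < M) f t.
have tail : `|s n - S| <= 2 * B * K2 * n%:R `^ (- delta).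
  have cv : `|s n - s M| @[M --> \oo] --> `|s n - S|.
    by apply: cvg_norm; apply: (@cvgB _ R^o); [exact: cvg_cst|exact: fS].
  apply: (cvgr_to_le cv); near=> M.
  have nM : (n <= M)%N by near: M; exact: nbhs_infty_ge.
  have -> : s n - s M = - (2 * \sum_(n <= t < M) f t).
    by rewrite /s (@big_cat_nat _ _ _ n 1 M)//=; ring.
  rewrite normrN normrM ger0_norm// -!mulrA ler_wpM2l//.
  apply: le_trans (ler_norm_sum _ _ _) _.
  apply: (@le_trans _ _ (B * \sum_(n <= t < M) t%:R `^ (- beta))).
    rewrite mulr_sumr !big_seq; apply: ler_sum => t; rewrite mem_index_iota => /andP[nt _].
    by apply: fB; exact: leq_trans nt.
  rewrite ler_wpM2l//; apply: le_trans (sum_powR_tail _ b1 n0) _.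
  by rewrite ler_wpM2l//; apply: ler_powR => //; lra.
have head : `|2 / n%:R * \sum_(1 <= t < n) t%:R * f t| <= 2 * B * K1 * n%:R `^ (- delta).
  rewrite normrM ger0_norm ?divr_ge0//.
  apply: (@le_trans _ _ (2 / n%:R * (B * (K1 * n%:R `^ (1 - delta))))).
    rewrite ler_wpM2l ?divr_ge0//; apply: le_trans (ler_norm_sum _ _ _) _.
    apply: le_trans (ler_wpM2l B0 (hK1 n n0)).
    rewrite mulr_sumr !big_seq; apply: ler_sum => t; rewrite mem_index_iota => /andP[t1 _].
    have tR : 0 < (t%:R : R) by rewrite ltr0n.
    rewrite normrM normr_nat (_ : - (beta - 1) = 1 + - beta); last by ring.
    rewrite powRD ?(gt_eqF tR) ?implybT// powRr1// mulrCA ler_wpM2l//.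
    exact: fB.
  rewrite powRD ?(gt_eqF nR) ?implybT// powRr1//.
  by rewrite le_eqVlt; apply/orP; left; apply/eqP; field; rewrite gt_eqF.
have -> : n%:R^-1 * (\sum_(k < n) \sum_(j < n) f (dist k j)) - S =
    (s n - S) - 2 / n%:R * \sum_(1 <= t < n) t%:R * f t.
  rewrite double_sum_dist /s.
  have -> : \sum_(1 <= t < n) (n%:R - t%:R) * f t =
      n%:R * (\sum_(1 <= t < n) f t) - \sum_(1 <= t < n) t%:R * f t.
    by rewrite mulr_sumr -sumrB; apply: eq_bigr => t _; rewrite mulrBl.
  by field; rewrite gt_eqF.
apply: le_trans (ler_normB _ _) _; rewrite [leRHS]mulrDl; exact: lerD.
Unshelve. all: by end_near. Qed.

End mean_rate.

Section stein_factor_rate.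
Context {R : realType}.

(** [|1 - G| <= |1 - E G| + |G - E G|]: the first term is [double_sum_rate], the second the
   square root of the variance. *)
Lemma stein_factor_rate (A a delta S : R) (q : nat) (c : nat -> R) :
  0 <= A -> regime a q.+1 delta -> (0 < q)%N ->
  c 0%N = 1 -> decay A a (fun t => `|c t|) -> 0 < S ->
  (c 0%N ^+ q.+1 + 2 * \sum_(1 <= t < M) c t ^+ q.+1) @[M --> \oo] --> S ->
  exists2 K : R, 0 <= K &
  forall (d : measure_display) (T : measurableType d) (P : probability T R)
    (N : weight P) (n : nat) (X : 'I_n -> T -> R) (kappa : R),
    gaussian_family N X (fun i j => c (dist i j)) -> (0 < n)%N ->
    kappa ^+ 2 = q.+1`!%:R / (S * n%:R) ->
    \int[P]_w `|1 - stein_factor (X := X) (C := fun i j => c (dist i j)) q kappa w| <=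
      K * n%:R `^ (- delta).
Proof.
move=> A0 reg q0 c0 dc S0 cS; have [d01 dbeta a0 _] := reg.
have [K1 K10 hK1] := double_sum_rate (exprn_ge0 q.+1 A0) d01 dbeta.
have [K4 K40 hK4] := @wick4_cov_bound R q.
have /choice[Kr hKr] : forall r : 'I_q, exists K : R, 0 <= K /\
  forall x, decay A a x -> forall n, (0 < n)%N ->
    quad_sum (fun t => x t ^+ r.+1) (fun t => x t ^+ (q - r)) n <=
    K * n%:R `^ (2 - 2 * delta).
  by move=> r; have [K K0 hK] := quad_sum_rate A0 reg (ltn_ord r); exists K.
pose f := q.+1`!%:R / S : R.
have f0 : 0 <= f by rewrite divr_ge0// ltW.
pose V := f ^+ 2 * (2 * K4) * \sum_(r < q) Kr r.
have V0 : 0 <= V.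
  apply: mulr_ge0; first by rewrite mulr_ge0 ?sqr_ge0// mulr_ge0.
  by apply: sumr_ge0 => r _; case: (hKr r).
exists (K1 / S + (V + 1)); first by rewrite addr_ge0 ?addr_ge0// divr_ge0// ltW.
move=> d T P N n X kappa GF n0 kE; set G := stein_factor _ _.
have nR : 0 < (n%:R : R) by rewrite ltr0n.
have nd0 : 0 < n%:R `^ (- delta) :> R by rewrite powR_gt0.
have C1 (i : 'I_n) : c (dist i i) = 1 by rewrite /dist subnn.
have tG : tame N G by exact: tame_stein_factor GF _ _.
have mean : `|1 - \int[P]_w G w| <= K1 / S * n%:R `^ (- delta).
  rewrite (Ex_stein_factor GF C1) kE.
  have -> : 1 - q.+1`!%:R / (S * n%:R) / q.+1`!%:R *
      (\sum_(k < n) \sum_(j < n) c (dist k j) ^+ q.+1) =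
      - S^-1 * (n%:R^-1 * (\sum_(k < n) \sum_(j < n) c (dist k j) ^+ q.+1) - S).
    have F0 : (q.+1`!%:R : R) != 0 by rewrite pnatr_eq0 -lt0n fact_gt0.
    by move: (q.+1`!%:R : R) F0 => F F0; field; rewrite F0 !gt_eqF.
  rewrite normrM normrN normfV (gtr0_norm S0) mulrC -mulrA mulrCA mulrC ler_wpM2l//.
    by rewrite invr_ge0 ltW.
  apply: (hK1 (fun t => c t ^+ q.+1)) => // t t0.
  by rewrite normrX; exact: (decay_pow A0 q.+1 dc t0).
have var : \int[P]_w ((G w - \int[P]_w G w) ^+ 2) <= ((V + 1) * n%:R `^ (- delta)) ^+ 2.
  apply: le_trans (stein_factor_var GF C1 kappa K40 hK4) _.
  have -> : kappa ^+ 4 = f ^+ 2 * n%:R ^- 2.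
    rewrite (exprM _ 2 2) kE /f; field; rewrite !gt_eqF//.
  apply: (@le_trans _ _ (f ^+ 2 * n%:R ^- 2 * (2 * K4) *
     \sum_(r < q) Kr r * n%:R `^ (2 - 2 * delta))).
    have co : 0 <= f ^+ 2 * n%:R ^- 2 * (2 * K4).
      apply: mulr_ge0; last exact: mulr_ge0.
      by apply: mulr_ge0; [exact: sqr_ge0|rewrite invr_ge0; exact: sqr_ge0].
    by rewrite ler_wpM2l//; apply: ler_sum => r _; have [_ h] := hKr r; exact: h dc n n0.
  rewrite -mulr_suml [leRHS]exprMn.
  have -> : n%:R `^ (2 - 2 * delta) = n%:R ^+ 2 * n%:R `^ (- delta) ^+ 2 :> R.
    rewrite powRD ?(gt_eqF nR) ?implybT// (powR_mulrn 2)//; congr (_ * _).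
    by rewrite -powR_mulrn ?powR_ge0// -powRrM; congr (_ `^ _); ring.
  rewrite [leLHS](_ : _ = V * n%:R `^ (- delta) ^+ 2); last first.
    by rewrite /V; field; rewrite gt_eqF.
  by rewrite ler_wpM2r ?sqr_ge0//; nra.
have tc : tame N (fun w => G w - \int[P]_w G w) by apply: tameB tG _; exact: tame_cst.
have sd := Ex_norm_le_sqr tc (mulr_gt0 (ltr_wpDl V0 ltr01) nd0) var.
have t1 : tame N (fun w => `|1 - G w|).
  by apply: tame_norm; apply: tameB tG; exact: tame_cst.
apply: (@le_trans _ _ (\int[P]_w (`|1 - \int[P]_w G w| + `|G w - \int[P]_w G w|))).
  apply: (Ex_le t1 (tameD (tame_cst N _) (tame_norm tc))) => w.
  have -> : 1 - G w = (1 - \int[P]_w G w) - (G w - \int[P]_w G w) by ring.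
  exact: ler_normB.
rewrite (ExD (tame_cst N _) (tame_norm tc)) Ex_cst [leRHS]mulrDl; exact: lerD.
Qed.

End stein_factor_rate.

(** * Sums over the integers *)

Section sum_over_integers.
Context {R : realType}.

Let esum_nat (h : int -> R) (e : nat -> int) (B : R) : injective e ->
  (forall k, 0 <= h k) -> (forall M, \sum_(0 <= t < M) h (e t) <= B) ->
  exists2 l : R, \esum_(k in range e) (h k)%:E = l%:E &
    (\sum_(0 <= t < M) h (e t)) @[M --> \oo] --> l.
Proof.
move=> ie h0 hB; pose u M := \sum_(0 <= t < M) h (e t).
have cu : cvgn u.
  apply: nondecreasing_is_cvgn.
    apply/nondecreasing_seqP => M.
    by rewrite /u big_nat_recr//= lerDl.
  by exists B => _ [M _ <-]; exact: hB.
exists (limn u) => //.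
rewrite esum_image; last by move=> x y _ _; exact: ie.
rewrite -nneseries_esumT => [|t]; last by rewrite lee_fin.
apply/cvg_lim => //.
under eq_fun do rewrite sumEFin.
by apply: cvg_EFin => //; exact: nearW.
Qed.

(** The positive and the negative part are summed separately, each over the nonnegative and
   over the negative integers. *)
Lemma sumZ_even (f : int -> R) (g : nat -> R) (B : R) :
  (forall t : nat, f t = g t) -> (forall t : nat, f (- t%:Z) = g t) ->
  (forall M, \sum_(0 <= t < M) `|g t| <= B) ->
  (g 0%N + 2 * \sum_(1 <= t < M) g t) @[M --> \oo] --> sumZ f.
Proof.
move=> fp fn gB.
have fN t : f (Negz t) = g t.+1 by rewrite -fn NegzE.
pose hp k := Num.max (f k) 0; pose hn k := Num.max (- f k) 0.
have B0 : 0 <= B by have := gB 0%N; rewrite big_geq.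
have hp0 k : 0 <= hp k by rewrite le_max lexx orbT.
have hn0 k : 0 <= hn k by rewrite le_max lexx orbT.
have hpn k : hp k - hn k = f k.
  rewrite /hp /hn; case/orP: (le_total 0 (f k)) => f0.
    by rewrite (max_l f0) max_r ?oppr_le0// subr0.
  by rewrite (max_r f0) max_l ?oppr_ge0// sub0r opprK.
have hpB k : hp k <= `|f k| by rewrite ge_max ler_norm normr_ge0.
have hnB k : hn k <= `|f k| by rewrite ge_max normr_ge0 -normrN ler_norm.
have gB' M : \sum_(0 <= t < M) `|g t.+1| <= B.
  have := gB M.+1; rewrite big_nat_recl//=; apply: le_trans.
  by rewrite lerDr.
have bndP (h : int -> R) : (forall k, h k <= `|f k|) ->
    forall M, \sum_(0 <= t < M) h (Posz t) <= B.
  by move=> hB M; apply: le_trans (gB M); apply: ler_sum => t _; rewrite -fp.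
have bndN (h : int -> R) : (forall k, h k <= `|f k|) ->
    forall M, \sum_(0 <= t < M) h (Negz t) <= B.
  by move=> hB M; apply: le_trans (gB' M); apply: ler_sum => t _; rewrite -fN.
have iP : injective Posz by move=> ? ? [].
have iN : injective Negz by move=> ? ? [].
have split_esum (h : int -> R) : (forall k, 0 <= h k) ->
    (\esum_(k in [set: int]) (h k)%:E = \esum_(k in range Posz) (h k)%:E +
      \esum_(k in range Negz) (h k)%:E)%E.
  move=> h0; rewrite (esumID (range Posz)) => [|k _]; last by rewrite lee_fin.
  rewrite !setTI; congr (_ + \esum_(k in _) _)%E.
  apply/seteqP; split => k.
    by case: k => t; [move=> H; case: H; exists t|exists t].
  by move=> [t _ <-] [].
have [lp1 ep1 cp1] := esum_nat iP hp0 (bndP _ hpB).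
have [lp2 ep2 cp2] := esum_nat iN hp0 (bndN _ hpB).
have [ln1 en1 cn1] := esum_nat iP hn0 (bndP _ hnB).
have [ln2 en2 cn2] := esum_nat iN hn0 (bndN _ hnB).
have -> : sumZ f = (lp1 - ln1) + (lp2 - ln2).
  rewrite /sumZ.
  have -> : (\esum_(k in [set: int]) (EFin \o f)^\+%E k = \esum_(k in [set: int]) (hp k)%:E)%E.
    by apply: eq_esum => k _; rewrite funeposE /= EFin_max.
  have -> : (\esum_(k in [set: int]) (EFin \o f)^\-%E k = \esum_(k in [set: int]) (hn k)%:E)%E.
    by apply: eq_esum => k _; rewrite funenegE /= EFin_max.
  rewrite !split_esum// ep1 ep2 en1 en2 /=; ring.
rewrite -(cvg_shiftS (fun M => g 0%N + 2 * \sum_(1 <= t < M) g t)).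
have -> : [sequence g 0%N + 2 * \sum_(1 <= t < M.+1) g t]_M =
    fun M => (\sum_(0 <= t < M.+1) hp (Posz t) - \sum_(0 <= t < M.+1) hn (Posz t)) +
             (\sum_(0 <= t < M) hp (Negz t) - \sum_(0 <= t < M) hn (Negz t)).
  apply/funext => M; rewrite -!sumrB.
  have -> : \sum_(0 <= t < M.+1) (hp t - hn t) = \sum_(0 <= t < M.+1) g t.
    by apply: eq_bigr => t _; rewrite hpn fp.
  have -> : \sum_(0 <= t < M) (hp (Negz t) - hn (Negz t)) = \sum_(0 <= t < M) g t.+1.
    by apply: eq_bigr => t _; rewrite hpn fN.
  by rewrite /= big_add1/= big_nat_recl//=; ring.
apply: (@cvgD _ R^o); apply: (@cvgB _ R^o) => //.
  by rewrite (cvg_shiftS (fun M => \sum_(0 <= t < M) hp (Posz t))).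
by rewrite (cvg_shiftS (fun M => \sum_(0 <= t < M) hn (Posz t))).
Qed.

End sum_over_integers.

(** * The covariance of fractional Gaussian noise *)

Section fractional_covariance.
Context {R : realType}.
Variable H : R.
Hypothesis H01 : 0 < H < 1.
Let p := 2 * H.
Let p0 : 0 < p. Proof. by have /andP[? _] := H01; rewrite mulr_gt0. Qed.
Let p2 : p < 2. Proof. by have /andP[_ ?] := H01; rewrite /p; lra. Qed.

(** The mean value theorem, applied to a difference and then to its derivative. *)
Lemma second_difference (x : R) : 1 < x -> exists2 y, x - 1 <= y <= x + 1 &
  (x + 1) `^ p + (x - 1) `^ p - 2 * x `^ p = p * (p - 1) * y `^ (p - 2).
Proof.
move=> x1; have xm : 0 < x - 1 by lra.
pose g (y : R) := (y + 1) `^ p - y `^ p.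
have dg (y : R) : 0 < y ->
    is_derive y (1 : R) g (p * (y + 1) `^ (p - 1) - p * y `^ (p - 1)).
  move=> y0; have y10 : 0 < y + 1 by lra.
  apply: derB; last exact: is_derive1_powR.
  apply: is_derive_eq (der_comp (derD (der_id y) (der_cst 1 y)) (is_derive1_powR p y10)) _.
  by rewrite addr0 mulr1.
have dgi y : y \in `]x - 1, x[%R ->
    is_derive y (1 : R) g (p * (y + 1) `^ (p - 1) - p * y `^ (p - 1)).
  by rewrite in_itv/= => /andP[xy _]; apply: dg; lra.
have cg : {within `[x - 1, x]%classic, continuous g}.
  apply: derivable_within_continuous => y; rewrite in_itv/= => /andP[xy _].
  by have [] := dg y (lt_le_trans xm xy).
have xx : x - 1 <= x by lra.
have [z + e] := MVT_segment xx dgi cg; rewrite in_itv/= => /andP[z1 z2].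
have z0 : 0 < z by lra.
have zz : z <= z + 1 by lra.
have [y /andP[y1 y2] ey] := powR_mean_value (p - 1) z0 zz.
exists y; first by lra.
have -> : (x + 1) `^ p + (x - 1) `^ p - 2 * x `^ p = g x - g (x - 1).
  by rewrite /g subrK; ring.
rewrite e -mulrBr ey (_ : z + 1 - z = 1); last by ring.
by rewrite (_ : x - (x - 1) = 1) ?mulr1 ?mulrA; [rewrite (_ : p - 1 - 1 = p - 2)//; ring|ring].
Qed.

Definition fcov (t : nat) : R := rho H t%:Z.

Lemma fcov0 : fcov 0 = 1.
Proof.
rewrite /fcov /rho add0r sub0r normrN normr1 powR1 normr0 powR0 ?gt_eqF//.
by rewrite mulr0 subr0; field.
Qed.

Lemma fcovS t : fcov t.+1 =
  2^-1 * ((t.+1%:R + 1) `^ p + (t.+1%:R - 1) `^ p - 2 * t.+1%:R `^ p).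
Proof.
rewrite /fcov /rho -/p (_ : (Posz t.+1)%:~R = t.+1%:R)//.
have t1 : 1 <= t.+1%:R :> R by rewrite ler1n.
by rewrite !ger0_norm//; lra.
Qed.

Lemma fcov1 : fcov 1 = 2^-1 * (2 `^ p - 2).
Proof.
rewrite fcovS subrr powR0 ?gt_eqF// powR1 addr0 mulr1.
by rewrite (_ : 1%:R + 1 = 2 :> R)//.
Qed.

Let two_pow_ge1 : 1 <= 2 `^ p :> R.
Proof. by rewrite -[leLHS](powRr0 2); apply: ler_powR; [lra|exact: ltW]. Qed.

Let two_pow_le4 : 2 `^ p <= 4 :> R.
Proof.
have -> : 4 = 2 `^ 2 :> R by rewrite (powR_mulrn 2)//; ring.
by apply: ler_powR; [lra|exact: ltW].
Qed.

Lemma fcovSS t : exists2 y : R, t.+1%:R <= y &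
  fcov t.+2 = 2^-1 * (p * (p - 1) * y `^ (p - 2)).
Proof.
have t1 : 1 < t.+2%:R :> R by rewrite ltr1n.
have [y /andP[y1 _] e] := second_difference t1; exists y; last by rewrite fcovS e.
by apply: le_trans y1; rewrite -[t.+2]addn1 natrD addrK.
Qed.

(** [second_difference] for t > 1; passing from t - 1 to t costs a factor 2^(2 - p), at
   most 4. *)
Lemma fcov_decay : decay 4 (2 - p) (fun t => `|fcov t|).
Proof.
split; first by rewrite fcov0 normr1; lra.
move=> t; split => // t0; rewrite opprB.
case: t t0 => // -[_|t _].
  rewrite powR1 mulr1 fcov1 ler_norml; have := two_pow_ge1; have := two_pow_le4; lra.
have [y ty ->] := fcovSS t.
have t10 : 0 < t.+1%:R :> R by rewrite ltr0n.
have yb : y `^ (p - 2) <= 4 * t.+2%:R `^ (p - 2).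
  have half0 : 0 < (t.+2%:R / 2 : R) by rewrite divr_gt0.
  have half : t.+2%:R / 2 <= y.
    apply: le_trans ty; rewrite ler_pdivrMr// -natrM ler_nat; lia.
  have pm : p - 2 <= 0 by have := p2; lra.
  apply: le_trans (powR_antitone pm half0 half) _.
  rewrite powRM// ?invr_ge0// mulrC ler_wpM2r ?powR_ge0//.
  have -> : 2^-1 `^ (p - 2) = 2 `^ (2 - p) :> R.
    by rewrite -(powR_inv1 (_ : 0 <= 2))// -powRrM; congr (_ `^ _); ring.
  have -> : 4 = 2 `^ 2 :> R by rewrite (powR_mulrn 2)//; ring.
  by apply: ler_powR; [|have := p0]; lra.
rewrite (normrM 2^-1) (normrM (p * _)) (normrM p) (ger0_norm (powR_ge0 _ _)).
rewrite (gtr0_norm p0) (ger0_norm (_ : 0 <= 2^-1)) ?invr_ge0//.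
have hp : `|p - 1| <= 1 by rewrite ler_norml; have := p0; have := p2; lra.
have yp := powR_ge0 y (p - 2).
have pp : p * `|p - 1| <= 2 by have := p0; have := p2; have := normr_ge0 (p - 1); nra.
have : p * `|p - 1| * y `^ (p - 2) <= 2 * y `^ (p - 2) by rewrite ler_wpM2r.
lra.
Qed.

Lemma fcov_ge0 t : 1 <= p -> 0 <= fcov t.
Proof.
move=> p1; case: t => [|[|t]]; first by rewrite fcov0.
  rewrite fcov1 mulr_ge0 ?invr_ge0// subr_ge0.
  by rewrite -[leLHS](powRr1 (_ : 0 <= 2))//; apply: ler_powR => //; lra.
have [y ty ->] := fcovSS t.
apply: mulr_ge0; first by rewrite invr_ge0.
apply: mulr_ge0; last exact: powR_ge0.
by apply: mulr_ge0; [exact: ltW|rewrite subr_ge0].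
Qed.

Lemma fcov_le0 t : p <= 1 -> fcov t.+1 <= 0.
Proof.
move=> p1; case: t => [|t].
  rewrite fcov1 mulr_ge0_le0 ?invr_ge0// subr_le0.
  by rewrite -[leRHS](powRr1 (_ : 0 <= 2))//; apply: ler_powR => //; lra.
have [y ty ->] := fcovSS t.
rewrite mulr_ge0_le0 ?invr_ge0// mulr_le0_ge0 ?powR_ge0//.
by apply: mulr_ge0_le0; [exact: ltW|rewrite subr_le0].
Qed.

Lemma fcov_half t : p = 1 -> fcov t.+1 = 0.
Proof.
move=> p1; apply/eqP; rewrite eq_le fcov_le0 ?p1// fcov_ge0 ?p1//.
Qed.

(** The second differences telescope. *)
Lemma sum_fcov M : \sum_(1 <= t < M.+1) fcov t =
  2^-1 * ((M%:R + 1) `^ p - M%:R `^ p - 1).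
Proof.
elim: M => [|M IH].
  by rewrite big_geq// add0r powR1 powR0 ?gt_eqF//; ring.
by rewrite big_nat_recr//= IH fcovS -(@natr1 R M) addrK; ring.
Qed.

Lemma sum_fcov_norm M : p <= 1 -> \sum_(1 <= t < M) `|fcov t| <= 2^-1.
Proof.
move=> p1; case: M => [|M]; first by rewrite big_geq// invr_ge0.
have -> : \sum_(1 <= t < M.+1) `|fcov t| = - \sum_(1 <= t < M.+1) fcov t.
  rewrite -sumrN; apply: eq_big_nat => -[//|t] _.
  by rewrite ler0_norm// fcov_le0.
rewrite sum_fcov.
have : M%:R `^ p <= (M%:R + 1) `^ p :> R.
  by apply: ge0_ler_powR; rewrite ?nnegrE ?addr_ge0 ?(ltW p0)// lerDl.
lra.
Qed.

Lemma fcov_norm_le t : p <= 1 -> `|fcov t.+1| <= 2^-1.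
Proof.
move=> p1; apply: le_trans (sum_fcov_norm t.+2 p1).
by rewrite big_nat_recr//= lerDr sumr_ge0.
Qed.

(** For p >= 1 the covariances are nonnegative. For p <= 1 those off the diagonal are
   nonpositive and sum to at least - 1/2, so each is at least - 1/2 and their Q-th powers
   sum to at most 1/4 in absolute value. *)
Lemma fcov_partial_sum_ge (Q M : nat) : (2 <= Q)%N ->
  2^-1 <= fcov 0 ^+ Q + 2 * \sum_(1 <= t < M) fcov t ^+ Q.
Proof.
move=> Q2; rewrite fcov0 expr1n; have [p1|/ltW p1] := leP 1 p.
  have : 0 <= \sum_(1 <= t < M) fcov t ^+ Q.
    by apply: sumr_ge0 => t _; rewrite exprn_ge0// fcov_ge0.
  lra.
suff : `|\sum_(1 <= t < M) fcov t ^+ Q| <= 2^-1 * 2^-1 by rewrite ler_norml; lra.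
apply: le_trans (ler_norm_sum _ _ _) _.
apply: (@le_trans _ _ (\sum_(1 <= t < M) 2^-1 * `|fcov t|)); last first.
  by rewrite -mulr_sumr ler_wpM2l ?invr_ge0// sum_fcov_norm.
rewrite !big_nat; apply: ler_sum => -[//|t] _.
rewrite normrX -(subnK Q2) addn2 !exprS.
apply: ler_pM => //.
  exact: fcov_norm_le.
rewrite ler_piMr// exprn_ile1//.
by apply: le_trans (fcov_norm_le t p1) _; rewrite invf_le1// ler1n.
Qed.

Lemma sumZ_fcov (Q : nat) : 1 < (2 - p) * Q%:R ->
  (fcov 0 ^+ Q + 2 * \sum_(1 <= t < M) fcov t ^+ Q) @[M --> \oo] -->
  sumZ (fun t => rho H t ^+ Q).
Proof.
move=> bQ; pose b := (2 - p) * Q%:R.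
have se : sum_exponent b 0 by right.
have h4 : 0 <= 4 :> R by lra.
have [K K0 hK] := power_sum_bound h4 se.
apply: (@sumZ_even _ _ (fun t => fcov t ^+ Q) K) => // [t|M].
  rewrite /fcov; congr (_ ^+ _); rewrite /rho intrN normrN.
  have -> : `|- t%:~R + 1| = `|t%:~R - 1| :> R by rewrite -normrN opprD opprK.
  have -> : `|- t%:~R - 1| = `|t%:~R + 1| :> R by rewrite -opprD normrN.
  by rewrite (addrC (_ `^ _)).
case: M => [|M]; first by rewrite big_geq.
have := hK _ fcov_decay M.+1 isT; rewrite powRr0 mulr1.
by rewrite big_mkord; under [X in _ -> X <= _]eq_bigr do rewrite normrX.
Qed.

(** The covariance of the increments over [k, k + 1] and [l, l + 1]. *)
Lemma fcov_dist (k l : nat) : fcov (dist k l) =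
  2^-1 * (`|k%:R - l%:R + 1| `^ p + `|k%:R - l%:R - 1| `^ p - 2 * `|k%:R - l%:R| `^ p).
Proof.
wlog lk : k l / (l <= k)%N.
  move=> W; have [/W//|/ltnW/W] := leqP l k; rewrite distC => ->.
  rewrite (distrC l%:R); congr (_ * (_ - _)); rewrite addrC.
  by congr (_ + _); rewrite -normrN; congr (`|_| `^ _); ring.
rewrite /fcov /rho (_ : (Posz (dist k l))%:~R = (dist k l)%:R)// -/p.
have -> : dist k l = (k - l)%N by rewrite /dist; lia.
by rewrite natrB.
Qed.

End fractional_covariance.

(** * Increments of fractional Brownian motion *)

Section weights.
Context {R : realType} {d : measure_display} {T : measurableType d}.
Variable P : probability T R.

Definition finite_moments (g : T -> R) := [/\ measurable_fun setT g,
  forall w, 0 <= g w & forall p : nat, P.-integrable setT (fun w => (g w ^+ p)%:E)].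

Lemma exprD_le (x y : R) (p : nat) : 0 <= x -> 0 <= y ->
  (x + y) ^+ p <= 2 ^+ p * (x ^+ p + y ^+ p).
Proof.
move=> x0 y0; wlog xy : x y x0 y0 / x <= y.
  by move=> W; have [/W|/ltW/W] := leP x y; [exact|rewrite addrC (addrC (y ^+ p)); exact].
apply: (@le_trans _ _ ((2 * y) ^+ p)).
  by rewrite lerXn2r ?nnegrE ?addr_ge0 ?mulr_ge0//; lra.
by rewrite exprMn ler_wpM2l ?exprn_ge0// lerDr exprn_ge0.
Qed.

Lemma finite_momentsD g h : finite_moments g -> finite_moments h ->
  finite_moments (fun w => g w + h w).
Proof.
move=> [mg g0 ig] [mh h0 ih]; split; [exact: measurable_funD|by move=> w; rewrite addr_ge0|].
move=> p.
have i1 : P.-integrable setT (fun w => (2 ^+ p)%:E * ((g w ^+ p)%:E + (h w ^+ p)%:E))%E.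
  by apply: integrableZl => //; exact: integrableD.
apply: le_integrable i1 => //.
  by apply/measurable_EFinP; apply: measurable_funX; exact: measurable_funD.
move=> w _ /=; rewrite lee_fin ger0_norm ?exprn_ge0 ?addr_ge0//.
by apply: le_trans (ler_norm _); exact: exprD_le.
Qed.

Lemma finite_momentsZ (c : R) g : 0 <= c -> finite_moments g ->
  finite_moments (fun w => c * g w).
Proof.
move=> c0 [mg g0 ig]; split; [exact: measurable_funM|by move=> w; rewrite mulr_ge0|].
by move=> p; under eq_fun do rewrite exprMn EFinM; exact: integrableZl.
Qed.

Lemma finite_moments_cst (c : R) : 0 <= c -> finite_moments (fun=> c).
Proof. by move=> c0; split => // p; exact: finite_measure_integrable_cst. Qed.

Lemma finite_moments_sum (I : Type) (s : seq I) (g : I -> T -> R) :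
  (forall i, finite_moments (g i)) -> finite_moments (fun w => \sum_(i <- s) g i w).
Proof.
move=> hg; elim: s => [|i s IH].
  by under eq_fun do rewrite big_nil; exact: finite_moments_cst.
by under eq_fun do rewrite big_cons; exact: finite_momentsD.
Qed.

End weights.

Section fBm_increments.
Context {R : realType} {d : measure_display} {T : measurableType d}.
Context {P : probability T R}.
Variables (H : R) (B : R -> {RV P >-> R}).
Hypothesis H01 : 0 < H < 1.
Hypothesis fB : fBm H B.
Variable n : nat.
Hypothesis n0 : (0 < n)%N.
Let p := 2 * H.
Let nR : 0 < n%:R :> R. Proof. by rewrite ltr0n. Qed.
Let s : R := n%:R `^ H.
Let s0 : 0 <= s. Proof. exact: powR_ge0. Qed.

Let b (k : 'I_n.+1) : T -> R := B (k%:R / n%:R).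

Let k01 (k : nat) : (k <= n)%N -> 0 <= (k%:R / n%:R : R) <= 1.
Proof.
by move=> kn; rewrite divr_ge0 ?ler0n//= ler_pdivrMr// mul1r ler_nat.
Qed.

Let b_moments k : finite_moments P (fun w => `|b k w|).
Proof.
have tk : 0 <= (k%:R / n%:R : R) <= 1 by apply: k01; rewrite -ltnS.
have := fBm_gaussian fB (N := 1) (fun=> 1) (fun=> tk).
move=> /gaussian_moments g; split => [||q].
- by apply: measurableT_comp => //; exact: measurable_funPT.
- by move=> w; exact: normr_ge0.
- have := g q; congr (P.-integrable _ _); apply/funext => w.
  by rewrite lin_combE big_ord1 mul1r.
Qed.

(** The factor 1 + 2s makes W dominate the values of B on the grid as well as the
   normalized increments. *)
Let W w := 1 + \sum_(k < n.+1) (1 + 2 * s) * `|b k w|.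

Let W_moments : finite_moments P W.
Proof.
apply: finite_momentsD; first exact: finite_moments_cst.
by apply: finite_moments_sum => k; apply: finite_momentsZ (b_moments k);
  rewrite addr_ge0// mulr_ge0.
Qed.

Let W1 w : 1 <= W w.
Proof. by rewrite lerDl sumr_ge0// => k _; rewrite mulr_ge0// addr_ge0// mulr_ge0. Qed.

Let N : weight P := Weight W1 (let: And3 _ _ h := W_moments in h).

Let bW k w : (1 + 2 * s) * `|b k w| <= W w.
Proof.
rewrite /W (bigD1 k)//= addrCA lerDl addr_ge0// sumr_ge0// => j _.
by rewrite mulr_ge0// addr_ge0// mulr_ge0.
Qed.

Let tb k : tame N (b k).
Proof.
split; first exact: measurable_funPT.
exists 1, 1%N => w; rewrite mul1r expr1; apply: le_trans (bW k w).
by rewrite ler_peMl// lerDl mulr_ge0.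
Qed.

Definition increment (i : 'I_n) : T -> R :=
  fun w => n%:R `^ H * (B (i.+1%:R / n%:R) w - B (i%:R / n%:R) w).

Let lo (i : 'I_n) : 'I_n.+1 := widen_ord (leqnSn n) i.
Let hi (i : 'I_n) : 'I_n.+1 := lift ord0 i.

Let incE i w : increment i w = s * (b (hi i) w - b (lo i) w).
Proof. by []. Qed.

Let inc_le i w : `|increment i w| <= W w.
Proof.
rewrite incE normrM (ger0_norm s0).
have h1 := bW (hi i) w; have h2 := bW (lo i) w.
have h3 := ler_normB (b (hi i) w) (b (lo i) w).
have h4 := normr_ge0 (b (hi i) w); have h5 := normr_ge0 (b (lo i) w).
have h6 : s * `|b (hi i) w - b (lo i) w| <= s * (`|b (hi i) w| + `|b (lo i) w|).
  by rewrite ler_wpM2l.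
by have := s0; lra.
Qed.

Let Ex_b k : \int[P]_w b k w = 0.
Proof.
have tk : 0 <= (k%:R / n%:R : R) <= 1 by apply: k01; rewrite -ltnS.
by have := fBm_centered fB tk; rewrite unlock /Rintegral => ->.
Qed.

Let cov (k l : R) : R := 2^-1 * (l `^ p + k `^ p - `|l - k| `^ p).

Let Ex_bb k l : \int[P]_w (b k w * b l w) = cov (k%:R / n%:R) (l%:R / n%:R).
Proof.
have tk : 0 <= (k%:R / n%:R : R) <= 1 by apply: k01; rewrite -ltnS.
have tl : 0 <= (l%:R / n%:R : R) <= 1 by apply: k01; rewrite -ltnS.
by have := fBm_cov fB tk tl; rewrite unlock /Rintegral => ->.
Qed.

(** Self-similarity: the normalization n^H removes the mesh 1/n. *)
Let scaling (x : R) : s ^+ 2 * `|x / n%:R| `^ p = `|x| `^ p.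
Proof.
have -> : s ^+ 2 = n%:R `^ p by rewrite /s -powR_mulrn ?powR_ge0// -powRrM mulrC.
rewrite -powRM ?ler0n//; congr (_ `^ _).
by rewrite normrM normfV (gtr0_norm nR) mulrC divfK// gt_eqF.
Qed.

Let t_inc i : tame N (increment i).
Proof. exact: tameZ (tameB (tb (hi i)) (tb (lo i))). Qed.

Let Ex_inc i j : \int[P]_w (increment i w * increment j w) = fcov H (dist i j).
Proof.
have tbb k l : tame N (fun w => b k w * b l w) by exact: tameM (tb k) (tb l).
transitivity (\int[P]_w (s ^+ 2 * ((b (hi i) w * b (hi j) w - b (hi i) w * b (lo j) w) -
   (b (lo i) w * b (hi j) w - b (lo i) w * b (lo j) w)))).
  by apply: eq_Rintegral => w _; rewrite !incE; ring.
rewrite (ExZ _ (tameB (tameB (tbb _ _) (tbb _ _)) (tameB (tbb _ _) (tbb _ _)))).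
rewrite (ExB (tameB (tbb _ _) (tbb _ _)) (tameB (tbb _ _) (tbb _ _))).
rewrite !(ExB (tbb _ _) (tbb _ _)) !Ex_bb fcov_dist// -/p.
have -> : (lo i : nat) = i by [].
have -> : (lo j : nat) = j by [].
have -> : (hi i : nat) = i.+1 by [].
have -> : (hi j : nat) = j.+1 by [].
rewrite -(scaling (i%:R - j%:R + 1)) -(scaling (i%:R - j%:R - 1)) -(scaling (i%:R - j%:R)).
have e1 : `|(j.+1%:R / n%:R - i.+1%:R / n%:R : R)| = `|(i%:R - j%:R) / n%:R|.
  by rewrite -normrN -!natr1; congr (`|_|); field; rewrite gt_eqF.
have e2 : `|(j%:R / n%:R - i.+1%:R / n%:R : R)| = `|(i%:R - j%:R + 1) / n%:R|.
  by rewrite -normrN -!natr1; congr (`|_|); field; rewrite gt_eqF.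
have e3 : `|(j.+1%:R / n%:R - i%:R / n%:R : R)| = `|(i%:R - j%:R - 1) / n%:R|.
  by rewrite -normrN -!natr1; congr (`|_|); field; rewrite gt_eqF.
have e4 : `|(j%:R / n%:R - i%:R / n%:R : R)| = `|(i%:R - j%:R) / n%:R|.
  by rewrite -normrN; congr (`|_|); field; rewrite gt_eqF.
by rewrite /cov e1 e2 e3 e4; field.
Qed.

(** A linear combination of increments is one of values of B, hence Gaussian, and
   [gaussian_cos] gives its characteristic function. *)
Lemma fBm_gaussian_family : exists N : weight P,
  gaussian_family N increment (fun i j => fcov H (dist i j)).
Proof.
exists N; split.
- by move=> i; case: (t_inc i).
- exact: inc_le.
- by move=> i j; rewrite distC.
move=> t c.
(* The right endpoints of the increments, then the left ones. *)
pose tau (j : 'I_(n + n)) : R := match fintype.split j with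
  | inl i => i.+1%:R / n%:R | inr i => i%:R / n%:R end.
pose a (j : 'I_(n + n)) : R := match fintype.split j with
  | inl i => t i * s | inr i => - (t i * s) end.
have tau01 j : 0 <= tau j <= 1.
  by rewrite /tau; case: (fintype.split j) => i; apply: k01; [exact: ltn_ord|exact/ltnW/ltn_ord].
have gY := fBm_gaussian fB a tau01.
set Y := lin_comb _ _ in gY.
have YE w : Y w = \sum_(i < n) t i * increment i w.
  rewrite lin_combE big_split_ord/= -big_split/=; apply: eq_bigr => i _.
  rewrite /a /tau !(unsplitK (inl _)) !(unsplitK (inr _)) /increment -/s.
  ring.
have tti i : tame N (fun w => t i * increment i w) by apply: tameZ; exact: t_inc.
have Y0 : \int[P]_w Y w = 0.
  under eq_Rintegral do rewrite YE.
  rewrite (Ex_sum _ tti) big1// => i _; rewrite (ExZ _ (t_inc i)).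
  under eq_Rintegral do rewrite incE.
  by rewrite (ExZ _ (tameB (tb _) (tb _))) (ExB (tb _) (tb _)) !Ex_b subrr !mulr0.
have Y2 : \int[P]_w (Y w ^+ 2) =
    \sum_(i < n) \sum_(j < n) t i * t j * fcov H (dist i j).
  transitivity (\int[P]_w (\sum_(i < n) \sum_(j < n) t i * t j * (increment i w * increment j w))).
    apply: eq_Rintegral => w _; rewrite YE expr2 mulr_suml; apply: eq_bigr => i _.
    by rewrite mulr_sumr; apply: eq_bigr => j _; ring.
  have tij i j : tame N (fun w => increment i w * increment j w) by exact: tameM (t_inc i) (t_inc j).
  have tsi i : tame N (fun w => \sum_(j < n) t i * t j * (increment i w * increment j w)).
    by apply: tame_sum => j; exact: tameZ.
  rewrite (Ex_sum _ tsi); apply: eq_bigr => i _.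
  rewrite (Ex_sum _ (fun j => tameZ _ (tij i j))); apply: eq_bigr => j _.
  by rewrite (ExZ _ (tij i j)) Ex_inc.
have e := gaussian_cos c gY Y0; rewrite Y2 in e.
transitivity (\int[P]_w cos (Y w + c)); first by apply: eq_Rintegral => w _; rewrite YE.
rewrite e; congr (expR (- _) * _); rewrite mulr_suml; apply: eq_bigr => i _.
by rewrite mulr_suml.
Qed.

End fBm_increments.

(** * Kolmogorov distance *)

Section probability_bounds.
Context {R : realType} {d : measure_display} {T : measurableType d}.
Variable P : probability T R.

Lemma integrable_bounded (g : T -> R) (M : R) : measurable_fun setT g ->
  (forall w, `|g w| <= M) -> P.-integrable setT (EFin \o g).
Proof.
move=> mg gM.
apply: (@le_integrable _ _ _ P setT _ (EFin \o g) (EFin \o cst M)) => //.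
- exact/measurable_EFinP.
- by move=> w _ /=; rewrite lee_fin (le_trans (gM w))// ler_norm.
- exact: finite_measure_integrable_cst.
Qed.

Definition cdf_at (X : {RV P >-> R}) z := \int[P]_w (\1_[set w | X w <= z] w : R).

Let mle (X : {RV P >-> R}) z : measurable [set w | X w <= z].
Proof.
rewrite -[X in measurable X]setTI; apply: measurable_fun_le => //.
Qed.

Lemma cdf_atE (X : {RV P >-> R}) z : P [set w | X w <= z] = (cdf_at X z)%:E.
Proof.
rewrite /cdf_at /Rintegral integral_indic ?setIT// fineK//.
exact: fin_num_measure.
Qed.

Let i_ind (X : {RV P >-> R}) z :
  P.-integrable setT (EFin \o (\1_[set w | X w <= z] : T -> R)).
Proof.
apply: (@integrable_bounded _ 1) => [|w].
  exact: measurable_indic.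
by rewrite indicE ger0_norm// lern1 leq_b1.
Qed.

Let i_comp (X : {RV P >-> R}) (h : R -> R) : continuous h ->
  (forall x, 0 <= h x <= 1) -> P.-integrable setT (fun w => (h (X w))%:E).
Proof.
move=> ch h01; apply: (@integrable_bounded (h \o X) 1) => [|w].
  by apply: measurableT_comp => //; exact: continuous_measurable_fun.
by rewrite ger0_norm; case/andP: (h01 (X w)).
Qed.

Lemma cdf_at_le (X : {RV P >-> R}) (h : R -> R) z : continuous h ->
  (forall x, 0 <= h x <= 1) -> (forall x, x <= z -> h x = 1) ->
  cdf_at X z <= \int[P]_w h (X w).
Proof.
move=> ch h01 hz; apply: le_Rintegral => //; first exact: i_comp.
move=> w _; rewrite indicE; have [wA|_] := boolP (w \in _).
  by rewrite hz//; move: wA; rewrite inE.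
by case/andP: (h01 (X w)).
Qed.

Lemma le_cdf_at (X : {RV P >-> R}) (h : R -> R) z : continuous h ->
  (forall x, 0 <= h x <= 1) -> (forall x, z < x -> h x = 0) ->
  \int[P]_w h (X w) <= cdf_at X z.
Proof.
move=> ch h01 hz; apply: le_Rintegral => //; first exact: i_comp.
move=> w _; rewrite indicE; have [wA|] := boolP (w \in _).
  by case/andP: (h01 (X w)).
by rewrite notin_setE/= => /negP; rewrite -ltNge => /hz ->.
Qed.

(** The normal density is bounded by its peak. *)
Lemma cdf_normal_lipschitz (Z : {RV P >-> R}) z e : has_normal_law Z 0 1 -> 0 <= e ->
  cdf_at Z (z + e) <= cdf_at Z z + normal_peak 1 * e.
Proof.
move=> lZ e0; rewrite -lee_fin EFinD -!cdf_atE.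
have -> : [set w | Z w <= z + e] = [set w | Z w <= z] `|` Z @^-1` `]z, (z + e)].
  apply/seteqP; split => w /=; rewrite in_itv/=.
    by move=> wz; have [h|h] := leP (Z w) z; [left|right].
  by case=> [/le_trans|/andP[]//]; apply; rewrite lerDl.
rewrite measureU//=; last 2 first.
- by rewrite -[X in measurable X]setTI; exact: measurable_funPT.
- apply/seteqP; split => w //= -[wz]; rewrite in_itv/= => /andP[zw _].
  by have := lt_le_trans zw wz; rewrite ltxx.
rewrite leeD2l//; have := lZ `]z, (z + e)]%classic (measurable_itv _).
rewrite /distribution/= /pushforward => ->.
rewrite /normal_prob.
pose I : set R := `]z, (z + e)]%classic.
have le_peak : (\int[@lebesgue_measure R]_(x in I) (normal_pdf 0 1 x)%:E <=
    \int[@lebesgue_measure R]_(x in I) (normal_peak 1)%:E)%E.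
  apply: ge0_le_integral => //.
  - exact: measurable_itv.
  - by move=> x _; rewrite lee_fin normal_pdf_ge0.
  - by apply: measurable_funTS; apply/measurable_EFinP; exact: measurable_normal_pdf.
  - by move=> x _; rewrite lee_fin normal_pdf_ub// oner_neq0.
apply: le_trans le_peak _.
rewrite integral_cst ?/I; last exact: measurable_itv.
rewrite [X in (_ * X)%E]lebesgue_measure_itv/= lte_fin ltrDl.
case: ltP => [_|]; last by rewrite mule0 lee_fin mulr_ge0// normal_peak_ge0.
by rewrite -EFinB -EFinM addrAC subrr add0r.
Qed.

End probability_bounds.

(** min(1, max(0, (z + e - x)/e)), with norms. *)
Definition ramp {R : realType} (z e x : R) : R :=
  (`|(z + e - x) / e| - `|(z + e - x) / e - 1| + 1) / 2.

Section ramp.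
Context {R : realType}.
Variables (z e : R).

Lemma continuous_ramp : continuous (ramp z e).
Proof.
have cst_c (c : R) : continuous (fun _ : R => c) by move=> x; exact: cvg_cst.
have cu : continuous (fun x => (z + e - x) / e).
  by apply: contM => //; apply: contB => // x; exact: cvg_id.
have norm_c (f : R -> R) : continuous f -> continuous (fun x => `|f x|).
  by move=> cf x; apply: (@cvg_norm _ R^o); exact: cf.
by apply: contM => //; apply: contD => //; apply: contB; apply: norm_c => //; exact: contB.
Qed.

Lemma ramp01 x : 0 <= ramp z e x <= 1.
Proof.
rewrite /ramp; move: ((z + e - x) / e) => u.
have := ler_normD u (- 1); have := ler_normD (u - 1) 1.
by rewrite subrK normrN normr1 => h1 h2; apply/andP; split; lra.
Qed.

Hypothesis e0 : 0 < e.

Lemma ramp1 x : x <= z -> ramp z e x = 1.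
Proof.
move=> xz; have : 1 <= (z + e - x) / e by rewrite ler_pdivlMr// mul1r; lra.
rewrite /ramp; move: ((z + e - x) / e) => u u1.
rewrite (ger0_norm (le_trans ler01 u1)) ger0_norm; first by field.
by rewrite subr_ge0.
Qed.

Lemma ramp0 x : z + e < x -> ramp z e x = 0.
Proof.
move=> xz; have : (z + e - x) / e <= 0 by rewrite ler_pdivrMr// mul0r; lra.
rewrite /ramp; move: ((z + e - x) / e) => u u0.
rewrite (ler0_norm u0) ler0_norm; first by field.
by rewrite subr_le0 (le_trans u0).
Qed.

End ramp.

(** The indicator of ]-oo, z] lies between the ramps on [z - e, z] and on [z, z + e], and
   for the normal law these cost O(e). Since the hypothesis is uniform in [h], [e] may tend
   to 0 with [eps] fixed. *)
Lemma kolmogorov_dist_smooth {R : realType}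
    {d : measure_display} {T : measurableType d} {P : probability T R}
    {d' : measure_display} {T' : measurableType d'} {Q : probability T' R}
    (X : {RV P >-> R}) (Z : {RV Q >-> R}) (eps : R) : has_normal_law Z 0 1 ->
  (forall h : R -> R, continuous h -> (forall x, `|h x| <= 1) ->
    `|\int[P]_w h (X w) - normal_mean h| <= eps) ->
  (kolmogorov_dist X Z <= eps%:E)%E.
Proof.
move=> lZ hX; apply: ge_ereal_sup => _ [z _ <-].
rewrite !cdf_atE -EFinB abse_EFin lee_fin.
pose K : R := normal_peak 1; have K0 : 0 <= K by exact: normal_peak_ge0.
have ch y e : continuous (ramp y e : R -> R) by exact: continuous_ramp.
have EZ y e : \int[Q]_w ramp y e (Z w) = normal_mean (ramp y e).
  have h1 x : `|ramp y e x : R| <= 1.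
    by rewrite ger0_norm; case/andP: (ramp01 y e x).
  rewrite /normal_mean; apply: Rintegral_law lZ _ _.
    exact: continuous_measurable_fun.
  exact: integrable_bounded_normal (ch y e) h1.
have close y e : `|\int[P]_w ramp y e (X w) - \int[Q]_w ramp y e (Z w)| <= eps.
  by rewrite EZ; apply: hX => // x; rewrite ger0_norm; case/andP: (ramp01 y e x).
apply/ler_addgt0Pr => t t0.
have [e e0 et] : exists2 e : R, 0 < e & K * e <= t.
  exists (t / (K + 1)); first by rewrite divr_gt0// ltr_wpDl.
  rewrite mulrCA ler_piMr ?(ltW t0)// ler_pdivrMr ?mul1r ?lerDl//.
  by rewrite ltr_wpDl.
rewrite ler_distl; apply/andP; split.
  have := close (z - e) e; rewrite ler_distl => /andP[h _].
  have h1 := cdf_at_le Z (ch (z - e) e) (ramp01 _ _) (fun x => @ramp1 _ (z - e) e e0 x).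
  have h2 : \int[P]_w ramp (z - e) e (X w) <= cdf_at X z.
    by apply: le_cdf_at (ch _ _) (ramp01 _ _) _ => x zx; apply: ramp0; rewrite ?subrK.
  have := cdf_normal_lipschitz (z - e) lZ (ltW e0); rewrite subrK -/K; lra.
have := close z e; rewrite ler_distl => /andP[_ h].
have h1 := cdf_at_le X (ch z e) (ramp01 _ _) (fun x => @ramp1 _ z e e0 x).
have h2 := le_cdf_at Z (ch z e) (ramp01 _ _) (fun x => @ramp0 _ z e e0 x).
have := cdf_normal_lipschitz z lZ (ltW e0); rewrite -/K; lra.
Qed.

(** * The rate for Hermite variations *)

Section rate.
Context {R : realType}.
Variables (q : nat) (H : R).
Hypotheses (hq : (2 <= q)%N) (hH0 : 0 < H) (hH1 : H < (2 * q%:R - 1) / (2 * q%:R)).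

Let q2 : 2 <= q%:R :> R. Proof. by rewrite (ler_nat R 2). Qed.

(** The hypothesis on [H] says that q (2 - 2H) > 1: the series of the [rho(t)^q]
   converges. *)
Let critical : 2 * q%:R * H < 2 * q%:R - 1.
Proof.
have q0 : 0 < 2 * q%:R :> R by have := q2; lra.
by have := hH1; rewrite ltr_pdivlMr// => h; lra.
Qed.

Let H1 : H < 1. Proof.
have := critical; have := q2; rewrite ltNge => h1 h2; apply/negP => h3; nra.
Qed.

Let H01 : 0 < H < 1. Proof. by rewrite hH0. Qed.

(** The threshold between the last two ranges is where their exponents agree. *)
Let threshold_le : (H <= (2 * q%:R - 3) / (2 * q%:R - 2)) =
  (q%:R * H - q%:R + 1 / 2 <= H - 1).
Proof.
rewrite ler_pdivlMr; last by have := q2; lra.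
by apply/idP/idP => ?; lra.
Qed.

Let threshold_ge : ((2 * q%:R - 3) / (2 * q%:R - 2) <= H) =
  (H - 1 <= q%:R * H - q%:R + 1 / 2).
Proof.
rewrite ler_pdivrMr; last by have := q2; lra.
by apply/idP/idP => ?; lra.
Qed.

(** The decay exponent is 2 - 2H, except at [H = 1/2], where [fcov H] vanishes off 0. *)
Lemma fcov_rate : exists a delta : R, [/\ decay 4 a (fun t => `|fcov H t|),
  regime a q delta, H <= 1 / 2 -> - (1 / 2) = - delta,
  1 / 2 <= H <= (2 * q%:R - 3) / (2 * q%:R - 2) -> H - 1 = - delta &
  (2 * q%:R - 3) / (2 * q%:R - 2) <= H -> q%:R * H - q%:R + 1 / 2 = - delta].
Proof.
rewrite threshold_le threshold_ge; have := q2; have := critical; have := H1 => lt1 cr q2'.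
have dec := fcov_decay H01.
have [Hlt|[Hgt|He]] : H < 1 / 2 \/ 1 / 2 < H \/ H = 1 / 2.
  by case: (ltgtP H (1 / 2)); auto.
- exists (2 - 2 * H), (1 / 2); split; [exact: dec|apply: regime_short => //; lra|..] => //.
  + by move=> /andP[h _]; lra.
  + by move=> h; nra.
- have [le|ge] := orP (le_total (q%:R * H - q%:R + 1 / 2) (H - 1)).
    exists (2 - 2 * H), (1 - H); split; [exact: dec|apply: regime_long; lra|..].
    + by move=> h; lra.
    + by move=> _; lra.
    + by move=> h; lra.
  exists (2 - 2 * H), (q%:R - q%:R * H - 1 / 2); split; [exact: dec|apply: regime_long; lra|..].
  + by move=> h; lra.
  + by move=> /andP[_ h]; lra.
  + by move=> _; lra.
- exists 2, (1 / 2); split; [|apply: regime_short => //; lra|..] => //.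
  + split; first by rewrite fcov0// normr1; lra.
    move=> t; split => // t0; rewrite -(prednK t0) fcov_half//; last by lra.
    by rewrite normr0 mulr_ge0// powR_ge0.
  + by move=> _; lra.
  + by move=> h; rewrite He in h *; nra.
Qed.

Let S := sumZ (fun t => rho H t ^+ q).

Let cvg_S : (fcov H 0 ^+ q + 2 * \sum_(1 <= t < M) fcov H t ^+ q) @[M --> \oo] --> S.
Proof. by apply: sumZ_fcov => //; have := critical; lra. Qed.

Lemma sumZ_rho_gt0 : 0 < S.
Proof.
apply: (@lt_le_trans _ _ 2^-1); first by rewrite invr_gt0.
apply: (cvgr_to_ge cvg_S); apply: nearW => M.
exact: fcov_partial_sum_ge.
Qed.

Let kappa (n : nat) : R := (sigma q H * Num.sqrt n%:R)^-1.

Let kappaE n : (0 < n)%N -> kappa n ^+ 2 = q`!%:R / (S * n%:R).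
Proof.
move=> n0; have S0 := sumZ_rho_gt0.
have f0 : 0 < q`!%:R :> R by rewrite ltr0n fact_gt0.
rewrite /kappa exprVn exprMn /sigma -/S !sqr_sqrtr ?ler0n//; last first.
  by rewrite mulr_ge0 ?invr_ge0// ltW.
by rewrite !invfM invrK mulrA.
Qed.

(** Uniformity in [h] is what both the convergence in law and the Kolmogorov distance
   require. *)
Lemma hermite_variation_rate : exists delta K : R, [/\ 0 < delta, 0 <= K,
  [/\ H <= 1 / 2 -> - (1 / 2) = - delta,
    1 / 2 <= H <= (2 * q%:R - 3) / (2 * q%:R - 2) -> H - 1 = - delta &
    (2 * q%:R - 3) / (2 * q%:R - 2) <= H -> q%:R * H - q%:R + 1 / 2 = - delta] &
  forall (d : measure_display) (T : measurableType d) (P : probability T R)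
    (B : R -> {RV P >-> R}) (n : nat) (h : R -> R) (M : R), fBm H B -> (0 < n)%N ->
    continuous h -> (forall x, `|h x| <= M) ->
    `|\int[P]_w h (Z_ q H B n w) - normal_mean h| <= M * (K * n%:R `^ (- delta))].
Proof.
have [a [delta [dec reg r1 r2 r3]]] := fcov_rate.
have [/andP[d0 _] _ _ _] := reg.
have qS : q = q.-1.+1 by rewrite prednK// (leq_trans _ hq).
have q1 : (0 < q.-1)%N by rewrite -ltnS -qS.
have := @stein_factor_rate R 4 a delta S q.-1 (fcov H) _ _ q1 (fcov0 H01) dec sumZ_rho_gt0.
rewrite -qS => /(_ _ reg cvg_S)[|K K0 hK]; first by [].
exists delta, (4 * K); split=> [//|||d T P B n h M fB n0 ch hM].
  by rewrite mulr_ge0.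
  by split.
have [N GF] := fBm_gaussian_family H01 fB n0.
have M0 : 0 <= M by apply: le_trans (hM 0).
have var1 i : fcov H (dist i i) = 1 by rewrite /dist subnn fcov0.
have -> : \int[P]_w h (Z_ q H B n w) =
    \int[P]_w h (hermite_sum (X := increment H B (n := n)) q.-1 (kappa n) w).
  apply: eq_Rintegral => w _; congr h.
  by rewrite /hermite_sum -qS -mulr_sumr [LHS]/= /Z_fun big_mkord.
apply: le_trans (stein_bound GF var1 q.-1 (kappa n) ch hM) _.
rewrite [leRHS](_ : _ = 4 * M * (K * n%:R `^ (- delta))); last by ring.
rewrite ler_wpM2l ?mulr_ge0//; apply: (hK _ _ _ N) => //.
exact: kappaE.
Qed.

End rate.

(** * The quantitative Breuer-Major theorem *)

Lemma powRN_small {R : realType} (delta e : R) : 0 < delta -> 0 < e ->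
  \forall n \near \oo, n%:R `^ (- delta) <= e.
Proof.
move=> d0 e0; near=> n.
have n_gt : e `^ (- delta^-1) < n%:R by near: n; exact: nbhs_infty_gtr.
have n0 : 0 < n%:R :> R by apply: le_lt_trans n_gt; exact: powR_ge0.
rewrite powRN -[leRHS]invrK lef_pV2 ?posrE ?powR_gt0 ?invr_gt0//.
have -> : e^-1 = (e `^ (- delta^-1)) `^ delta.
  by rewrite -powRrM mulNr mulVf ?gt_eqF// powR_inv1 ?ltW.
by rewrite ge0_ler_powR ?nnegrE ?ltW// powR_gt0.
Unshelve. all: by end_near. Qed.

Theorem theorem4p1 (R : realType) (q : nat) (H : R)
    (hq : (2 <= q)%N)
    (hH0 : 0 < H) (hH1 : H < (2 * q%:R - 1) / (2 * q%:R)) :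
  (forall (d : measure_display) (T : measurableType d) (P : probability T R)
          (B : R -> {RV P >-> R}), fBm H B ->
   forall (d' : measure_display) (T' : measurableType d')
          (Q : probability T' R) (Z : {RV Q >-> R}), has_normal_law Z 0 1 ->
     cvg_in_law (Z_ q H B) Z)
  /\
  exists c : R,
   forall (d : measure_display) (T : measurableType d) (P : probability T R)
          (B : R -> {RV P >-> R}), fBm H B ->
   forall (d' : measure_display) (T' : measurableType d')
          (Q : probability T' R) (Z : {RV Q >-> R}), has_normal_law Z 0 1 ->
   forall n : nat, (1 <= n)%N ->
     [/\ H <= 1 / 2 ->
           (kolmogorov_dist (Z_ q H B n) Z
              <= (c * n%:R `^ (- (1 / 2)))%:E)%E,
         1 / 2 <= H <= (2 * q%:R - 3) / (2 * q%:R - 2) ->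
           (kolmogorov_dist (Z_ q H B n) Z
              <= (c * n%:R `^ (H - 1))%:E)%E
       & (2 * q%:R - 3) / (2 * q%:R - 2) <= H ->
           (kolmogorov_dist (Z_ q H B n) Z
              <= (c * n%:R `^ (q%:R * H - q%:R + 1 / 2))%:E)%E ].
Proof.
have [delta [K [d0 K0 [r1 r2 r3] rate]]] := hermite_variation_rate hq hH0 hH1.
split=> [d T P B fB d' T' Q Z lZ f cf bf|].
  have [M fM] : exists M, forall x, `|f x| <= M.
    have [M0 [_ hM]] := bf; exists (M0 + 1) => x.
    by apply: (hM (M0 + 1)); rewrite ?ltrDl.
  have fin (d1 : measure_display) (T1 : measurableType d1) (P1 : probability T1 R)
      (X : {RV P1 >-> R}) : ('E_P1[f \o X] = (\int[P1]_w f (X w))%:E)%E.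
    rewrite unlock /Rintegral fineK//; apply: integrable_fin_num => //.
    apply: (@integrable_bounded _ _ _ _ _ M) => [|w]; last exact: fM.
    by apply: measurableT_comp => //; exact: continuous_measurable_fun.
  have EZ : \int[Q]_w f (Z w) = normal_mean f.
    rewrite /normal_mean; apply: Rintegral_law lZ _ _.
      exact: continuous_measurable_fun.
    exact: integrable_bounded_normal cf fM.
  rewrite (_ : (fun n => _) = (fun n => (\int[P]_w f (Z_ q H B n w))%:E)); last first.
    by apply/funext => n; rewrite fin.
  rewrite fin EZ; apply: cvg_EFin; first by apply: nearW.
  have M0 : 0 <= M by apply: le_trans (fM 0).
  have C0 : 0 < M * K + 1 by rewrite ltr_wpDl// mulr_ge0.
  apply/cvgrPdist_le => e e0; near=> n.
  rewrite distrC; apply: le_trans (rate _ _ _ _ n _ _ fB _ cf fM) _; first by near: n; exists 1%N.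
  rewrite mulrA; apply: (@le_trans _ _ ((M * K + 1) * n%:R `^ (- delta))).
    by rewrite ler_wpM2r ?powR_ge0// lerDl.
  rewrite mulrC -ler_pdivlMr//.
  by near: n; apply: powRN_small => //; rewrite divr_gt0.
exists K => d T P B fB d' T' Q Z lZ n n0.
have kol : (kolmogorov_dist (Z_ q H B n) Z <= (K * n%:R `^ (- delta))%:E)%E.
  apply: kolmogorov_dist_smooth => // h ch h1.
  by rewrite -[leRHS]mul1r; exact: rate.
by split=> [/r1 ->|/r2 ->|/r3 ->].
Unshelve. all: by end_near. Qed.
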